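(* Let $A$ and $B$ be two finite dimensional $k$-algebras. Assume that $B$ is triangular and $k$ is a splitting field for $B$. Then the three categories $(A\otimes_k B)\text{-}\mathsf{Gproj}$, $\mathsf{Mon}(B, A\text{-}\mathsf{Gproj})$ and $\mathsf{filt}(A\text{-}\mathsf{Gproj}\otimes_k B\text{-}\mathsf{Gproj})$ are the same, where $\mathsf{filt}(A\text{-}\mathsf{Gproj}\otimes_k B\text{-}\mathsf{Gproj})$ is the smallest full subcategory of $(A\otimes_k B)\text{-mod}$ containing $A\text{-}\mathsf{Gproj}\otimes_k B\text{-}\mathsf{Gproj}$ and closed under extensions.
   Context: $k$ is a fixed field; all algebras are finite dimensional $k$-algebras; $\otimes=\otimes_k$; modules are finitely generated left modules unless stated otherwise. $D=\mathrm{Hom}_k(-,k)$. Put $\Lambda:=A\otimes B$. Subcategories are full and closed under isomorphism. $B$ is triangular if its Ext-quiver (vertices: isoclasses of simple modules; arrows given by nonzero $\mathrm{Ext}^1$ between simples) has no oriented cycles. $k$ is a splitting field for $B$ if every simple $B$-module has endomorphism algebra $k$. A $\Gamma$-module $G$ is Gorenstein projective if there is an exact complex $P^\bullet=(\cdots\to P^{i}\xrightarrow{d^i}P^{i+1}\to\cdots)$ of finitely generated projective $\Gamma$-modules with $G=\mathrm{Ker}\,d^1$ such that $\mathrm{Hom}_\Gamma(P^\bullet,{}_\Gamma\Gamma)$ is exact; $\Gamma\text{-}\mathsf{Gproj}$ is the full subcategory of $\Gamma\text{-mod}$ of Gorenstein projective modules. $\mathsf{Mon}(B,A)$ is the full subcategory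 of $\Lambda\text{-mod}$ consisting of the modules $X$ with $\mathrm{Tor}_i^{\Lambda}(A\otimes D(S),X)=0$ for all $i\ge 1$ and all simple left $B$-modules $S$. For a full additive subcategory $\mathscr{L}$ of $A\text{-mod}$, $\mathsf{Mon}(B,\mathscr{L})$ is the full subcategory of those $X\in\mathsf{Mon}(B,A)$ such that the left $A$-module $(A\otimes V)\otimes_\Lambda X$ lies in $\mathscr{L}$ for every finitely generated right $B$-module $V$. For $\mathscr{X}\subseteq A\text{-mod}$, $\mathscr{Y}\subseteq B\text{-mod}$, $\mathscr{X}\otimes_k\mathscr{Y}:=\{X\otimes_k Y\mid X\in\mathscr{X},Y\in\mathscr{Y}\}$. For a class $\mathscr{X}$ of $\Gamma$-modules, $\mathsf{filt}(\mathscr{X})$ is the full subcategory of $\Gamma\text{-mod}$ of modules $X$ admitting a finite filtration $0=X_0\subset X_1\subset\cdots\subset X_m=X$ by submodules with all $X_i/X_{i-1}$ in $\mathscr{X}$ (up to isomorphism). *)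

(* Defs.v *)
From HB Require Import structures.
From mathcomp Require Import all_boot all_algebra falgebra.

Set Implicit Arguments.
Unset Strict Implicit.
Unset Printing Implicit Defensive.

Import GRing.Theory.
Import VectorInternalTheory.
Local Open Scope ring_scope.

(* U ⊗_k V, realised on the coordinate matrices with respect to the canonical *)
(* bases of U and V; tlift_pure and tens_ext are its universal property.      *)
Definition tens (k : fieldType) (U V : vectType k) : Type :=
  'M[k]_(dim U, dim V).
HB.instance Definition _ (k : fieldType) (U V : vectType k) :=
  Vector.on (tens U V).

Section Tensor.
Context {k : fieldType}.
Implicit Types U V W : vectType k.

Definition tpure {U V} (u : U) (v : V) : tens U V := (v2r u)^T *m v2r v.

Definition bilin {U V W} (f : U -> V -> W) :=
  (forall v, linear (f^~ v)) /\ (forall u, linear (f u)).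

Definition tlift {U V W} (f : U -> V -> W) (t : tens U V) : W :=
  \sum_i \sum_j t i j *: f (r2v (delta_mx 0 i)) (r2v (delta_mx 0 j)).

Lemma tlift_is_linear U V W (f : U -> V -> W) : linear (tlift f).
Proof.
move=> c s t; rewrite /tlift scaler_sumr -big_split /=; apply: eq_bigr => i _.
rewrite scaler_sumr -big_split /=; apply: eq_bigr => j _.
by rewrite !mxE scalerDl scalerA.
Qed.
HB.instance Definition _ U V W (f : U -> V -> W) :=
  GRing.isLinear.Build k (tens U V) W _ (tlift f) (tlift_is_linear f).

Lemma tpure_bilin U V : bilin (@tpure U V).
Proof.
split=> [v c u u' | u c v v']; rewrite /tpure.
  by rewrite linearP /= linearP /= mulmxDl scalemxAl.
by rewrite linearP /= mulmxDr scalemxAr.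
Qed.

Lemma bilin_suml U V W (f : U -> V -> W) I (r : seq I) (c : I -> k) u v :
  bilin f -> f (\sum_(i <- r) c i *: u i) v = \sum_(i <- r) c i *: f (u i) v.
Proof.
case=> fl _; pose g : {linear U -> W} := HB.pack (f^~ v)
  (GRing.isLinear.Build k U W _ (f^~ v) (fl v)).
rewrite -[LHS]/(g _) linear_sum; apply: eq_bigr => i _; exact: linearZ.
Qed.

Lemma bilin_sumr U V W (f : U -> V -> W) I (r : seq I) (c : I -> k) u v :
  bilin f -> f u (\sum_(i <- r) c i *: v i) = \sum_(i <- r) c i *: f u (v i).
Proof.
case=> _ fr; pose g : {linear V -> W} := HB.pack (f u)
  (GRing.isLinear.Build k V W _ (f u) (fr u)).
rewrite -[LHS]/(g _) linear_sum; apply: eq_bigr => i _; exact: linearZ.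
Qed.

Lemma r2v_basis U (u : U) :
  u = \sum_i v2r u 0 i *: (r2v (delta_mx 0 i) : U).
Proof.
rewrite -{1}[u]v2rK {1}[v2r u]row_sum_delta linear_sum.
by apply: eq_bigr => i _; exact: linearZ.
Qed.

Lemma tlift_pure U V W (f : U -> V -> W) u v :
  bilin f -> tlift f (tpure u v) = f u v.
Proof.
move=> fB; rewrite [in RHS](r2v_basis u) (bilin_suml _ _ _ _ fB).
apply: eq_bigr => i _; rewrite [in RHS](r2v_basis v) (bilin_sumr _ _ _ _ fB).
rewrite scaler_sumr; apply: eq_bigr => j _.
by rewrite scalerA /tpure !mxE big_ord1 !mxE.
Qed.

Lemma tens_ind U V (P : tens U V -> Prop) :
    (forall u v, P (tpure u v)) -> (forall s t, P s -> P t -> P (s + t)) ->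
  forall t, P t.
Proof.
move=> Pp PD t; have P0 : P 0.
  by have := Pp 0 0; rewrite /tpure [v2r (0 : V)]linear0 mulmx0.
rewrite [t]matrix_sum_delta.
apply: (big_ind P) => // i _; apply: (big_ind P) => // j _.
have -> : t i j *: delta_mx i j =
    tpure (t i j *: r2v (delta_mx 0 i)) (r2v (delta_mx 0 j)) :> tens U V.
  rewrite /tpure linearZ /= !r2vK linearZ /= trmx_delta -scalemxAl.
  by rewrite mul_delta_mx.
exact: Pp.
Qed.

Lemma tens_ext U V W (f g : {linear tens U V -> W}) :
  (forall u v, f (tpure u v) = g (tpure u v)) -> f =1 g.
Proof. by move=> fg; elim/tens_ind=> // s t es et; rewrite !linearD es et. Qed.

Definition tmap {U V U' V'} (f : 'Hom(U, U')) (g : 'Hom(V, V')) :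
    'Hom(tens U V, tens U' V') :=
  linfun (tlift (fun u v => tpure (f u) (g v)) : tens U V -> tens U' V').

Lemma tmap_bilin0 U V U' V' (f : 'Hom(U, U')) (g : 'Hom(V, V')) :
  bilin (fun u v => tpure (f u) (g v)).
Proof.
have [Bl Br] := tpure_bilin U' V'.
by split=> [v c u u' | u c v v']; rewrite linearP ?Bl ?Br.
Qed.

Lemma tmapE U V U' V' (f : 'Hom(U, U')) (g : 'Hom(V, V')) u v :
  tmap f g (tpure u v) = tpure (f u) (g v).
Proof. by rewrite lfunE /= tlift_pure //; exact: tmap_bilin0. Qed.

Lemma tens_lfun_ext U V W (f g : 'Hom(tens U V, W)) :
  (forall u v, f (tpure u v) = g (tpure u v)) -> f = g.
Proof. by move=> fg; apply/lfunP; exact: tens_ext. Qed.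

Lemma tmap1 U V : tmap \1%VF \1%VF = \1%VF :> 'End(tens U V).
Proof. by apply: tens_lfun_ext => u v; rewrite tmapE !id_lfunE. Qed.

Lemma tmap_comp U V U' V' U'' V'' (f' : 'Hom(U', U'')) (g' : 'Hom(V', V''))
    (f : 'Hom(U, U')) (g : 'Hom(V, V')) :
  tmap (f' \o f)%VF (g' \o g)%VF = (tmap f' g' \o tmap f g)%VF.
Proof. by apply: tens_lfun_ext => u v; rewrite comp_lfunE !tmapE !comp_lfunE. Qed.

Lemma tmap_bilin U V U' V' : bilin (@tmap U V U' V').
Proof.
have [Bl Br] := tpure_bilin U' V'.
split=> [g c f f' | f c g g']; apply: tens_lfun_ext => u v.
  by rewrite add_lfunE scale_lfunE !tmapE add_lfunE scale_lfunE Bl.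
by rewrite add_lfunE scale_lfunE !tmapE add_lfunE scale_lfunE Br.
Qed.

End Tensor.
Arguments tens {k} U V.

(* The k-algebra A ⊗_k B, with (a ⊗ b)(a' ⊗ b') = aa' ⊗ bb'. *)
Section TensorAlgebra.
Context {k : fieldType} (A B : falgType k).
Implicit Types s t u : tens A B.

Definition tmul s t : tens A B :=
  tlift (fun a b => tlift (fun a' b' => tpure (a * a') (b * b')) t) s.
Definition tone : tens A B := tpure 1 1.

Let tind := @tens_ind k A B.
Let tliftD (f : A -> B -> tens A B) t t' :
  tlift f (t + t') = tlift f t + tlift f t'.
Proof. exact: linearD. Qed.

Let mul_bilin (a : A) (b : B) :
  bilin (fun a' b' => tpure (a * a') (b * b')).
Proof.
have [Bl Br] := tpure_bilin A B.
by split=> [v c x y | v c x y]; rewrite mulrDr -scalerAr ?Bl ?Br.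
Qed.

Lemma tmulP t : bilin (fun (a : A) (b : B) =>
  tlift (fun a' b' => tpure (a * a') (b * b')) t).
Proof.
have [Bl Br] := tpure_bilin A B.
split=> [v c x y | v c x y]; elim/tind: t => [a b | t t' IH IH'].
- by rewrite !tlift_pure // mulrDl -scalerAl Bl.
- by rewrite !tliftD IH IH' scalerDr addrACA.
- by rewrite !tlift_pure // mulrDl -scalerAl Br.
- by rewrite !tliftD IH IH' scalerDr addrACA.
Qed.

Lemma tmul_pure a b a' b' :
  tmul (tpure a b) (tpure a' b') = tpure (a * a') (b * b').
Proof. by rewrite /tmul tlift_pure ?tlift_pure //; exact: tmulP. Qed.

Lemma tmul_linearl t : linear (tmul^~ t).
Proof. by move=> c s s'; rewrite /tmul linearP. Qed.
Lemma tmul_linearr s : linear (tmul s).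
Proof.
move=> c t t'; elim/tind: s => [a b | s s' IH IH'].
  by rewrite /tmul !tlift_pure ?linearP //; exact: tmulP.
have mD r : tmul (s + s') r = tmul s r + tmul s' r by exact: tliftD.
by rewrite !mD IH IH' scalerDr addrACA.
Qed.
Lemma tmulDl : left_distributive tmul +%R.
Proof. by move=> s s' t; rewrite -[s]scale1r tmul_linearl !scale1r. Qed.
Lemma tmulDr : right_distributive tmul +%R.
Proof. by move=> s t t'; rewrite -[t]scale1r tmul_linearr !scale1r. Qed.
Lemma tmulA : associative tmul.
Proof.
move=> s t u; elim/tind: s => [a b | s s' IH IH']; last first.
  by rewrite !tmulDl IH IH'.
elim/tind: t => [a' b' | s s' IH IH']; last first.
  by rewrite !tmulDl !tmulDr !tmulDl IH IH'.
elim/tind: u => [a'' b'' | s s' IH IH']; last by rewrite !tmulDr IH IH'.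
by rewrite !tmul_pure !mulrA.
Qed.
Lemma tmul1 : left_id tone tmul.
Proof.
elim/tind=> [a b | s s' IH IH']; last by rewrite tmulDr IH IH'.
by rewrite tmul_pure !mul1r.
Qed.
Lemma tmulr1 : right_id tone tmul.
Proof.
elim/tind=> [a b | s s' IH IH']; last by rewrite tmulDl IH IH'.
by rewrite tmul_pure !mulr1.
Qed.
Lemma tone_neq0 : tone != 0.
Proof.
have nz (C : falgType k) : exists i, v2r (1 : C) 0 i != 0.
  apply/existsP; apply: contraNT (oner_neq0 C); rewrite negb_exists => /forallP h.
  apply/eqP/v2r_inj; apply/rowP=> i; rewrite linear0 mxE.
  by apply/eqP; have := h i; rewrite negbK.
have [[i ni] [j nj]] := (nz A, nz B).
apply/eqP=> /matrixP/(_ i j); rewrite /tone /tpure !mxE big_ord1 !mxE.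
by move/eqP; rewrite mulf_eq0 (negPf ni) (negPf nj).
Qed.

HB.instance Definition _ := GRing.Zmodule_isNzRing.Build (tens A B)
  tmulA tmul1 tmulr1 tmulDl tmulDr tone_neq0.

Lemma tscaleAl (c : k) s t : c *: (s * t) = (c *: s) * t.
Proof.
have z : tmul 0 t = 0 := mul0r (t : tens A B).
by have := tmul_linearl t c s 0; rewrite addr0 z addr0 => /esym.
Qed.
Lemma tscaleAr (c : k) s t : c *: (s * t) = s * (c *: t).
Proof.
have z : tmul s 0 = 0 := mulr0 (s : tens A B).
by have := tmul_linearr s c t 0; rewrite addr0 z addr0 => /esym.
Qed.
HB.instance Definition _ :=
  GRing.Lmodule_isLalgebra.Build k (tens A B) tscaleAl.
HB.instance Definition _ :=
  GRing.Lalgebra_isAlgebra.Build k (tens A B) tscaleAr.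
HB.instance Definition _ := Algebra_isFalgebra.Build k (tens A B).

End TensorAlgebra.

(* W / U, realised on the canonical complement of U. *)
Section QuotientSpace.
Context {k : fieldType} {W : vectType k}.
Implicit Type U : {vspace W}.

Definition quotv U : vectType k := subvs_of (U^C)%VS.
Definition qproj U : 'Hom(W, quotv U) :=
  linfun (vsproj (U^C)%VS \o daddv_pi (U^C)%VS U).
Definition qsec U : 'Hom(quotv U, W) := linfun vsval.

Let capC U : (U^C :&: U = 0)%VS. Proof. by rewrite capvC capv_compl. Qed.

Lemma qsecK U : (qproj U \o qsec U)%VF = \1%VF.
Proof.
apply/lfunP=> w; rewrite comp_lfunE id_lfunE lfunE /= [qsec U w]lfunE /=.
by rewrite daddv_pi_id ?capC ?subvsP ?vsvalK.
Qed.

Lemma qsecE U w : qproj U (qsec U w) = w.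
Proof. by rewrite -comp_lfunE qsecK id_lfunE. Qed.

Lemma qprojK U w : w - qsec U (qproj U w) \in U.
Proof.
rewrite lfunE /= lfunE /= vsprojK ?memv_pi //.
have wUC : w \in (U^C + U)%VS by rewrite addvC addv_complf memvf.
by rewrite -{1}(daddv_pi_add (capC U) wUC) addrAC subrr add0r memv_pi.
Qed.

Lemma lker_qproj U : lker (qproj U) = U.
Proof.
apply/vspaceP=> w; rewrite memv_ker; apply/idP/idP => [/eqP w0 | wU].
  by have := qprojK U w; rewrite w0 linear0 subr0.
suff w0 : qsec U (qproj U w) = 0.
  by rewrite -[qproj U w]qsecE w0 linear0.
apply/eqP; rewrite -memv0 -(capC U) memv_cap; apply/andP; split.
  by rewrite lfunE; exact: subvsP.
by rewrite -[X in X \in U](subKr w) rpredB ?qprojK.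
Qed.

Lemma limg_qproj U : limg (qproj U) = fullv.
Proof.
apply/eqP; rewrite eqEsubv subvf; apply/subvP=> w _.
rewrite -[w]qsecE; exact/memv_img/memvf.
Qed.

End QuotientSpace.

(* A finitely generated left A-module, that is, a finite dimensional k-space  *)
(* with an action of A by a homomorphism of k-algebras.                       *)
Record lmod (k : fieldType) (A : falgType k) := Lmod {
  lm_sort :> vectType k;
  lact : A -> 'End(lm_sort);
  lact_linear : linear lact;
  lact1 : lact 1 = \1%VF;
  lactM : forall a b, lact (a * b) = (lact a \o lact b)%VF }.

Record rmod (k : fieldType) (A : falgType k) := Rmod {
  rm_sort :> vectType k;
  ract : A -> 'End(rm_sort);
  ract_linear : linear ract;
  ract1 : ract 1 = \1%VF;
  ractM : forall a b, ract (a * b) = (ract b \o ract a)%VF }.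

(* A-C-bimodules on which k acts centrally *)
Record bimod (k : fieldType) (A C : falgType k) := Bimod {
  bm_lmod :> lmod A;
  bract : C -> 'End(bm_lmod);
  bract_linear : linear bract;
  bract1 : bract 1 = \1%VF;
  bractM : forall a b, bract (a * b) = (bract b \o bract a)%VF;
  bm_comm : forall a c, (lact bm_lmod a \o bract c = bract c \o lact bm_lmod a)%VF }.

Arguments lact {k A} M a : rename.
Arguments ract {k A} M a : rename.
Arguments bract {k A C} M a : rename.

Definition bm_rmod (k : fieldType) (A C : falgType k) (V : bimod A C) : rmod C :=
  Rmod (@bract_linear k A C V) (bract1 V) (@bractM k A C V).

Section Modules.
Context {k : fieldType} {A : falgType k}.
Implicit Types M N E P S X Y : lmod A.

Definition is_hom M N (f : 'Hom(M, N)) :=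
  forall a, (f \o lact M a = lact N a \o f)%VF.

Definition isomorphic M N :=
  exists f : 'Hom(M, N), [/\ is_hom f, lker f = 0%VS & limg f = fullv].

Definition short_exact M E N (i : 'Hom(M, E)) (p : 'Hom(E, N)) :=
  [/\ is_hom i, is_hom p, lker i = 0%VS, limg i = lker p & limg p = fullv].

Record submod M := Submod {
  sm_vs :> {vspace M};
  sm_stable : forall a, (lact M a @: sm_vs <= sm_vs)%VS }.

Section SubQuotient.
Variables (M : lmod A) (N : submod M).

Let subN a x : x \in (N : {vspace M}) -> lact M a x \in (N : {vspace M}).
Proof. by move=> xN; apply: (subvP (sm_stable N a)); exact: memv_img. Qed.

Definition sub_act (a : A) : 'End(subvs_of N) :=
  (linfun (vsproj N) \o lact M a \o linfun vsval)%VF.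

Let sub_actE a x : vsval (sub_act a x) = lact M a (vsval x).
Proof. by rewrite !comp_lfunE !lfunE /= vsprojK ?subN ?subvsP. Qed.

Lemma sub_act_linear : linear sub_act.
Proof.
move=> c a b; apply/lfunP=> x; apply/val_inj; rewrite /= sub_actE.
by rewrite lact_linear !add_lfunE !scale_lfunE !linearP /= !sub_actE.
Qed.
Lemma sub_act1 : sub_act 1 = \1%VF.
Proof.
by apply/lfunP=> x; apply/val_inj; rewrite /= sub_actE lact1 !id_lfunE.
Qed.
Lemma sub_actM a b : sub_act (a * b) = (sub_act a \o sub_act b)%VF.
Proof.
apply/lfunP=> x; apply/val_inj.
have -> : (sub_act a \o sub_act b)%VF x = sub_act a (sub_act b x).
  exact: comp_lfunE.
by rewrite /= !sub_actE lactM comp_lfunE.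
Qed.

Definition sub_lmod : lmod A := Lmod sub_act_linear sub_act1 sub_actM.

Definition quot_act (a : A) : 'End(quotv N) :=
  (qproj N \o lact M a \o qsec N)%VF.

Let quot_actE a x : quot_act a (qproj N x) = qproj N (lact M a x).
Proof.
rewrite !comp_lfunE; apply/eqP; rewrite -subr_eq0 -!linearB -memv_ker lker_qproj.
by rewrite -opprB linearN rpredN; exact/subN/qprojK.
Qed.
Let quot_ext (f g : 'End(quotv N)) :
  (forall x, f (qproj N x) = g (qproj N x)) -> f = g.
Proof.
by move=> fg; apply/lfunP=> x; rewrite -[x]qsecE fg.
Qed.

Lemma quot_act_linear : linear quot_act.
Proof.
move=> c a b; apply: quot_ext => x; rewrite quot_actE lact_linear.
by rewrite !add_lfunE !scale_lfunE linearP !quot_actE.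
Qed.
Lemma quot_act1 : quot_act 1 = \1%VF.
Proof. by apply: quot_ext => x; rewrite quot_actE lact1 !id_lfunE. Qed.
Lemma quot_actM a b : quot_act (a * b) = (quot_act a \o quot_act b)%VF.
Proof.
by apply: quot_ext => x; rewrite quot_actE lactM [in RHS]comp_lfunE !quot_actE comp_lfunE.
Qed.

Definition quot_lmod : lmod A := Lmod quot_act_linear quot_act1 quot_actM.

End SubQuotient.

Section SubIn.
Variables (M : lmod A) (N N' : submod M).
Lemma sub_in_stable a :
  (lact (sub_lmod N) a @: (linfun (vsval (U := N)) @^-1: N')
     <= linfun (vsval (U := N)) @^-1: N')%VS.
Proof.
apply/subvP=> _ /memv_imgP[x xN' ->]; move: xN'; rewrite -!memv_preim !lfunE /=.
move=> xN'; rewrite !comp_lfunE !lfunE /= vsprojK.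
  by apply: (subvP (sm_stable N' a)); exact: memv_img.
by apply: (subvP (sm_stable N a)); exact/memv_img/subvsP.
Qed.
(* N ∩ N' as a submodule of N *)
Definition sub_in : submod (sub_lmod N) := Submod sub_in_stable.
End SubIn.

Lemma amull_linear : linear (@amull k A).
Proof. exact: linearP. Qed.
Lemma amull_mul (a b : A) : amull (a * b) = (amull a \o amull b)%VF.
Proof. by apply/lfunP=> x; rewrite comp_lfunE !lfunE /= mulrA. Qed.

Definition regular_lmod : lmod A := Lmod amull_linear (@amull1 k A) amull_mul.

Definition projective P :=
  forall M N (g : 'Hom(M, N)) (f : 'Hom(P, N)),
    is_hom g -> limg g = fullv -> is_hom f ->
  exists h : 'Hom(P, M), is_hom h /\ (g \o h)%VF = f.

Definition simple S :=
  (fullv : {vspace S}) <> 0%VS /\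
  forall N : submod S, (N : {vspace S}) = 0%VS \/ (N : {vspace S}) = fullv.

(* Ext^1(N, M) <> 0, in terms of Yoneda classes of extensions *)
Definition Ext1_neq0 N M :=
  exists (E : lmod A) (i : 'Hom(M, E)) (p : 'Hom(E, N)), short_exact i p /\
    ~ exists s : 'Hom(N, E), is_hom s /\ (p \o s)%VF = \1%VF.

Definition Gproj (G : lmod A) :=
  exists (P : int -> lmod A) (d : forall i : int, 'Hom(P i, P (i + 1))),
  [/\ forall i, projective (P i) /\ is_hom (d i),
      forall i, limg (d i) = lker (d (i + 1)),
      forall i (f : 'Hom(P (i + 1), regular_lmod)), is_hom f ->
        (f \o d i)%VF = 0 ->
        exists g : 'Hom(P (i + 1 + 1), regular_lmod),
          is_hom g /\ f = (g \o d (i + 1))%VF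
    & exists e : 'Hom(G, P 1),
        [/\ is_hom e, lker e = 0%VS & limg e = lker (d 1)] ].

Definition iso_closed (F : lmod A -> Prop) :=
  forall M N, isomorphic M N -> F M -> F N.

Definition ext_closed (F : lmod A -> Prop) :=
  forall M E N (i : 'Hom(M, E)) (p : 'Hom(E, N)),
    short_exact i p -> F M -> F N -> F E.

Definition filt (L : lmod A -> Prop) X :=
  exists (m : nat) (F : nat -> submod X),
  [/\ (F 0 : {vspace X}) = 0%VS, (F m : {vspace X}) = fullv
    & forall i, (i < m)%N -> (F i <= F i.+1)%VS /\
        exists2 Y, L Y & isomorphic (quot_lmod (sub_in (F i.+1) (F i))) Y ].

Definition smallest_ext_closed (L F : lmod A -> Prop) :=
  [/\ iso_closed F, ext_closed F, (forall X, L X -> F X)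
    & forall C : lmod A -> Prop, iso_closed C -> ext_closed C ->
        (forall X, L X -> C X) -> forall X, F X -> C X].

End Modules.

(* A closed walk S_0 -> S_1 -> ... -> S_n -> S_0 in the Ext-quiver is given   *)
(* by representatives of its vertices.                                        *)
Definition triangular (k : fieldType) (B : falgType k) :=
  forall (n : nat) (S : 'I_n.+1 -> lmod B), (forall i, simple (S i)) ->
    ~ forall i, Ext1_neq0 (S i) (S (ordS i)).

Definition splitting (k : fieldType) (B : falgType k) :=
  forall (S : lmod B) (f : 'End(S)), simple S -> is_hom f ->
    exists c : k, f = c *: \1%VF.

Section TensorOver.
Context {k : fieldType} {C : falgType k}.
Implicit Types (V : rmod C) (X Y : lmod C).

(* The span of all v c ⊗ x - v ⊗ c x. By linearity in c, it is enough to let  *)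
(* c run over a basis of C.                                                   *)
Definition balanced V X : {vspace tens V X} :=
  (\sum_(c <- vbasis {:C})
     limg (tmap (ract V c) \1%VF - tmap \1%VF (lact X c)))%VS.

Lemma mem_balanced V X v c x :
  tpure (ract V c v) x - tpure v (lact X c x) \in balanced V X.
Proof.
pose D c := tmap (ract V c) \1%VF - tmap \1%VF (lact X c).
have DE c' v' x' : tpure (ract V c' v') x' - tpure v' (lact X c' x') =
    D c' (tpure v' x').
  by rewrite add_lfunE opp_lfunE !tmapE !id_lfunE.
rewrite DE (coord_vbasis (memvf c)).
have Dlin : linear D.
  have [Bl _] := tmap_bilin V X V X; have [_ Br] := tmap_bilin V X V X.
  move=> r a b; rewrite /D ract_linear lact_linear Bl Br scalerBr opprD.
  by rewrite addrACA.
pose DL : {linear C -> 'End(tens V X)} := HB.pack D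
  (GRing.isLinear.Build k C 'End(tens V X) _ D Dlin).
rewrite -[D _]/(DL _) linear_sum sum_lfunE; apply: rpred_sum => i _.
rewrite linearZ scale_lfunE rpredZ //.
have bi : (vbasis {:C})`_i \in (vbasis {:C} : seq C) by rewrite mem_nth ?size_tuple.
rewrite /balanced (big_rem _ bi) /=.
by apply: (subvP (addvSl _ _)); exact/memv_img/memvf.
Qed.

Lemma balanced_min V X (U : {vspace tens V X}) :
    (forall v c x, tpure (ract V c v) x - tpure v (lact X c x) \in U) ->
  (balanced V X <= U)%VS.
Proof.
move=> hU; rewrite /balanced; elim: (tval _) => [|c s IH].
  by rewrite big_nil sub0v.
rewrite big_cons subv_add IH andbT; apply/subvP=> _ /memv_imgP[t _ ->].
elim/(@tens_ind k V X): t => [v x | t t' ht ht']; last by rewrite linearD rpredD.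
by rewrite add_lfunE opp_lfunE !tmapE !id_lfunE; exact: hU.
Qed.

Definition tens_over V X : vectType k := quotv (balanced V X).

Definition tens_over_map V X Y (f : 'Hom(X, Y)) :
    'Hom(tens_over V X, tens_over V Y) :=
  (qproj (balanced V Y) \o tmap \1%VF f \o qsec (balanced V X))%VF.

(* Tor_n(V, X) = 0, where Tor_n(V, X) is the n-th homology of V ⊗_C P for a   *)
(* resolution P -> X by finitely generated projectives; such resolutions      *)
(* exist and the homology does not depend on the choice.                      *)
Definition Tor_eq0 (n : nat) V X :=
  forall (P : nat -> lmod C) (d : forall i, 'Hom(P i.+1, P i))
         (e : 'Hom(P 0, X)),
    (forall i, projective (P i)) -> (forall i, is_hom (d i)) -> is_hom e ->
    limg e = fullv -> limg (d 0) = lker e ->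
    (forall i, limg (d i.+1) = lker (d i)) ->
  let dV i := tens_over_map V (d i) in
  match n with
  | 0 => limg (dV 0) = fullv
  | m.+1 => limg (dV m.+1) = lker (dV m)
  end.

End TensorOver.

(* V ⊗_C X as a left A-module, for an A-C-bimodule V; its underlying space is *)
(* tens_over (bm_rmod V) X.                                                   *)
Section BimoduleTensor.
Context {k : fieldType} {A C : falgType k} (V : bimod A C) (X : lmod C).

Definition tensk_act (a : A) : 'End(tens V X) := tmap (lact V a) \1%VF.
Lemma tensk_act_linear : linear tensk_act.
Proof.
have [Bl _] := tmap_bilin V X V X.
by move=> c a b; rewrite /tensk_act lact_linear Bl.
Qed.
Lemma tensk_act1 : tensk_act 1 = \1%VF. Proof. by rewrite /tensk_act lact1 tmap1. Qed.
Lemma tensk_actM a b : tensk_act (a * b) = (tensk_act a \o tensk_act b)%VF.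
Proof. by rewrite /tensk_act lactM -tmap_comp comp_lfun1l. Qed.

Definition tensk_lmod : lmod A := Lmod tensk_act_linear tensk_act1 tensk_actM.

Lemma balanced_stable a :
  (lact tensk_lmod a @: balanced (bm_rmod V) X <= balanced (bm_rmod V) X)%VS.
Proof.
suff sub : (balanced (bm_rmod V) X <=
    lact tensk_lmod a @^-1: balanced (bm_rmod V) X)%VS.
  by apply/subvP=> _ /memv_imgP[t /(subvP sub) tb ->]; rewrite memv_preim.
apply: balanced_min => v c x.
rewrite -memv_preim linearB /= !tmapE !id_lfunE.
have /lfunP/(_ v) := bm_comm V a c; rewrite !comp_lfunE /= => ->.
exact: (mem_balanced (V := bm_rmod V)).
Qed.

Definition bimod_tens : lmod A := quot_lmod (Submod balanced_stable).

End BimoduleTensor.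

Section OverTensorAlgebra.
Context {k : fieldType} {A B : falgType k}.

Section LeftTensor.
Variables (X : lmod A) (Y : lmod B).

Definition tens_act (t : tens A B) : 'End(tens X Y) :=
  tlift (fun a b => tmap (lact X a) (lact Y b)) t.

Let act_bilin : bilin (fun a b => tmap (lact X a) (lact Y b)).
Proof.
have [Bl Br] := tmap_bilin X Y X Y.
by split=> [b c a a' | a c b b']; rewrite lact_linear ?Bl ?Br.
Qed.

Lemma tens_act_linear : linear tens_act.
Proof. exact: tlift_is_linear. Qed.
Lemma tens_act1 : tens_act 1 = \1%VF.
Proof. by rewrite /tens_act tlift_pure // !lact1 tmap1. Qed.
Lemma tens_actM s t : tens_act (s * t) = (tens_act s \o tens_act t)%VF.
Proof.
have actD s' t' : tens_act (s' + t') = tens_act s' + tens_act t'.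
  exact: linearD.
elim/(@tens_ind k A B): s => [a b | s s' IH IH']; last first.
  by rewrite mulrDl !actD IH IH' comp_lfunDl.
elim/(@tens_ind k A B): t => [a' b' | t t' IH IH']; last first.
  by rewrite mulrDr !actD IH IH' comp_lfunDr.
rewrite [_ * _]tmul_pure /tens_act !tlift_pure // !lactM.
exact: tmap_comp.
Qed.

(* (a ⊗ b)(x ⊗ y) = ax ⊗ by *)
Definition tens_lmod : lmod (tens A B) :=
  Lmod tens_act_linear tens_act1 tens_actM.

End LeftTensor.

Section RightTensor.
Variable V : rmod B.

Definition inflate_lact (a : A) : 'End(tens A V) := tmap (amull a) \1%VF.
Lemma inflate_lact_linear : linear inflate_lact.
Proof.
have [Bl _] := tmap_bilin A V A V.
by move=> c a b; rewrite /inflate_lact amull_linear Bl.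
Qed.
Lemma inflate_lact1 : inflate_lact 1 = \1%VF. Proof. by rewrite /inflate_lact amull1 tmap1. Qed.
Lemma inflate_lactM a b : inflate_lact (a * b) = (inflate_lact a \o inflate_lact b)%VF.
Proof. by rewrite /inflate_lact amull_mul -tmap_comp comp_lfun1l. Qed.

Definition inflate_lmod : lmod A :=
  Lmod inflate_lact_linear inflate_lact1 inflate_lactM.

Definition inflate_ract (t : tens A B) : 'End(tens A V) :=
  tlift (fun (a : A) (b : B) => tmap (amulr a) (ract V b)) t.

Let ract_bilin : bilin (fun (a : A) (b : B) => tmap (amulr a) (ract V b)).
Proof.
have [Bl Br] := tmap_bilin A V A V.
by split=> [b c a a' | a c b b']; rewrite ?ract_linear ?linearP ?Bl ?Br.
Qed.

Lemma inflate_ract_linear : linear inflate_ract.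
Proof. exact: tlift_is_linear. Qed.
Lemma inflate_ract1 : inflate_ract 1 = \1%VF.
Proof.
rewrite /inflate_ract tlift_pure // ract1 -[RHS]tmap1; congr tmap.
by apply/lfunP=> x; rewrite !lfunE /= mulr1.
Qed.
Lemma inflate_ractM s t :
  inflate_ract (s * t) = (inflate_ract t \o inflate_ract s)%VF.
Proof.
have actD s' t' : inflate_ract (s' + t') = inflate_ract s' + inflate_ract t'.
  exact: linearD.
elim/(@tens_ind k A B): s => [a b | s s' IH IH']; last first.
  by rewrite mulrDl !actD IH IH' comp_lfunDr.
elim/(@tens_ind k A B): t => [a' b' | t t' IH IH']; last first.
  by rewrite mulrDr !actD IH IH' comp_lfunDl.
rewrite [_ * _]tmul_pure /inflate_ract !tlift_pure // -tmap_comp ractM.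
by congr tmap; apply/lfunP=> x; rewrite comp_lfunE !lfunE /= mulrA.
Qed.
Lemma inflate_comm a c :
  (lact inflate_lmod a \o inflate_ract c = inflate_ract c \o lact inflate_lmod a)%VF.
Proof.
have actD s' t' : inflate_ract (s' + t') = inflate_ract s' + inflate_ract t'.
  exact: linearD.
elim/(@tens_ind k A B): c => [a' b' | s s' IH IH']; last first.
  by rewrite !actD comp_lfunDl comp_lfunDr IH IH'.
rewrite /inflate_ract tlift_pure // /= /inflate_lact -!tmap_comp comp_lfun1l comp_lfun1r.
by congr tmap; apply/lfunP=> x; rewrite !comp_lfunE !lfunE /= mulrA.
Qed.

(* The A-(A ⊗ B)-bimodule A ⊗ V: a'(x ⊗ v)(a ⊗ b) = a'xa ⊗ vb. *)
Definition inflate : bimod A (tens A B) :=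
  @Bimod k A (tens A B) inflate_lmod inflate_ract
    inflate_ract_linear inflate_ract1 inflate_ractM inflate_comm.

End RightTensor.

Section Dual.
Variable S : lmod B.

Definition precomp (b : B) (f : 'Hom(S, k^o)) : 'Hom(S, k^o) := (f \o lact S b)%VF.
Lemma precomp_linear b : linear (precomp b).
Proof. by move=> c f g; rewrite /precomp comp_lfunDl comp_lfunZl. Qed.
HB.instance Definition _ b := GRing.isLinear.Build k 'Hom(S, k^o) 'Hom(S, k^o) _
  (precomp b) (precomp_linear b).

Definition dual_act (b : B) : 'End('Hom(S, k^o)) := linfun (precomp b).

Lemma dual_actE b f : dual_act b f = (f \o lact S b)%VF.
Proof. by rewrite lfunE. Qed.
Lemma dual_act_linear : linear dual_act.
Proof.
move=> c a b; apply/lfunP=> f; rewrite add_lfunE scale_lfunE !dual_actE.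
by rewrite lact_linear comp_lfunDr comp_lfunZr.
Qed.
Lemma dual_act1 : dual_act 1 = \1%VF.
Proof. by apply/lfunP=> f; rewrite dual_actE lact1 comp_lfun1r id_lfunE. Qed.
Lemma dual_actM a b : dual_act (a * b) = (dual_act b \o dual_act a)%VF.
Proof.
by apply/lfunP=> f; rewrite comp_lfunE !dual_actE lactM comp_lfunA.
Qed.

(* D(S) = Hom_k(S, k) with (f b)(s) = f(b s) *)
Definition dual_rmod : rmod B := Rmod dual_act_linear dual_act1 dual_actM.

End Dual.

Definition Mon (X : lmod (tens A B)) :=
  forall (i : nat) (S : lmod B), (0 < i)%N -> simple S ->
    Tor_eq0 i (bm_rmod (inflate (dual_rmod S))) X.

Definition MonIn (L : lmod A -> Prop) (X : lmod (tens A B)) :=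
  Mon X /\ forall V : rmod B, L (bimod_tens (inflate V) X).

(* The isomorphism closure of {X ⊗_k Y | X in LA, Y in LB} *)
Definition tens_class (LA : lmod A -> Prop) (LB : lmod B -> Prop)
    (Z : lmod (tens A B)) :=
  exists X Y, [/\ LA X, LB Y & isomorphic Z (tens_lmod X Y)].

End OverTensorAlgebra.

(* Main.v *)
From HB Require Import structures.
Require Import Defs.
From mathcomp Require Import all_boot all_algebra falgebra.
From Stdlib Require Import ClassicalEpsilon.

(* For a right B-module V one has (A ⊗ V) ⊗_(A ⊗ B) X = V ⊗_B X, so X lies in    *)
(* Mon(B, A) exactly when it is projective over B: Tor_1 against all D(S) vanishes *)
(* iff every B-linear map from a syzygy of X to a simple module S extends, i.e.    *)
(* iff Ext^1_B(X, S) = 0.                                                          *)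
(* Triangularity bounds the length of the walks in the Ext-quiver, so B has finite *)
(* global dimension. Hence syzygies of acyclic complexes of projective B-modules   *)
(* are projective, which gives both B-Gproj = B-proj and the B-projectivity of     *)
(* Gorenstein projective X; likewise Ext^1(X, A ⊗ M) = 0 for all B-modules M,      *)
(* which, for M = D(V), is what makes V ⊗_B X Gorenstein projective over A.        *)
(* Conversely, let X be B-projective and let S be a simple quotient of X whose     *)
(* walks in the quiver are as long as possible, with projective cover P. Over B,   *)
(* X = P^m + X' with no maps from P to X' or from X' to S, so that P^m is an       *)
(* A ⊗ B-submodule; as End(P) = k, it is isomorphic to (D(S) ⊗_B X) ⊗_k P. The     *)
(* quotient X' is again B-projective, D(S') ⊗_B X' is D(S') ⊗_B X for S' not       *)
(* isomorphic to S and 0 otherwise, and induction on the dimension applies.        *)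

Set Implicit Arguments.
Unset Strict Implicit.
Unset Printing Implicit Defensive.

Import GRing.Theory.
Import VectorInternalTheory.
Local Open Scope ring_scope.

(** * Modules and exact sequences *)

(** The proof runs once around a cycle: a Gorenstein projective module lies in the monomorphic
    category ([Gproj_MonIn]), an object of that category is filtered ([projective_fil]), and a
    filtered module is Gorenstein projective ([fil_Gproj]).

    Only Ext^1 is used, in the form that extensions split ([Ext1_eq0]); higher Ext is reached by
    shifting along syzygies and cosyzygies ([Ext1_eq0_cosyzygy]). Total acyclicity is handled
    coinductively: by [Gproj_coind], any class of modules G with Ext^1(G, A) = 0 that admits one
    step of a projective coresolution and one of a resolution inside the class consists of
    Gorenstein projectives.

    Triangularity enters through the levels [low n]: the kernel of the projective cover of a simple
    S has composition factors of lower level than S ([cover_kernel]). Hence B has finite global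
    dimension, and a B-module that is an n-th syzygy for every n, as is every kernel in an acyclic
    complex of projectives, is projective ([acyclic_projective], [res_Gproj]). The same induction
    gives Ext^1(X, A ⊗ M) = 0 for Gorenstein projective X ([Gproj_Ext1_eq0_tens]). Since Hom_A(V ⊗_B
    X, A) = Hom(X, A ⊗ D(V)), this makes V ⊗_B X Gorenstein projective ([tens_over_Gproj]). That the
    Tor condition means B-projectivity ([MonP]) comes from D(D(S) ⊗_B X) = Hom_B(X, S).

    The passage to filtrations is where the splitting field matters. For S of maximal level among
    the simple quotients of X, with projective cover P, one has End(P) = k ([local_end]). So A acts
    on the P-isotypic part P^m by scalar matrices, and this part is U ⊗ P with U = D(S) ⊗_B X, which
    is Gorenstein projective by hypothesis ([isotypic_embedding], [peel_top]). For the way back, G ⊗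
    P is Gorenstein projective when P is projective ([tens_Gproj]), and Gorenstein projectives are
    closed under extensions ([Gproj_ext_closed]). *)

Section LinearMaps.
Context {k : fieldType}.
Implicit Types U V W : vectType k.

Lemma limg_fullP U V (f : 'Hom(U, V)) :
  limg f = fullv <-> forall y, exists x, f x = y.
Proof.
split=> [fs y | fs].
  have /memv_imgP[x _ ->] : y \in limg f by rewrite fs memvf.
  by exists x.
apply/vspaceP=> y; rewrite memvf; have [x <-] := fs y.
exact/memv_img/memvf.
Qed.

Lemma lker0E U V (f : 'Hom(U, V)) :
  lker f = 0%VS <-> forall x, f x = 0 -> x = 0.
Proof.
split=> [fi x fx | fi].
  by apply/eqP; rewrite -memv0 -fi memv_ker fx.
apply/vspaceP=> x; rewrite memv_ker memv0.
by apply/eqP/eqP=> [/fi | ->]; rewrite ?linear0.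
Qed.

Lemma limg_lkerP U V W (i : 'Hom(U, V)) (p : 'Hom(V, W)) :
  limg i = lker p <->
  (forall x, p (i x) = 0) /\ forall y, p y = 0 -> exists x, i x = y.
Proof.
split=> [e | [pi0 ex]].
  split=> [x | y py].
    by apply/eqP; rewrite -memv_ker -e; exact/memv_img/memvf.
  have /memv_imgP[x _ ->] : y \in limg i by rewrite e memv_ker py.
  by exists x.
apply/vspaceP=> y; rewrite memv_ker; apply/memv_imgP/eqP => [[x _ ->] // | /ex].
by case=> x <-; exists x; rewrite ?memvf.
Qed.

Lemma linfun_exists U V (f : U -> V) :
  linear f -> exists g : 'Hom(U, V), forall x, g x = f x.
Proof.
move=> fl; pose h : {linear U -> V} := HB.pack f (GRing.isLinear.Build k U V _ f fl).
by exists (linfun h) => x; rewrite lfunE.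
Qed.

End LinearMaps.

Section ModuleTheory.
Context {k : fieldType} {A : falgType k}.
Implicit Types M N E P Q S X Y K : lmod A.

Lemma is_homP M N (f : 'Hom(M, N)) :
  is_hom f <-> forall a x, f (lact M a x) = lact N a (f x).
Proof.
split=> [h a x | h a].
  by have /lfunP/(_ x) := h a; rewrite !comp_lfunE.
by apply/lfunP=> x; rewrite !comp_lfunE.
Qed.

Lemma hom1 M : is_hom (\1%VF : 'End(M)).
Proof. by apply/is_homP=> a x; rewrite !id_lfunE. Qed.

Lemma hom0 M N : is_hom (0 : 'Hom(M, N)).
Proof. by apply/is_homP=> a x; rewrite !zero_lfunE linear0. Qed.

Lemma hom_comp M N E (g : 'Hom(N, E)) (f : 'Hom(M, N)) :
  is_hom g -> is_hom f -> is_hom (g \o f)%VF.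
Proof.
by move=> /is_homP hg /is_homP hf; apply/is_homP=> a x; rewrite !comp_lfunE hf hg.
Qed.

Lemma homD M N (f g : 'Hom(M, N)) : is_hom f -> is_hom g -> is_hom (f + g).
Proof.
move=> /is_homP hf /is_homP hg; apply/is_homP=> a x.
by rewrite !add_lfunE hf hg linearD.
Qed.

Lemma homN M N (f : 'Hom(M, N)) : is_hom f -> is_hom (- f).
Proof.
by move=> /is_homP hf; apply/is_homP=> a x; rewrite !opp_lfunE hf linearN.
Qed.

Lemma homB M N (f g : 'Hom(M, N)) : is_hom f -> is_hom g -> is_hom (f - g).
Proof. by move=> hf hg; apply: homD => //; exact: homN. Qed.

Lemma homZ M N c (f : 'Hom(M, N)) : is_hom f -> is_hom (c *: f).
Proof.
by move=> /is_homP hf; apply/is_homP=> a x; rewrite !scale_lfunE hf linearZ.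
Qed.

Lemma hom_sum M N I (r : seq I) (F : I -> 'Hom(M, N)) :
  (forall i, is_hom (F i)) -> is_hom (\sum_(i <- r) F i).
Proof. by move=> h; apply: (big_ind (@is_hom k A M N)) => //; [exact: hom0|exact: homD]. Qed.

Lemma short_exactP M E N (i : 'Hom(M, E)) (p : 'Hom(E, N)) :
  short_exact i p <->
  [/\ is_hom i, is_hom p, forall x, i x = 0 -> x = 0,
      (forall x, p (i x) = 0) /\ (forall y, p y = 0 -> exists x, i x = y)
    & forall z, exists y, p y = z].
Proof.
split=> [] [hi hp ii ip ps]; split=> //.
- exact/lker0E.
- exact/limg_lkerP.
- exact/limg_fullP.
- exact/lker0E.
- exact/limg_lkerP.
- exact/limg_fullP.
Qed.

Lemma hom_factor_epi P N M (p : 'Hom(P, N)) (f : 'Hom(P, M)) :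
    is_hom p -> is_hom f -> (forall z, exists y, p y = z) ->
    (forall x, p x = 0 -> f x = 0) ->
  exists2 g : 'Hom(N, M), is_hom g & forall x, g (p x) = f x.
Proof.
move=> /is_homP hp /is_homP hf /limg_fullP ps pf.
(* [p^-1] is only a k-linear section of p; composing with f gives a module map because f kills Ker
   p. *)
have gE x : (f \o p^-1)%VF (p x) = f x.
  apply/eqP; rewrite comp_lfunE -subr_eq0 -linearB; apply/eqP/pf.
  by rewrite linearB /= limg_lfunVK ?subrr // memv_img ?memvf.
exists (f \o p^-1)%VF => //; apply/is_homP=> a z.
have /limg_fullP/(_ z)[y <-] := ps.
by rewrite -hp !gE hf.
Qed.

Lemma hom_factor_mono K P M (i : 'Hom(K, P)) (f : 'Hom(M, P)) :
    is_hom i -> is_hom f -> (forall x, i x = 0 -> x = 0) ->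
    (forall x, exists y, i y = f x) ->
  exists2 g : 'Hom(M, K), is_hom g & forall x, i (g x) = f x.
Proof.
move=> /is_homP hi /is_homP hf ii fi.
have gE x : i ((i^-1 \o f)%VF x) = f x.
  by rewrite comp_lfunE limg_lfunVK //; have [y <-] := fi x; exact/memv_img/memvf.
have inj x y : i x = i y -> x = y.
  by move=> e; apply/eqP; rewrite -subr_eq0; apply/eqP/ii; rewrite linearB /= e subrr.
exists (i^-1 \o f)%VF => //; apply/is_homP=> a x.
by apply: inj; rewrite gE hf hi gE.
Qed.

Lemma ker_exists M N (p : 'Hom(M, N)) :
    is_hom p ->
  exists (K : lmod A) (i : 'Hom(K, M)), [/\ is_hom i, forall x, i x = 0 -> x = 0,
    forall x, p (i x) = 0 & forall y, p y = 0 -> exists x, i x = y].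
Proof.
move=> /is_homP hp.
have st a : (lact M a @: lker p <= lker p)%VS.
  apply/subvP=> _ /memv_imgP[x xk ->]; rewrite memv_ker hp.
  by move: xk; rewrite memv_ker => /eqP ->; rewrite linear0.
pose K := sub_lmod (Submod st).
have vE (x : K) : (linfun (vsval (U := lker p)) : 'Hom(K, M)) x = vsval x.
  exact: lfunE.
exists K, (linfun vsval); split.
- apply/is_homP=> a x; rewrite !vE /= /sub_act.
  rewrite !comp_lfunE !lfunE /= vsprojK //.
  by apply: (subvP (st a)); exact/memv_img/subvsP.
- by move=> x; rewrite vE => e; apply/val_inj.
- by move=> x; rewrite vE; apply/eqP; rewrite -memv_ker; exact: subvsP.
- move=> y /eqP; rewrite -memv_ker => yk.
  by exists (vsproj _ y); rewrite vE vsprojK.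
Qed.

Lemma kernel_exact M N (p : 'Hom(M, N)) :
    is_hom p -> (forall z, exists y, p y = z) ->
  exists (K : lmod A) (i : 'Hom(K, M)), short_exact i p.
Proof.
move=> hp ps; have [K [i [hi ii ip ex]]] := ker_exists hp.
by exists K, i; apply/short_exactP.
Qed.

Lemma qproj_hom M (N : submod M) : is_hom (qproj N : 'Hom(M, quot_lmod N)).
Proof.
apply/is_homP=> a x /=; rewrite /quot_act !comp_lfunE.
apply/eqP; rewrite -subr_eq0 -!linearB -memv_ker lker_qproj.
apply: (subvP (sm_stable N a)); exact/memv_img/qprojK.
Qed.

Lemma img_stable M N (f : 'Hom(M, N)) (hf : is_hom f) a :
  (lact N a @: limg f <= limg f)%VS.
Proof.
apply/subvP=> _ /memv_imgP[_ /memv_imgP[x _ ->] ->].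
by rewrite -(is_homP f).1 // memv_img ?memvf.
Qed.
Definition img_submod M N (f : 'Hom(M, N)) (hf : is_hom f) : submod N :=
  Submod (img_stable hf).

Lemma quot_exact K M (i : 'Hom(K, M)) :
    is_hom i -> (forall x, i x = 0 -> x = 0) ->
  exists (C : lmod A) (p : 'Hom(M, C)), short_exact i p.
Proof.
move=> hi ii; exists (quot_lmod (img_submod hi)), (qproj (limg i)).
by split; rewrite ?lker_qproj ?limg_qproj //; [exact: (qproj_hom (img_submod hi))|exact/lker0E].
Qed.

Lemma hom_image M N (f : 'Hom(M, N)) :
    is_hom f ->
  exists (I : lmod A) (p : 'Hom(M, I)) (i : 'Hom(I, N)), [/\ is_hom p, is_hom i,
    forall x, i x = 0 -> x = 0, forall z, exists y, p y = z
    & forall x, i (p x) = f x].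
Proof.
move=> hf; have [K [j [hj ij jf ex]]] := ker_exists hf.
have [I [p /short_exactP[_ hp _ [jp pex] ps]]] := quot_exact hj ij.
have [i hi iE] : exists2 i : 'Hom(I, N), is_hom i & forall x, i (p x) = f x.
  by apply: hom_factor_epi => // x /pex[y <-].
exists I, p, i; split=> // z; have [y <-] := ps z.
by rewrite iE => /ex[x <-].
Qed.

Lemma biprod_exists M N :
  exists (E : lmod A) (i : 'Hom(M, E)) (j : 'Hom(N, E)) (p : 'Hom(E, M)) (q : 'Hom(E, N)),
    [/\ is_hom i, is_hom j, is_hom p & is_hom q] /\
    [/\ forall x, p (i x) = x, forall x, q (j x) = x, forall x, q (i x) = 0,
        forall x, p (j x) = 0 & forall x, i (p x) + j (q x) = x].
Proof.
have bl (U1 U2 V1 V2 : vectType k) (f : 'Hom(U1, V1)) (g : 'Hom(U2, V2)) :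
  linear (fun x : (U1 * U2)%type => (f x.1, g x.2)).
  by move=> c x y; rewrite !linearP.
pose bf (a : A) : {linear (M * N)%type -> (M * N)%type} := HB.pack
  (fun x : (M * N)%type => (lact M a x.1, lact N a x.2))
  (GRing.isLinear.Build k _ _ _ _ (bl _ _ _ _ (lact M a) (lact N a))).
pose act a : 'End((M * N)%type) := linfun (bf a).
have actE a x : act a x = (lact M a x.1, lact N a x.2) by rewrite lfunE.
have al : linear act.
  move=> c a b; apply/lfunP=> x; rewrite add_lfunE scale_lfunE !actE.
  by rewrite !lact_linear !add_lfunE !scale_lfunE.
have a1 : act 1 = \1%VF.
  by apply/lfunP=> -[x y]; rewrite actE !lact1 !id_lfunE.
have aM a b : act (a * b) = (act a \o act b)%VF.
  by apply/lfunP=> x; rewrite comp_lfunE !actE !lactM !comp_lfunE.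
have [i iE] : exists f : 'Hom(M, (M * N)%type), forall x, f x = (x, 0).
  by apply: linfun_exists => c x y; rewrite -[RHS]/(c *: x + y, c *: 0 + 0) scaler0 addr0.
have [j jE] : exists f : 'Hom(N, (M * N)%type), forall x, f x = (0, x).
  by apply: linfun_exists => c x y; rewrite -[RHS]/(c *: 0 + 0, c *: x + y) scaler0 addr0.
have [p pE] : exists f : 'Hom((M * N)%type, M), forall x, f x = x.1.
  exact: linfun_exists.
have [q qE] : exists f : 'Hom((M * N)%type, N), forall x, f x = x.2.
  exact: linfun_exists.
exists (Lmod al a1 aM), i, j, p, q; split; split.
- by apply/is_homP=> a x /=; rewrite actE !iE /= linear0.
- by apply/is_homP=> a x /=; rewrite actE !jE /= linear0.
- by apply/is_homP=> a x /=; rewrite actE !pE.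
- by apply/is_homP=> a x /=; rewrite actE !qE.
- by move=> x; rewrite iE pE.
- by move=> x; rewrite jE qE.
- by move=> x; rewrite iE qE.
- by move=> x; rewrite jE pE.
- by case=> x y; rewrite pE qE iE jE -[LHS]/(x + 0, 0 + y) addr0 add0r.
Qed.

End ModuleTheory.

(** * Splitting of extensions and the long exact sequences of Ext^1 *)

Section Extensions.
Context {k : fieldType} {A : falgType k}.
Implicit Types M N E P Q S X Y K L : lmod A.
Implicit Type F : lmod A -> Prop.

(* Covers finite direct sums and direct summands at once. *)
Definition add_closed F := forall M N E
    (i : 'Hom(M, E)) (p : 'Hom(E, M)) (j : 'Hom(N, E)) (q : 'Hom(E, N)),
  is_hom i -> is_hom p -> is_hom j -> is_hom q ->
  (forall x, i (p x) + j (q x) = x) -> F M -> F N -> F E.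

Lemma add_closed_retract F M E (i : 'Hom(M, E)) (p : 'Hom(E, M)) :
  add_closed F -> is_hom i -> is_hom p -> (forall x, i (p x) = x) -> F M -> F E.
Proof.
move=> Fadd hi hp ip FM; apply: (Fadd M M E i p 0 0) => //; try exact: hom0.
by move=> x; rewrite !zero_lfunE addr0.
Qed.

Lemma add_closed_zero F M (Z : lmod A) : add_closed F -> F M -> (forall x : Z, x = 0) -> F Z.
Proof.
move=> Fadd FM Z0.
apply: (@add_closed_retract F M Z 0 0) => //; try exact: hom0.
by move=> x; rewrite zero_lfunE (Z0 x).
Qed.

Lemma lift_epi P M N (g : 'Hom(M, N)) (f : 'Hom(P, N)) :
  projective P -> is_hom g -> (forall z, exists y, g y = z) -> is_hom f ->
  exists2 h : 'Hom(P, M), is_hom h & forall x, g (h x) = f x.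
Proof.
move=> prP hg gs hf; have [h [hh gh]] := prP _ _ _ _ hg ((limg_fullP _).2 gs) hf.
by exists h => // x; rewrite -gh comp_lfunE.
Qed.

Lemma projective_add_closed : add_closed (@projective k A).
Proof.
move=> M N E i p j q hi hp hj hq ijpq prM prN X Y g f hg /limg_fullP gs hf.
have [h1 hh1 e1] := lift_epi prM hg gs (hom_comp hf hi).
have [h2 hh2 e2] := lift_epi prN hg gs (hom_comp hf hj).
exists ((h1 \o p)%VF + (h2 \o q)%VF); split.
  by apply: homD; exact: hom_comp.
apply/lfunP=> x; rewrite comp_lfunE add_lfunE !comp_lfunE linearD /= e1 e2.
by rewrite !comp_lfunE -linearD ijpq.
Qed.

Lemma lact_linearl M (c : k) a b x : lact M (c *: a + b) x = c *: lact M a x + lact M b x.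
Proof. by rewrite lact_linear add_lfunE scale_lfunE. Qed.

Lemma lact_mul M a b x : lact M (a * b) x = lact M a (lact M b x).
Proof. by rewrite lactM comp_lfunE. Qed.

Lemma lact_one M x : lact M 1 x = x.
Proof. by rewrite lact1 id_lfunE. Qed.

Lemma regular_actE a b : lact (@regular_lmod k A) a b = a * b :> A.
Proof. exact: lfunE. Qed.

Lemma regular_hom_exists M (x : M) :
  exists2 h : 'Hom(@regular_lmod k A, M), is_hom h & forall b : A, h b = lact M b x.
Proof.
have [h hE] : exists h : 'Hom(A, M), forall b, h b = lact M b x.
  by apply: linfun_exists => c a b; rewrite lact_linearl.
exists h => //; apply/is_homP=> a b.
by rewrite regular_actE !hE lact_mul.
Qed.

Lemma regular_projective : projective (@regular_lmod k A).
Proof.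
move=> M N g f /is_homP hg /limg_fullP gs /is_homP hf.
have [y yE] := gs (f (1 : A)); have [h hh hE] := regular_hom_exists y.
exists h; split=> //; apply/lfunP=> b.
by rewrite comp_lfunE hE hg yE -hf regular_actE mulr1.
Qed.

Lemma cover_exists F M : F (@regular_lmod k A) -> add_closed F ->
  exists (P : lmod A) (p : 'Hom(P, M)), [/\ F P, is_hom p & forall z, exists y, p y = z].
Proof.
move=> Freg Fadd.
have ex (s : seq M) : exists (P : lmod A) (p : 'Hom(P, M)),
    [/\ F P, is_hom p & forall x, x \in s -> exists y, p y = x].
  elim: s => [|x s [P [p [FP hp ps]]]].
    by exists regular_lmod, 0; split=> //; exact: hom0.
  have [h hh hE] := regular_hom_exists x.
  have [E [i [j [p1 [q1 [[hi hj hp1 hq1] [p1i q1j q1i p1j ij]]]]]]] :=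
    biprod_exists P (@regular_lmod k A).
  exists E, ((p \o p1)%VF + (h \o q1)%VF); split.
  - exact: (Fadd P regular_lmod E i p1 j q1).
  - by apply: homD; exact: hom_comp.
  - move=> y; rewrite inE => /orP[/eqP -> | /ps[z <-]].
      exists (j (1 : A)); rewrite add_lfunE !comp_lfunE p1j q1j linear0 add0r hE.
      exact: lact_one.
    by exists (i z); rewrite add_lfunE !comp_lfunE p1i q1i linear0 addr0.
have [P [p [FP hp ps]]] := ex (vbasis {:M}).
exists P, p; split=> //; apply/limg_fullP/eqP; rewrite eqEsubv subvf /=.
have /andP[/eqP <- _] := vbasisP {:M}.
by apply/span_subvP=> x /ps[y <-]; exact/memv_img/memvf.
Qed.

(** A projective module is a retract of a finite sum of copies of the regular module. This serves as
    an induction principle: a property compatible with sums and retracts need only be checked on the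
    regular module. *)
Lemma projective_ind F P :
  F (@regular_lmod k A) -> add_closed F -> projective P -> F P.
Proof.
move=> Freg Fadd prP; have [Q [p [FQ hp ps]]] := cover_exists P Freg Fadd.
have [s hs ps1] := lift_epi prP hp ps (hom1 P).
apply: (add_closed_retract Fadd hp hs _ FQ) => x.
by rewrite ps1 id_lfunE.
Qed.

Lemma presentation_exists M :
  exists (K P : lmod A) (i : 'Hom(K, P)) (p : 'Hom(P, M)), short_exact i p /\ projective P.
Proof.
have [P [p [prP hp ps]]] :=
  cover_exists M regular_projective projective_add_closed.
have [K [i ip]] := kernel_exact hp ps.
by exists K, P, i, p.
Qed.

(** The positive form of the negation of [Ext1_neq0], so that a splitting can be extracted directly;
    their equivalence [Ext1_eq0P] is classical. *)
Definition Ext1_eq0 N M :=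
  forall E (i : 'Hom(M, E)) (p : 'Hom(E, N)), short_exact i p ->
  exists s : 'Hom(N, E), is_hom s /\ (p \o s)%VF = \1%VF.

Lemma Ext1_eq0P N M : Ext1_eq0 N M <-> ~ Ext1_neq0 N M.
Proof.
split=> [h [E [i [p [ip ns]]]] | h E i p ip]; first exact: ns (h _ _ _ ip).
by case: (classic (exists s : 'Hom(N, E), is_hom s /\ (p \o s)%VF = \1%VF)) => // ns;
  case: h; exists E, i, p.
Qed.

Lemma Ext1_eq0_retraction N M E (i : 'Hom(M, E)) (p : 'Hom(E, N)) :
  Ext1_eq0 N M -> short_exact i p ->
  exists2 r : 'Hom(E, M), is_hom r & forall x, r (i x) = x.
Proof.
move=> NM ip; have [s [hs /lfunP ps]] := NM _ _ _ ip.
case/short_exactP: ip => hi hp ii [pi pex] psur.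
have [r hr rE] : exists2 r : 'Hom(E, M), is_hom r &
    forall x, i (r x) = (\1%VF - (s \o p)%VF) x.
  apply: hom_factor_mono => //.
    by apply: homB; [exact: hom1 | exact: hom_comp].
  move=> x; apply: pex; rewrite add_lfunE opp_lfunE id_lfunE comp_lfunE linearB /=.
  by have := ps (p x); rewrite comp_lfunE id_lfunE => ->; rewrite subrr.
exists r => // x; apply/eqP; rewrite -subr_eq0; apply/eqP/ii.
by rewrite linearB /= rE add_lfunE opp_lfunE id_lfunE comp_lfunE pi linear0 subr0 subrr.
Qed.

Definition extends K P (i : 'Hom(K, P)) M := forall f : 'Hom(K, M), is_hom f ->
  exists2 g : 'Hom(P, M), is_hom g & forall x, g (i x) = f x.

(** Push the sequence out along f: the pushout is an extension of N by M, and a retraction onto M,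
    restricted to P, extends f. *)
Lemma Ext1_eq0_extends N M K P (i : 'Hom(K, P)) (p : 'Hom(P, N)) :
  Ext1_eq0 N M -> short_exact i p -> extends i M.
Proof.
move=> NM /short_exactP[hi hp ii [pi pex] psur] f hf.
have [S [a [b [c [d [[ha hb hc hd] [ca db da cb abcd]]]]]]] := biprod_exists M P.
(* The pushout is the cokernel of (f, -i) from K to M ⊕ P. *)
pose u : 'Hom(K, S) := (a \o f)%VF - (b \o i)%VF.
have uE x : u x = a (f x) - b (i x) by rewrite add_lfunE opp_lfunE !comp_lfunE.
have hu : is_hom u by apply: homB; exact: hom_comp.
have du x : d (u x) = - i x by rewrite uE linearB /= da db sub0r.
have ui x : u x = 0 -> x = 0.
  by move=> ux; apply/ii/oppr_inj; rewrite -du ux linear0 oppr0.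
have [E [w /short_exactP[_ hw _ [wu wex] ws]]] := quot_exact hu ui.
have wab x : w (a (f x)) = w (b (i x)).
  by apply/eqP; rewrite -subr_eq0 -linearB /= -uE wu.
have [t ht tE] : exists2 t : 'Hom(E, N), is_hom t & forall x, t (w x) = (p \o d)%VF x.
  apply: hom_factor_epi => //; first exact: hom_comp.
  by move=> x /wex[y <-]; rewrite comp_lfunE du linearN /= pi oppr0.
have ex : short_exact (w \o a)%VF t.
  apply/short_exactP; split=> //; first exact: hom_comp.
  - move=> x; rewrite comp_lfunE => /wex[y yE].
    have y0 : y = 0 by apply/ii/oppr_inj; rewrite -du yE da oppr0.
    by rewrite -[x]ca -yE y0 !linear0.
  - split=> [x | y ty]; first by rewrite comp_lfunE tE comp_lfunE da linear0.
    have [z zE] := ws y; move: ty; rewrite -zE tE comp_lfunE => /pex[x xE].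
    exists (f x + c z); rewrite comp_lfunE !linearD /= wab xE addrC.
    by rewrite -(linearD w) abcd.
  - move=> z; have [y <-] := psur z; exists (w (b y)).
    by rewrite tE comp_lfunE db.
have [r hr rE] := Ext1_eq0_retraction NM ex.
exists (r \o (w \o b))%VF; first by do 2?apply: hom_comp.
by move=> x; rewrite !comp_lfunE -wab -{2}[f x]rE comp_lfunE.
Qed.

(** Lift p to t : P -> E. On K it lands in M; subtracting from t an extension to P of that
    restriction makes it vanish on K, so it descends to a section over N. *)
Lemma extends_Ext1_eq0 N M K P (i : 'Hom(K, P)) (p : 'Hom(P, N)) :
  short_exact i p -> projective P -> extends i M -> Ext1_eq0 N M.
Proof.
move=> /short_exactP[hi hp ii [pi pex] psur] prP ext E j q /short_exactP.
move=> [hj hq ij [qj qex] qs].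
have [t ht tE] := lift_epi prP hq qs hp.
have [f hf fE] : exists2 f : 'Hom(K, M), is_hom f & forall x, j (f x) = (t \o i)%VF x.
  apply: hom_factor_mono => //; first exact: hom_comp.
  by move=> x; apply: qex; rewrite comp_lfunE tE pi.
have [g hg gE] := ext f hf.
have [s hs sE] : exists2 s : 'Hom(N, E), is_hom s &
    forall x, s (p x) = (t - (j \o g)%VF) x.
  apply: hom_factor_epi => //; first by apply: homB => //; exact: hom_comp.
  move=> x /pex[y <-]; rewrite add_lfunE opp_lfunE comp_lfunE gE fE comp_lfunE.
  by rewrite subrr.
exists s; split=> //; apply/lfunP=> z; have [y <-] := psur z.
rewrite comp_lfunE sE add_lfunE opp_lfunE comp_lfunE linearB /= qj tE.
by rewrite subr0 id_lfunE.
Qed.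

Lemma projective_Ext1_eq0 P M : projective P -> Ext1_eq0 P M.
Proof.
move=> prP E i p /short_exactP[_ hp _ _ ps].
have [s hs ps1] := lift_epi prP hp ps (hom1 P).
by exists s; split=> //; apply/lfunP=> x; rewrite comp_lfunE ps1.
Qed.

Lemma Ext1_eq0_projective N : (forall M, Ext1_eq0 N M) -> projective N.
Proof.
move=> N0; have [K [P [i [p [ip prP]]]]] := presentation_exists N.
have [s [hs /lfunP ps]] := N0 K _ _ _ ip.
case/short_exactP: ip => hi hp ii [pi pex] psur.
apply: (add_closed_retract projective_add_closed hp hs _ prP) => x.
by have := ps x; rewrite comp_lfunE id_lfunE.
Qed.

Lemma Ext1_eq0_add_closedr N : add_closed (Ext1_eq0 N).
Proof.
move=> M M' E i p j q hi hp hj hq ijpq NM NM'.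
have [K [P [u [v [uv prP]]]]] := presentation_exists N.
apply: (extends_Ext1_eq0 uv prP) => f hf.
have [g hg gE] := Ext1_eq0_extends NM uv (hom_comp hp hf).
have [g' hg' gE'] := Ext1_eq0_extends NM' uv (hom_comp hq hf).
exists ((i \o g)%VF + (j \o g')%VF); first by apply: homD; exact: hom_comp.
by move=> x; rewrite add_lfunE !comp_lfunE gE gE' !comp_lfunE.
Qed.

Lemma Ext1_eq0_projr N P : Ext1_eq0 N (@regular_lmod k A) -> projective P -> Ext1_eq0 N P.
Proof. by move=> NA; apply: projective_ind => //; exact: Ext1_eq0_add_closedr. Qed.

Lemma Ext1_eq0_extr N M E M' (i : 'Hom(M, E)) (p : 'Hom(E, M')) :
  short_exact i p -> Ext1_eq0 N M -> Ext1_eq0 N M' -> Ext1_eq0 N E.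
Proof.
move=> /short_exactP[hi hp ii [pi pex] psur] NM NM'.
have [K [P [u [v [uv prP]]]]] := presentation_exists N.
apply: (extends_Ext1_eq0 uv prP) => f hf.
have hu : is_hom u by case: uv.
have [g hg gE] := Ext1_eq0_extends NM' uv (hom_comp hp hf).
have [h hh hE] := lift_epi prP hp psur hg.
have [d hd dE] : exists2 d : 'Hom(K, M), is_hom d &
    forall x, i (d x) = (f - (h \o u)%VF) x.
  apply: hom_factor_mono => //; first by apply: homB => //; exact: hom_comp.
  move=> x; apply: pex; rewrite add_lfunE opp_lfunE comp_lfunE linearB /= hE gE.
  by rewrite comp_lfunE subrr.
have [e he eE] := Ext1_eq0_extends NM uv hd.
exists ((i \o e)%VF + h); first by apply: homD => //; exact: hom_comp.
move=> x; rewrite add_lfunE comp_lfunE eE dE add_lfunE opp_lfunE comp_lfunE.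
by rewrite subrK.
Qed.

(** Let P cover E with kernel K, and let L be the kernel of P -> N'. Then L/K = N and P/L = N', so a
    map K -> M is extended in two stages, from K to L and from L to P. *)
Lemma Ext1_eq0_extl M N E N' (i : 'Hom(N, E)) (p : 'Hom(E, N')) :
  short_exact i p -> Ext1_eq0 N M -> Ext1_eq0 N' M -> Ext1_eq0 E M.
Proof.
move=> /short_exactP[hi hp ii [pi pex] psur] NM NM'.
have [K [P [u [v [uv prP]]]]] := presentation_exists E.
case/short_exactP: (uv) => hu hv iu [vu vex] vsur.
have [L [w wpv]] : exists (L : lmod A) (w : 'Hom(L, P)), short_exact w (p \o v)%VF.
  apply: kernel_exact; first exact: hom_comp.
  move=> z; have [y <-] := psur z; have [x <-] := vsur y.
  by exists x; rewrite comp_lfunE.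
case/short_exactP: (wpv) => hw _ iw [pvw pvex] _.
have [a ha aE] : exists2 a : 'Hom(K, L), is_hom a & forall x, w (a x) = u x.
  by apply: hom_factor_mono => // x; apply: pvex; rewrite comp_lfunE vu linear0.
have [b hb bE] : exists2 b : 'Hom(L, N), is_hom b & forall x, i (b x) = (v \o w)%VF x.
  apply: hom_factor_mono => //; first exact: hom_comp.
  by move=> x; apply: pex; have := pvw x; rewrite !comp_lfunE.
have ab : short_exact a b.
  apply/short_exactP; split=> //.
  - by move=> x ax; apply: iu; rewrite -aE ax linear0.
  - split=> [x | y by0]; first by apply: ii; rewrite bE comp_lfunE aE vu.
    have /vex[x xE] : v (w y) = 0 by have := bE y; rewrite by0 linear0 comp_lfunE.
    exists x; apply/eqP; rewrite -subr_eq0; apply/eqP/iw.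
    by rewrite linearB /= aE xE subrr.
  - move=> z; have [x xE] := vsur (i z).
    have [|y yE] := pvex x; first by rewrite comp_lfunE xE pi.
    exists y; apply/eqP; rewrite -subr_eq0; apply/eqP/ii.
    by rewrite linearB /= bE comp_lfunE yE xE subrr.
apply: (extends_Ext1_eq0 uv prP) => f hf.
have [g hg gE] := Ext1_eq0_extends NM ab hf.
have [h hh hE] := Ext1_eq0_extends NM' wpv hg.
by exists h => // x; rewrite -aE hE gE.
Qed.

(* Exactness of Hom(K, M) -> Hom(K, N) -> Ext^1(K, L). *)
Lemma Ext1_eq0_lift K L M N (i : 'Hom(L, M)) (p : 'Hom(M, N)) (f : 'Hom(K, N)) :
  short_exact i p -> Ext1_eq0 K L -> is_hom f ->
  exists2 h : 'Hom(K, M), is_hom h & forall x, p (h x) = f x.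
Proof.
move=> /short_exactP[hi hp ii [pi pex] psur] KL hf.
have [R [Q [u [v [uv prQ]]]]] := presentation_exists K.
case/short_exactP: (uv) => hu hv iu [vu vex] vsur.
have [g hg gE] := lift_epi prQ hp psur (hom_comp hf hv).
have [d hd dE] : exists2 d : 'Hom(R, L), is_hom d & forall x, i (d x) = (g \o u)%VF x.
  apply: hom_factor_mono => //; first exact: hom_comp.
  by move=> x; apply: pex; rewrite comp_lfunE gE comp_lfunE vu linear0.
have [e he eE] := Ext1_eq0_extends KL uv hd.
have [h hh hE] : exists2 h : 'Hom(K, M), is_hom h &
    forall x, h (v x) = (g - (i \o e)%VF) x.
  apply: hom_factor_epi => //; first by apply: homB => //; exact: hom_comp.
  move=> x /vex[y <-]; rewrite add_lfunE opp_lfunE comp_lfunE eE dE comp_lfunE.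
  by rewrite subrr.
exists h => // x; have [y <-] := vsur x.
by rewrite hE add_lfunE opp_lfunE comp_lfunE linearB /= pi subr0 gE comp_lfunE.
Qed.

(* Ext^1(N, M') embeds into Ext^2(N, L) = Ext^1(K, L) when Ext^1(N, M) = 0. *)
Lemma Ext1_eq0_shift N K P L M M' (i : 'Hom(K, P)) (p : 'Hom(P, N))
    (j : 'Hom(L, M)) (q : 'Hom(M, M')) :
  short_exact i p -> projective P -> short_exact j q ->
  Ext1_eq0 K L -> Ext1_eq0 N M -> Ext1_eq0 N M'.
Proof.
move=> ip prP jq KL NM; apply: (extends_Ext1_eq0 ip prP) => f hf.
have [h hh hE] := Ext1_eq0_lift jq KL hf.
have [g hg gE] := Ext1_eq0_extends NM ip hh.
have hq : is_hom q by case: jq.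
exists (q \o g)%VF; first exact: hom_comp.
by move=> x; rewrite comp_lfunE gE.
Qed.

Definition injective_mod X := forall N, Ext1_eq0 N X.

(* Ext^1(K, L) = Ext^2(N, L) = Ext^1(N, M') when P is projective and M injective. *)
Lemma Ext1_eq0_coshift N K P L M M' (i : 'Hom(K, P)) (p : 'Hom(P, N))
    (j : 'Hom(L, M)) (q : 'Hom(M, M')) :
  short_exact i p -> projective P -> short_exact j q -> injective_mod M ->
  Ext1_eq0 N M' -> Ext1_eq0 K L.
Proof.
move=> ip prP jq injM NM'.
have [R [Q [u [v [uv prQ]]]]] := presentation_exists K.
case/short_exactP: (uv) => hu hv iu [vu vex] vsur.
case/short_exactP: (jq) => hj hq ij [qj qex] qsur.
have hi : is_hom i by case: ip.
apply: (extends_Ext1_eq0 uv prQ) => f hf.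
have [g hg gE] := Ext1_eq0_extends (injM K) uv (hom_comp hj hf).
have [h hh hE] : exists2 h : 'Hom(K, M'), is_hom h & forall x, h (v x) = (q \o g)%VF x.
  apply: hom_factor_epi => //; first exact: hom_comp.
  by move=> x /vex[y <-]; rewrite comp_lfunE gE comp_lfunE qj.
have [a ha aE] := Ext1_eq0_extends NM' ip hh.
have [b hb bE] := lift_epi prP hq qsur ha.
have [d hd dE] : exists2 d : 'Hom(Q, L), is_hom d &
    forall x, j (d x) = (g - (b \o (i \o v)))%VF x.
  apply: hom_factor_mono => //.
    by apply: homB => //; do 2?apply: hom_comp.
  move=> x; apply: qex; rewrite add_lfunE opp_lfunE !comp_lfunE linearB /= bE aE hE.
  by rewrite comp_lfunE subrr.
exists d => // x; apply/eqP; rewrite -subr_eq0; apply/eqP/ij.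
rewrite linearB /= dE add_lfunE opp_lfunE !comp_lfunE vu !linear0 addr0 gE.
by rewrite comp_lfunE subrr.
Qed.

End Extensions.

(** * Injective modules, cosyzygies and composition series *)

Section InjectiveAndSimpleModules.
Context {k : fieldType} {A : falgType k}.
Implicit Types M N E P Q S T X Y K L W Z : lmod A.

Lemma curry_exists (U V W : vectType k) (F : U -> V -> W) :
  (forall u, linear (F u)) -> (forall v, linear (F^~ v)) ->
  exists g : 'Hom(U, 'Hom(V, W)), forall u v, g u v = F u v.
Proof.
move=> Fr Fl; pose f u : {linear V -> W} :=
  HB.pack (F u) (GRing.isLinear.Build k V W _ (F u) (Fr u)).
have [g gE] : exists g : 'Hom(U, 'Hom(V, W)), forall u, g u = linfun (f u).
  apply: linfun_exists => c x y; apply/lfunP=> v.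
  by rewrite add_lfunE scale_lfunE !lfunE /=; exact: Fl.
by exists g => u v; rewrite gE lfunE.
Qed.

(* The coinduced module Hom_k(A, M) with (a f)(x) = f(x a). *)
Lemma injective_hull_exists M :
  exists (I : lmod A) (j : 'Hom(M, I)),
    [/\ injective_mod I, is_hom j & forall x, j x = 0 -> x = 0].
Proof.
have cl a : linear (fun f : 'Hom(A, M) => (f \o amulr a)%VF).
  by move=> c f g; apply/lfunP=> x; rewrite comp_lfunDl -comp_lfunZl.
pose bf a : {linear 'Hom(A, M) -> 'Hom(A, M)} := HB.pack
  (fun f : 'Hom(A, M) => (f \o amulr a)%VF) (GRing.isLinear.Build k _ _ _ _ (cl a)).
pose act a : 'End('Hom(A, M)) := linfun (bf a).
have actE a f x : act a f x = f (x * a).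
  by rewrite lfunE /= comp_lfunE lfunE.
have al : linear act.
  move=> c a b; apply/lfunP=> f; apply/lfunP=> x.
  by rewrite !(add_lfunE, scale_lfunE) !actE mulrDr -scalerAr linearP.
have a1 : act 1 = \1%VF.
  by apply/lfunP=> f; apply/lfunP=> x; rewrite actE mulr1 id_lfunE.
have aM a b : act (a * b) = (act a \o act b)%VF.
  by apply/lfunP=> f; apply/lfunP=> x; rewrite comp_lfunE !actE mulrA.
have [j jE] : exists j : 'Hom(M, 'Hom(A, M)), forall x a, j x a = lact M a x.
  apply: curry_exists => [x c a b | a c x y]; first exact: lact_linearl.
  exact: linearP.
exists (Lmod al a1 aM), j; split.
- move=> N; have [K [P [u [v [uv prP]]]]] := presentation_exists N.
  apply: (extends_Ext1_eq0 uv prP) => f /is_homP hf.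
  case/short_exactP: uv => /is_homP hu hv /lker0E /eqP iu _ _.
  (* Maps into the coinduced module correspond to k-linear maps into M by evaluation at 1. The
     k-linear map belonging to f is extended along the linear left inverse of u and then coinduced
     again. *)
  have [g gE] : exists g : 'Hom(P, 'Hom(A, M)),
      forall x a, g x a = f (u^-1%VF (lact P a x)) 1.
    apply: curry_exists => [x c a b | a c x y].
      by rewrite lact_linearl !linearP /= add_lfunE scale_lfunE.
    by rewrite !linearP /= add_lfunE scale_lfunE.
  exists g; first apply/is_homP=> b x.
    by apply/lfunP=> a; rewrite gE -lact_mul /= actE gE.
  move=> x; apply/lfunP=> a.
  by rewrite gE -hu lker0_lfunK // hf /= actE mul1r.
- by apply/is_homP=> a x; apply/lfunP=> b; rewrite jE /= actE jE lact_mul.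
- by move=> x /lfunP/(_ 1); rewrite jE lact_one zero_lfunE.
Qed.

Lemma cosyzygy_exists M :
  exists (C I : lmod A) (j : 'Hom(M, I)) (q : 'Hom(I, C)), short_exact j q /\ injective_mod I.
Proof.
have [I [j [injI hj ij]]] := injective_hull_exists M.
by have [C [q jq]] := quot_exact hj ij; exists C, I, j, q.
Qed.

(** A choice is fixed so that the construction can be iterated: Ext^1(N, -) at [iter n cosyzygy M]
    is Ext^(n+1)(N, M). *)
Definition cosyzygy M : lmod A :=
  proj1_sig (constructive_indefinite_description _ (cosyzygy_exists M)).

Lemma cosyzygyP M :
  exists (I : lmod A) (j : 'Hom(M, I)) (q : 'Hom(I, cosyzygy M)),
    short_exact j q /\ injective_mod I.
Proof. exact: proj2_sig (constructive_indefinite_description _ (cosyzygy_exists M)). Qed.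

(** Dimension shifting: both groups are Ext^2(N, M). *)
Lemma Ext1_eq0_cosyzygy N M K P (i : 'Hom(K, P)) (p : 'Hom(P, N)) :
  short_exact i p -> projective P -> Ext1_eq0 N (cosyzygy M) <-> Ext1_eq0 K M.
Proof.
move=> ip prP; have [I [j [q [jq injI]]]] := cosyzygyP M.
split=> [NC | KM]; first exact: (Ext1_eq0_coshift ip prP jq injI NC).
exact: (Ext1_eq0_shift ip prP jq KM (injI N)).
Qed.

Lemma dim_eq0P M : dim M = 0%N <-> forall x : M, x = 0.
Proof.
rewrite -dimvf; split=> [/eqP | M0].
  by rewrite dimv_eq0 => /eqP e x; apply/eqP; rewrite -memv0 -e memvf.
by apply/eqP; rewrite dimv_eq0; apply/eqP/vspaceP=> x; rewrite (M0 x) !mem0v.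
Qed.

Lemma dim_gt0P M : (0 < dim M)%N <-> exists x : M, x <> 0.
Proof.
rewrite lt0n; split=> [/eqP d0 | [x x0]].
  apply: NNPP => nx; apply: d0; apply/dim_eq0P => x.
  by apply: NNPP => x0; apply: nx; exists x.
by apply/eqP=> /dim_eq0P M0; exact: x0 (M0 x).
Qed.

Lemma dim_short_exact M E N (i : 'Hom(M, E)) (p : 'Hom(E, N)) :
  short_exact i p -> (dim E = dim M + dim N)%N.
Proof.
move=> [_ _ ii ip ps].
have := limg_ker_dim p fullv; have := limg_ker_dim i fullv.
by rewrite !capfv ii dimv0 add0n -ip ps !dimvf => -> ->.
Qed.

Lemma dim_epi M N (p : 'Hom(M, N)) : (forall z, exists y, p y = z) ->
  (dim N <= dim M)%N.
Proof.
move=> /limg_fullP ps; have := limg_ker_dim p fullv.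
by rewrite ps !dimvf => <-; rewrite leq_addl.
Qed.

Lemma zero_mod_exists : exists Z : lmod A, forall x : Z, x = 0.
Proof.
have [Z [i [_ ii i0 _]]] := ker_exists (hom1 (@regular_lmod k A)).
by exists Z => x; apply: ii; rewrite -(i0 x) id_lfunE.
Qed.

Lemma projective_zero Z : (forall x : Z, x = 0) -> projective Z.
Proof.
by move=> Z0; apply: add_closed_zero Z0;
  [exact: projective_add_closed | exact: regular_projective].
Qed.

Definition iso M N (f : 'Hom(M, N)) :=
  [/\ is_hom f, forall x, f x = 0 -> x = 0 & forall z, exists y, f y = z].

Lemma isomorphicP M N : isomorphic M N <-> exists f : 'Hom(M, N), iso f.
Proof.
split=> [[f [hf /lker0E fi /limg_fullP fs]] | [f [hf fi fs]]]; exists f.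
  by split.
by split=> //; [exact/lker0E | exact/limg_fullP].
Qed.

Lemma iso_inverse M N (f : 'Hom(M, N)) : iso f ->
  exists g : 'Hom(N, M), [/\ iso g, forall x, g (f x) = x & forall y, f (g y) = y].
Proof.
move=> [hf fi fs].
have [g hg gE] : exists2 g : 'Hom(N, M), is_hom g & forall x, f (g x) = (\1%VF : 'End(N)) x.
  by apply: hom_factor_mono => //; exact: hom1.
have fg y : f (g y) = y by rewrite gE id_lfunE.
have gf x : g (f x) = x.
  by apply/eqP; rewrite -subr_eq0; apply/eqP/fi; rewrite linearB /= fg subrr.
exists g; split=> //; split=> // [y y0 | x]; last by exists (f x).
by rewrite -[y]fg y0 linear0.
Qed.

Lemma isomorphic_refl M : isomorphic M M.
Proof.
apply/isomorphicP; exists \1%VF; split; first exact: hom1.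
  by move=> x; rewrite id_lfunE.
by move=> x; exists x; rewrite id_lfunE.
Qed.

Lemma isomorphic_sym M N : isomorphic M N -> isomorphic N M.
Proof.
case/isomorphicP=> f /iso_inverse[g [gi _ _]].
by apply/isomorphicP; exists g.
Qed.

Lemma isomorphic_exact M N Z : isomorphic M N -> (forall x : Z, x = 0) ->
  exists f : 'Hom(M, N), short_exact f (0 : 'Hom(N, Z)).
Proof.
move=> /isomorphicP[f [hf fi fs]] Z0; exists f; apply/short_exactP; split=> //.
- exact: hom0.
- by move=> z; exists 0; rewrite linear0 (Z0 z).
Qed.

(** The extension closure as an inductive predicate, which permits induction over filtrations
    without submodules; [filtP] identifies it with [filt]. Closure under isomorphism is an extension
    by zero. *)
Inductive fil (F : lmod A -> Prop) : lmod A -> Prop :=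
  | fil_zero Z : (forall x : Z, x = 0) -> fil F Z
  | fil_in M : F M -> fil F M
  | fil_ext M E N (i : 'Hom(M, E)) (p : 'Hom(E, N)) :
      short_exact i p -> fil F M -> fil F N -> fil F E.

Lemma fil_iso F M N : isomorphic M N -> fil F M -> fil F N.
Proof.
move=> MN FM; have [Z Z0] := zero_mod_exists.
have [f fe] := isomorphic_exact MN Z0.
by apply: (fil_ext fe) => //; exact: fil_zero.
Qed.

Lemma fil_sub (F F' : lmod A -> Prop) M :
  (forall X, F X -> F' X) -> fil F M -> fil F' M.
Proof.
move=> FF'; elim=> [Z Z0 | X FX | X E Y i p ip _ FX _ FY].
- exact: fil_zero.
- by apply: fil_in; exact: FF'.
- exact: fil_ext ip FX FY.
Qed.

Lemma Ext1_eq0_isol M N N' : isomorphic N N' -> Ext1_eq0 N M -> Ext1_eq0 N' M.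
Proof.
move=> NN' NM; have [Z Z0] := zero_mod_exists.
have [f fe] := isomorphic_exact NN' Z0.
by apply: (Ext1_eq0_extl fe) => //; apply: projective_Ext1_eq0; exact: projective_zero.
Qed.

Lemma Ext1_eq0_isor N M M' : isomorphic M M' -> Ext1_eq0 N M -> Ext1_eq0 N M'.
Proof.
move=> /isomorphicP[f /[dup] /iso_inverse[g [[hg _ _] gf fg]] [hf _ _]].
exact: (add_closed_retract (@Ext1_eq0_add_closedr _ _ N) hf hg fg).
Qed.

Lemma fil_Ext1_eq0l F M W : (forall X, F X -> Ext1_eq0 X M) -> fil F W -> Ext1_eq0 W M.
Proof.
move=> FM; elim=> [Z Z0 | X /FM // | X E Y i p ip _ XM _ YM].
  by apply: projective_Ext1_eq0; exact: projective_zero.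
exact: Ext1_eq0_extl ip XM YM.
Qed.

Lemma Ext1_eq0_zeror N Z : (forall x : Z, x = 0) -> Ext1_eq0 N Z.
Proof.
move=> Z0; have [I [j [injI _ _]]] := injective_hull_exists Z.
exact: (add_closed_zero (@Ext1_eq0_add_closedr _ _ N) (injI N)).
Qed.

Lemma fil_Ext1_eq0r F N W : (forall X, F X -> Ext1_eq0 N X) -> fil F W -> Ext1_eq0 N W.
Proof.
move=> FN; elim=> [Z Z0 | X /FN // | X E Y i p ip _ XM _ YM].
  exact: Ext1_eq0_zeror.
exact: Ext1_eq0_extr ip XM YM.
Qed.

Lemma simple_neq0 S : simple S -> exists x : S, x <> 0.
Proof.
move=> [S0 _]; apply: NNPP => nx; apply: S0.
by apply/vspaceP=> x; rewrite memvf memv0; case: eqP => // x0; case: nx; exists x.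
Qed.

Lemma simple_epi M S (f : 'Hom(M, S)) : simple S -> is_hom f ->
  (exists x, f x <> 0) -> forall z, exists y, f y = z.
Proof.
move=> [_ sS] hf [x fx]; apply/limg_fullP.
case: (sS (img_submod hf)) => //= f0; case: fx; apply/eqP.
by rewrite -memv0 -f0 memv_img ?memvf.
Qed.

Lemma simple_mono N S (f : 'Hom(S, N)) : simple S -> is_hom f ->
  (exists x, f x <> 0) -> forall x, f x = 0 -> x = 0.
Proof.
move=> [_ sS] hf [x fx].
have st a : (lact S a @: lker f <= lker f)%VS.
  apply/subvP=> _ /memv_imgP[z zk ->]; rewrite memv_ker (is_homP f).1 //.
  by move: zk; rewrite memv_ker => /eqP ->; rewrite linear0.
apply/lker0E; case: (sS (Submod st)) => //= fk; case: fx; apply/eqP.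
by rewrite -memv_ker fk memvf.
Qed.

Lemma simple_quotient_exists M : (exists x : M, x <> 0) ->
  exists (S : lmod A) (p : 'Hom(M, S)), [/\ simple S, is_hom p & forall z, exists y, p y = z].
Proof.
have [n] := ubnP (dim M); elim: n M => // n IH M; rewrite ltnS => lt_n [x x0].
case: (classic (simple M)) => [sM | nsM].
  exists M, \1%VF; split=> //; first exact: hom1.
  by move=> y; exists y; rewrite id_lfunE.
have [N [N0 NT]] : exists N : submod M, (N : {vspace M}) <> 0%VS /\ (N : {vspace M}) <> fullv.
  apply: NNPP => nN; apply: nsM; split.
    by move/vspaceP/(_ x); rewrite memvf memv0 => /esym/eqP.
  move=> N; apply: NNPP => /not_or_and[N0 NT]; apply: nN.
  by exists N.
have qs : forall z, exists y, qproj N y = z by exact/limg_fullP/limg_qproj.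
have [S [p [sS hp ps]]] : exists (S : lmod A) (p : 'Hom(quot_lmod N, S)),
    [/\ simple S, is_hom p & forall z, exists y, p y = z].
  apply: IH.
    apply: leq_trans lt_n; rewrite -!dimvf -(limg_qproj N).
    rewrite -(limg_ker_dim (qproj N) fullv) capfv lker_qproj -[X in (X < _)%N]add0n ltn_add2r.
    by rewrite lt0n dimv_eq0; apply/eqP.
  apply: NNPP => nx; apply: NT; apply/eqP; rewrite eqEsubv subvf /=.
  apply/subvP=> y _; rewrite -(lker_qproj N) memv_ker; case: eqP => // y0.
  by case: nx; exists (qproj N y).
exists S, (p \o qproj N)%VF; split=> //.
  apply: hom_comp => //; exact: qproj_hom.
by move=> z; have [y <-] := ps z; have [t <-] := qs y; exists t; rewrite comp_lfunE.
Qed.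

Lemma fil_simple M : fil (@simple k A) M.
Proof.
have [n] := ubnP (dim M); elim: n M => // n IH M; rewrite ltnS => lt_n.
case: (classic (exists x : M, x <> 0)) => [x0 | nx]; last first.
  by apply: fil_zero => x; apply: NNPP => x0; apply: nx; exists x.
have [S [p [sS hp ps]]] := simple_quotient_exists x0.
have [K [i ip]] := kernel_exact hp ps.
apply: (fil_ext ip); last exact: fil_in.
apply: IH; apply: leq_trans lt_n; rewrite (dim_short_exact ip).
by rewrite -addn1 leq_add2l; apply/dim_gt0P; exact: simple_neq0.
Qed.

End InjectiveAndSimpleModules.

(** * Triangular algebras *)

Section Triangular.
Context {k : fieldType} {B : falgType k}.
Implicit Types M N E P Q S T X Y K L W Z D : lmod B.

Lemma simple_iso S T (f : 'Hom(S, T)) : simple S -> simple T -> is_hom f ->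
  (exists x, f x <> 0) -> iso f.
Proof. by move=> sS sT hf f0; split=> //; [exact: simple_mono | exact: simple_epi]. Qed.

Lemma fil_hom0r F P W (f : 'Hom(P, W)) : 
  (forall X (g : 'Hom(P, X)), F X -> is_hom g -> forall x, g x = 0) ->
  fil F W -> is_hom f -> forall x, f x = 0.
Proof.
move=> F0 FW; elim: FW f => [Z Z0 | X FX | X E Y i p ip _ IX _ IY] f hf x //.
  exact: F0.
case/short_exactP: ip => hi hp ii [pi pex] ps.
have [g hg gE] : exists2 g : 'Hom(P, X), is_hom g & forall x, i (g x) = f x.
  apply: hom_factor_mono => // z; apply: pex.
  by have := IY _ (hom_comp hp hf) z; rewrite comp_lfunE.
by rewrite -gE IX ?linear0.
Qed.

Lemma fil_hom0l F T W (f : 'Hom(W, T)) : 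
  (forall X (g : 'Hom(X, T)), F X -> is_hom g -> forall x, g x = 0) ->
  fil F W -> is_hom f -> forall x, f x = 0.
Proof.
move=> F0 FW; elim: FW f => [Z Z0 | X FX | X E Y i p ip _ IX _ IY] f hf x.
- by rewrite (Z0 x) linear0.
- exact: F0.
case/short_exactP: ip => hi hp ii [pi pex] ps.
have [g hg gE] : exists2 g : 'Hom(Y, T), is_hom g & forall x, g (p x) = f x.
  apply: hom_factor_epi => // z /pex[y <-].
  by have := IX _ (hom_comp hf hi) y; rewrite comp_lfunE.
by rewrite -gE IY.
Qed.

(* Walks in the Ext-quiver starting at S have fewer than n vertices. *)
Fixpoint low n S : Prop :=
  if n is n'.+1 then forall T, simple T -> Ext1_neq0 S T -> low n' T else False.

Lemma lowS n S : low n S -> low n.+1 S.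
Proof. by elim: n S => // n IH S h T sT ST; apply: IH; exact: h. Qed.

Lemma low_iso n S T : isomorphic S T -> low n S -> low n T.
Proof.
case: n => // n ST h X sX TX; apply: h => //; apply: NNPP => /Ext1_eq0P SX.
by move: TX; apply/Ext1_eq0P; exact: Ext1_eq0_isol SX.
Qed.

(** B maps onto a module D filtered by the first simples. The kernel of B -> D must map onto the
    next simple, or else B -> S_m would factor through D and S_m would be isomorphic to an earlier
    one; hence B also maps onto D ⊕ S_m. This bounds the number of simples by dim B. *)
Lemma nonisomorphic_simples_bound m (S : nat -> lmod B) :
    (forall i, (i < m)%N -> simple (S i)) ->
    (forall i j, (i < j < m)%N -> ~ isomorphic (S i) (S j)) ->
  exists (D : lmod B) (p : 'Hom(@regular_lmod k B, D)),
    [/\ is_hom p, forall z, exists y, p y = z,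
        fil (fun X => exists2 i, (i < m)%N & X = S i) D & (m <= dim D)%N].
Proof.
elim: m => [|m IH] sS niso.
  have [Z Z0] := zero_mod_exists (A := B).
  exists Z, 0; split=> //; [exact: hom0 | | exact: fil_zero].
  by move=> z; exists 0; rewrite linear0 (Z0 z).
have [||D [p [hp ps FD mD]]] := IH; [by move=> i im; exact/sS/ltnW | | ].
  by move=> i j /andP[ij jm]; apply: niso; rewrite ij /= ltnW.
have sm := sS m (leqnn _).
have [x x0] := simple_neq0 sm.
have [q hq qE] := regular_hom_exists x.
have qx : exists b, q b <> 0 by exists (1 : B); rewrite qE lact_one.
have [L [l lp]] := kernel_exact hp ps.
case/short_exactP: (lp) => hl _ il [pl pex] _.
have ls : forall z, exists y, (q \o l)%VF y = z.
  apply: simple_epi => //; first exact: hom_comp.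
  apply: NNPP => nx.
  have [g hg gE] : exists2 g : 'Hom(D, S m), is_hom g & forall x, g (p x) = q x.
    apply: hom_factor_epi => // y /pex[z <-].
    by apply: NNPP => z0; apply: nx; exists z; rewrite comp_lfunE.
  case: qx => b; apply; rewrite -gE.
  apply: (fil_hom0l _ FD hg) => X u [i im eX] hu y; subst X.
  apply: NNPP => y0; apply: (niso i m); first by rewrite im /=.
  apply/isomorphicP; exists u; apply: simple_iso => //; first exact/sS/ltnW.
  by exists y.
have [E [i [j [p1 [q1 [[hi hj hp1 hq1] [p1i q1j q1i p1j ij]]]]]]] := biprod_exists D (S m).
have eq : short_exact i q1.
  apply/short_exactP; split=> //.
  - by move=> y y0; rewrite -[y]p1i y0 linear0.
  - split=> // y y0; exists (p1 y); rewrite -[RHS]ij y0 linear0 addr0 //.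
  - by move=> z; exists (j z).
exists E, ((i \o p)%VF + (j \o q)%VF); split.
- by apply: homD; exact: hom_comp.
- move=> z; have [y yE] := ps (p1 z); have [t tE] := ls (q1 z - q y).
  exists (y + l t); rewrite add_lfunE !comp_lfunE !linearD /= pl linear0 addr0 yE.
  rewrite -(linearD j); move: tE; rewrite comp_lfunE => ->.
  by rewrite [q y + _]addrC subrK ij.
- apply: (fil_ext eq); last by apply: fil_in; exists m.
  by apply: fil_sub FD => X [n nm ->]; exists n => //; exact: ltnW.
- rewrite (dim_short_exact eq) -addn1 leq_add //.
  by apply/dim_gt0P; exact: simple_neq0.
Qed.

Lemma walk_exists n S : simple S -> ~ low n S -> exists w : nat -> lmod B,
  [/\ w 0 = S, forall i, (i <= n)%N -> simple (w i)
    & forall i, (i < n)%N -> Ext1_neq0 (w i) (w i.+1)].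
Proof.
elim: n S => [|n IH] S sS nS; first by exists (fun _ => S).
have [T [sT ST nT]] : exists T, [/\ simple T, Ext1_neq0 S T & ~ low n T].
  apply: NNPP => nT; apply: nS => T sT ST; apply: NNPP => lT.
  by apply: nT; exists T.
have [w [w0 sw ww]] := IH T sT nT.
exists (fun i => if i is i'.+1 then w i' else S); split=> // -[|i] //.
- by rewrite ltnS; exact: sw.
- by rewrite w0.
- by rewrite ltnS; exact: ww.
Qed.

(** A walk with more than dim B vertices meets two isomorphic simples, and the stretch between them
    closes up to an oriented cycle. *)
Lemma triangular_low : triangular B -> exists n, forall S, simple S -> low n S.
Proof.
move=> tri; set n := dim (@regular_lmod k B); exists n => S sS.
apply: NNPP => /(walk_exists sS)[w [_ sw ww]].
have [i [j [/andP[ij jn] wij]]] : exists i j, (i < j < n.+1)%N /\ isomorphic (w i) (w j).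
  apply: NNPP => nij.
  have [||D [p [hp ps _]]] := @nonisomorphic_simples_bound n.+1 w; last first.
  - by rewrite ltnNge (dim_epi ps).
  - by move=> i j ij wij; apply: nij; exists i, j.
  - by move=> i; rewrite ltnS; exact: sw.
rewrite ltnS in jn.
pose m := (j - i.+1)%N; have jE : j = (i + m.+1)%N by rewrite addnS -addSn subnKC.
apply: (tri m (fun t : 'I_m.+1 => w (i + t)%N)) => [t | t].
  apply: sw; apply: leq_trans jn; rewrite jE leq_add2l ltnW //.
have [tm | tm] := ltnP t m.
  rewrite /= modn_small ?ltnS // addnS; apply: ww.
  by apply: leq_trans jn; rewrite jE ltn_add2l ltnS ltnW.
rewrite /=; have -> : (t = m :> nat) by apply/eqP; rewrite eqn_leq tm -ltnS ltn_ord.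
(* The last arrow of the stretch ends at [w j]; the isomorphism with [w i] redirects it to the
   starting vertex. *)
rewrite modnn addn0; apply: NNPP => /Ext1_eq0P h.
have : Ext1_neq0 (w (i + m)%N) (w j).
  by rewrite jE addnS; apply: ww; rewrite -addnS -jE.
by apply/Ext1_eq0P; exact: Ext1_eq0_isor wij h.
Qed.

Lemma max_nat_exists (R : nat -> Prop) b : (exists n, R n) ->
  (forall n, R n -> (n <= b)%N) -> exists2 n, R n & forall m, R m -> (m <= n)%N.
Proof.
elim: b => [|b IH] Rn Rb.
  have [n Rn'] := Rn; exists n => // m /Rb mb; apply: leq_trans mb _; exact: leq0n.
case: (classic (R b.+1)) => [Rb1 | nRb1]; first by exists b.+1.
apply: IH => // n nR; have := Rb _ nR; rewrite leq_eqVlt => /orP[/eqP e|//].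
by case: nRb1; rewrite -e.
Qed.

(** Every proper submodule of P lies in Ker p. For simple S this says that P is local with top S,
    and if P is also projective, that p is the projective cover. *)
Definition local_over S P (p : 'Hom(P, S)) :=
  [/\ is_hom p, forall z, exists y, p y = z &
  forall N (f : 'Hom(N, P)), is_hom f -> (exists y, p (f y) <> 0) ->
    forall z, exists y, f y = z].

Lemma local_dim S P (p : 'Hom(P, S)) : simple S -> local_over p ->
  (dim P <= dim (@regular_lmod k B))%N.
Proof.
move=> sS [hp ps loc]; have [x x0] := simple_neq0 sS; have [y yE] := ps x.
have [f hf fE] := regular_hom_exists y.
apply: (dim_epi (p := f)); apply: loc => //.
by exists (1 : B); rewrite fE lact_one yE.
Qed.

(** A submodule of E not killed in S maps onto P. Either it contains T, and is all of E, or it meets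
    T trivially, and then it splits the extension. *)
Lemma local_extension S P (p : 'Hom(P, S)) T E (i : 'Hom(T, E)) (q : 'Hom(E, P)) :
    simple T -> local_over p -> short_exact i q ->
    ~ (exists s : 'Hom(P, E), is_hom s /\ (q \o s)%VF = \1%VF) ->
  local_over (p \o q)%VF.
Proof.
move=> sT [hp ps loc] /short_exactP[hi hq ii [qi qex] qs] nsplit; split.
- exact: hom_comp.
- by move=> z; have [y <-] := ps z; have [x <-] := qs y; exists x; rewrite comp_lfunE.
move=> N f hf [y0 y0E].
have qf : forall z, exists y, (q \o f)%VF y = z.
  by apply: loc; [exact: hom_comp | exists y0; move: y0E; rewrite !comp_lfunE].
have [I [g [j [hg hj ij gs jg]]]] := hom_image hf.
have [C [c jc]] := quot_exact hj ij.
case/short_exactP: jc => _ hc _ [cj cex] cs.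
case: (classic (exists2 x, x <> 0 & c (i x) = 0)) => [[x x0 cx] z | nx].
  have ci0 y : c (i y) = 0.
    apply: NNPP => y1; apply: x0; rewrite -comp_lfunE in cx.
    apply: (simple_mono sT (hom_comp hc hi) _ cx).
    by exists y; rewrite comp_lfunE.
  have [y yE] := qf (q z); rewrite comp_lfunE in yE.
  have [|t tE] := qex (z - f y); first by rewrite linearB /= yE subrr.
  have [u uE] := cex _ (ci0 t); have [v vE] := gs u.
  by exists (v + y); rewrite linearD /= -jg vE uE tE subrK.
case: nsplit.
have qji x : q (j x) = 0 -> x = 0.
  move=> qj; have [t tE] := qex _ qj; apply: ij; rewrite -tE.
  suff -> : t = 0 by rewrite linear0.
  by apply: NNPP => t0; apply: nx; exists t; rewrite // tE cj.
have [s hs sE] : exists2 s : 'Hom(P, E), is_hom s & forall x, s ((q \o j)%VF x) = j x.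
  apply: hom_factor_epi => //; first exact: hom_comp.
  - by move=> z; have [y <-] := qf z; exists (g y); rewrite !comp_lfunE jg.
  - by move=> x; rewrite comp_lfunE => /qji ->; rewrite linear0.
exists s; split=> //; apply/lfunP=> z; have [y <-] := qf z.
by rewrite comp_lfunE id_lfunE comp_lfunE -{1}jg -[q (j _)]comp_lfunE sE jg.
Qed.

(** Local modules with top S are cyclic, so their dimension is bounded by dim B. One of maximal
    dimension has no nonsplit extension by a simple ([local_extension]), so it is projective. *)
Lemma projective_cover_exists S : simple S ->
  exists (P : lmod B) (p : 'Hom(P, S)), projective P /\ local_over p.
Proof.
move=> sS.
pose R n := exists (P : lmod B) (p : 'Hom(P, S)), local_over p /\ dim P = n.
have [||_ [P [p [lp <-]]] Pmax] := @max_nat_exists R (dim (@regular_lmod k B)).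
- exists (dim S), S, \1%VF; split=> //; split; first exact: hom1.
    by move=> z; exists z; rewrite id_lfunE.
  move=> N f hf [y fy]; apply: simple_epi => //; exists y.
  by move: fy; rewrite id_lfunE.
- by move=> _ [P [p [lp <-]]]; exact: local_dim lp.
exists P, p; split=> //; apply: Ext1_eq0_projective => M.
apply: fil_Ext1_eq0r (fil_simple M) => T sT E i q iq; apply: NNPP => ns.
have lE := local_extension sT lp iq ns.
have := Pmax (dim E); rewrite (dim_short_exact iq) leqNgt.
rewrite -[X in (X < _)%N]add0n ltn_add2r => h; apply: (negP (h _)).
  by exists E, (p \o q)%VF; rewrite (dim_short_exact iq).
by apply/dim_gt0P; exact: simple_neq0.
Qed.

(** Composition factors are taken from the top: if M/N is already filtered and T is a simple
    quotient of N outside F, then the extension of M/N by T splits, so T is a quotient of M, against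
    the second hypothesis. *)
Lemma fil_top (F : lmod B -> Prop) M :
    (forall X T, F X -> simple T -> ~ F T -> Ext1_eq0 X T) ->
    (forall T (g : 'Hom(M, T)), simple T -> is_hom g ->
       (forall z, exists y, g y = z) -> F T) ->
  fil F M.
Proof.
move=> Farr Ftop.
suff: forall n N Q (i : 'Hom(N, M)) (p : 'Hom(M, Q)), short_exact i p ->
    fil F Q -> (dim N < n)%N -> fil F M.
  have [Z Z0] := zero_mod_exists (A := B).
  move=> /(_ (dim M).+1 M Z \1%VF 0); apply=> //; last exact: fil_zero.
  apply/short_exactP; split=> //; [exact: hom1 | exact: hom0 | | | ].
  - by move=> x; rewrite id_lfunE.
  - by split=> x //; exists x; rewrite id_lfunE.
  - by move=> z; exists 0; rewrite (Z0 z).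
elim=> // n IH N Q i p ip FQ; rewrite ltnS => Nn.
case/short_exactP: (ip) => hi hp ii [pi pex] ps.
case: (classic (exists x : N, x <> 0)) => [x0 | nx]; last first.
  apply: (fil_iso _ FQ); apply: isomorphic_sym; apply/isomorphicP; exists p.
  split=> // x /pex[y <-]; rewrite (_ : y = 0) ?linear0 //.
  by apply: NNPP => y0; apply: nx; exists y.
have [T [g [sT hg gs]]] := simple_quotient_exists x0.
have [N' [j jg]] := kernel_exact hg gs.
case/short_exactP: (jg) => hj _ ij [gj gex] _.
have hij := hom_comp hi hj.
have [Q' [p' ijp']] : exists (Q' : lmod B) (p' : 'Hom(M, Q')), short_exact (i \o j)%VF p'.
  by apply: quot_exact => // x; rewrite comp_lfunE => /ii/ij.
case/short_exactP: (ijp') => _ hp' _ [p'ij p'ex] p's.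
have p'ij' x : p' (i (j x)) = 0 by rewrite -(p'ij x) comp_lfunE.
have [t ht tE] : exists2 t : 'Hom(T, Q'), is_hom t & forall x, t (g x) = (p' \o i)%VF x.
  apply: hom_factor_epi => //; first exact: hom_comp.
  by move=> x /gex[y <-]; rewrite comp_lfunE.
have [q hq qE] : exists2 q : 'Hom(Q', Q), is_hom q & forall x, q (p' x) = p x.
  apply: hom_factor_epi => // x /p'ex[y <-]; rewrite comp_lfunE; exact: pi.
have tq : short_exact t q.
  apply/short_exactP; split=> //.
  - move=> x; have [y <-] := gs x; rewrite tE comp_lfunE => /p'ex[z].
    rewrite comp_lfunE => /eqP; rewrite -subr_eq0 -linearB /= => /eqP/ii/eqP.
    by rewrite subr_eq0 => /eqP <-; rewrite gj.
  - split=> [x | y].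
      by have [y <-] := gs x; rewrite tE comp_lfunE qE pi.
    have [x <-] := p's y; rewrite qE => /pex[z <-].
    by exists (g z); rewrite tE comp_lfunE.
  - by move=> z; have [y <-] := ps z; exists (p' y); rewrite qE.
have FT : F T.
  apply: NNPP => nFT.
  have QT : Ext1_eq0 Q T by apply: fil_Ext1_eq0l FQ => X FX; exact: Farr.
  have [r hr rE] := Ext1_eq0_retraction QT tq.
  apply: nFT; apply: (Ftop T (r \o p')%VF) => //; first exact: hom_comp.
  move=> z; have [y yE] := p's (t z).
  by exists y; rewrite comp_lfunE yE.
apply: (IH _ _ _ _ ijp').
  by apply: (fil_ext tq) => //; exact: fil_in.
apply: leq_trans Nn; rewrite (dim_short_exact jg) -addn1 leq_add2l.
by apply/dim_gt0P; exact: simple_neq0.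
Qed.

(** By [fil_top] only simple quotients T of the radical K matter, and there must be an arrow S -> T.
    Otherwise K -> T extends to P; as P is local, p factors through this extension by an injective
    map T -> S, although p vanishes on K and K -> T is onto. *)
Lemma cover_kernel n S P K (p : 'Hom(P, S)) (i : 'Hom(K, P)) :
    simple S -> low n.+1 S -> projective P -> local_over p -> short_exact i p ->
  fil (fun T => simple T /\ low n T) K.
Proof.
move=> sS lS prP [hp ps loc] ip.
apply: fil_top => [X T [sX lX] sT nT | T g sT hg gs].
  apply: NNPP => XT; apply: nT; split=> //.
  have {}XT : Ext1_neq0 X T by apply: NNPP => /Ext1_eq0P.
  by case: n lX {lS} => // n lX; apply/lowS/lX.
split=> //; apply: lS => //; apply: NNPP => /Ext1_eq0P ST.
have [h hh hE] := Ext1_eq0_extends ST ip hg.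
case/short_exactP: ip => hi _ ii [pi pex] _.
have [t t0] := simple_neq0 sT; have [y yE] := gs t.
have hs : forall z, exists y, h y = z.
  by apply: simple_epi => //; exists (i y); rewrite hE yE.
have [G [j [hj ij hj0 hex]]] := ker_exists hh.
have pj x : p (j x) = 0.
  apply: NNPP => px; have [|z zE] := loc _ _ hj _ (i y); first by exists x.
  by apply: t0; rewrite -yE -hE -zE hj0.
have [u hu uE] : exists2 u : 'Hom(T, S), is_hom u & forall x, u (h x) = p x.
  by apply: hom_factor_epi => // x /hex[z <-].
apply: t0; apply: (simple_mono sT hu); last by rewrite -yE -hE uE pi.
have [s s0] := simple_neq0 sS; have [x xE] := ps s.
by exists (h x); rewrite uE xE.
Qed.

(** That is, Ext^(n+1)(W, M) = 0: passing to the kernel of a projective cover lowers the level by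
    one and uses up one cosyzygy. *)
Lemma fil_low_Ext1_eq0 n W M : fil (fun T => simple T /\ low n T) W ->
  Ext1_eq0 W (iter n cosyzygy M).
Proof.
elim: n W M => [|n IH] W M; apply: fil_Ext1_eq0l => S [sS] // lS.
have [P [p [prP lp]]] := projective_cover_exists sS.
have [hp ps _] := lp.
have [K [i ip]] := kernel_exact hp ps.
by apply/(Ext1_eq0_cosyzygy _ ip prP); apply: IH; exact: cover_kernel lp ip.
Qed.

(** A module Z in C is an n-th syzygy of some W in C, so Ext^1(Z, M) = Ext^(n+1)(W, M), which
    vanishes for n the bound on levels. *)
Lemma acyclic_projective (C : lmod B -> Prop) :
    triangular B ->
    (forall Z, C Z -> exists (P Z' : lmod B) (i : 'Hom(Z, P)) (p : 'Hom(P, Z')),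
       [/\ short_exact i p, projective P & C Z']) ->
  forall Z, C Z -> projective Z.
Proof.
move=> /triangular_low[n nB] Cstep.
have step m Z M : C Z -> (forall W, Ext1_eq0 W (iter m cosyzygy M)) -> Ext1_eq0 Z M.
  elim: m Z M => [|m IH] Z M CZ WM; first exact: WM.
  have [P [Z' [i [p [ip prP CZ']]]]] := Cstep _ CZ.
  apply/(Ext1_eq0_cosyzygy _ ip prP); apply: IH => // W.
  by rewrite -iterSr.
move=> Z CZ; apply: Ext1_eq0_projective => M; apply: (step n) => // W.
apply: fil_low_Ext1_eq0; apply: fil_sub (fil_simple W) => T sT.
by split=> //; exact: nB.
Qed.

End Triangular.

(** * Gorenstein projective modules *)

Section GorensteinProjective.
Context {k : fieldType} {A : falgType k}.
Implicit Types M N E P Q S T X Y K L W Z G : lmod A.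

Definition has_coresolution_step (C : lmod A -> Prop) G :=
  exists (P G' : lmod A) (i : 'Hom(G, P)) (p : 'Hom(P, G')),
    [/\ short_exact i p, projective P & C G'].

Definition has_resolution_step (C : lmod A -> Prop) G :=
  exists (P G' : lmod A) (i : 'Hom(G', P)) (p : 'Hom(P, G)),
    [/\ short_exact i p, projective P & C G'].

(** A coinductive form of total acyclicity: the Gorenstein projectives are the largest such class,
    by [Gproj_coind] and [Gproj_gorenstein_class]. *)
Definition gorenstein_class (C : lmod A -> Prop) := forall G, C G ->
  [/\ Ext1_eq0 G regular_lmod, has_coresolution_step C G & has_resolution_step C G].

(** Splicing the sequences gives a complex with kernels Z i, and Ext^1(Z i, A) = 0 in every degree
    keeps it exact under Hom(-, A). *)
Lemma Gproj_splice (Z : int -> lmod A) :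
    (forall i, Ext1_eq0 (Z i) regular_lmod) ->
    (forall i, exists (P : lmod A) (e : 'Hom(Z i, P)) (p : 'Hom(P, Z (i + 1))),
       short_exact e p /\ projective P) ->
  Gproj (Z 1).
Proof.
move=> Zext Zstep.
have step i : exists x : {P : lmod A & ('Hom(Z i, P) * 'Hom(P, Z (i + 1)%R))%type},
    short_exact (tagged x).1 (tagged x).2 /\ projective (tag x).
  by have [P [e [p ep]]] := Zstep i; exists (existT _ P (e, p)).
pose x i := proj1_sig (constructive_indefinite_description _ (step i)).
have xP i : short_exact (tagged (x i)).1 (tagged (x i)).2 /\ projective (tag (x i)).
  exact: proj2_sig (constructive_indefinite_description _ (step i)).
pose P i := tag (x i); pose e i : 'Hom(Z i, P i) := (tagged (x i)).1.
pose p i : 'Hom(P i, Z (i + 1)) := (tagged (x i)).2.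
have ep i : short_exact (e i) (p i) by case: (xP i).
have prP i : projective (P i) by case: (xP i).
clearbody P e p; clear x xP step Zstep.
exists P, (fun i => (e (i + 1) \o p i)%VF); split.
- move=> i; split=> //; apply: hom_comp; first by case: (ep (i + 1)).
  by case: (ep i).
- move=> i; apply/limg_lkerP.
  have /short_exactP[_ _ _ _ ps] := ep i.
  have /short_exactP[_ _ _ [pe pex] _] := ep (i + 1).
  have /short_exactP[_ _ ei _ _] := ep (i + 1 + 1).
  split=> [y | y]; first by rewrite !comp_lfunE pe linear0.
  rewrite comp_lfunE => /ei/pex[z <-]; have [t <-] := ps z.
  by exists t; rewrite comp_lfunE.
- move=> i f hf /lfunP fd.
  have /short_exactP[_ _ _ _ ps] := ep i.
  have /short_exactP[_ hp _ [pe pex] ps'] := ep (i + 1).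
  have [g hg gE] : exists2 g : 'Hom(Z (i + 1 + 1), regular_lmod), is_hom g &
      forall y, g (p (i + 1) y) = f y.
    apply: hom_factor_epi => // y /pex[z <-]; have [t <-] := ps z.
    by have := fd t; rewrite !comp_lfunE zero_lfunE.
  have [h hh hE] := Ext1_eq0_extends (Zext _) (ep (i + 1 + 1)) hg.
  by exists h; split=> //; apply/lfunP=> y; rewrite !comp_lfunE hE gE.
have /short_exactP[he _ ei _ _] := ep 1; exists (e 1); split=> //.
  exact/lker0E.
have /short_exactP[_ _ _ [pe pex] _] := ep 1.
have /short_exactP[_ _ ei' _ _] := ep (1 + 1).
apply/limg_lkerP; split=> [y | y]; first by rewrite comp_lfunE pe linear0.
by rewrite comp_lfunE => /ei'/pex.
Qed.

Lemma Gproj_coind (C : lmod A -> Prop) G : gorenstein_class C -> C G -> Gproj G.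
Proof.
move=> gC CG; pose T := {M : lmod A | C M}.
have right (M : T) : exists N : T, exists (P : lmod A) (e : 'Hom(sval M, P)) (p : 'Hom(P, sval N)),
    short_exact e p /\ projective P.
  case: M => M CM; have [_ [P [N [i [p [ip prP CN]]]]] _] := gC M CM.
  by exists (exist _ N CN), P, i, p.
have left (M : T) : exists N : T, exists (P : lmod A) (e : 'Hom(sval N, P)) (p : 'Hom(P, sval M)),
    short_exact e p /\ projective P.
  case: M => M CM; have [_ _ [P [N [i [p [ip prP CN]]]]]] := gC M CM.
  by exists (exist _ N CN), P, i, p.
pose nx (M : T) := proj1_sig (constructive_indefinite_description _ (right M)).
pose pv (M : T) := proj1_sig (constructive_indefinite_description _ (left M)).
have nxP (M : T) : exists (P : lmod A) (e : 'Hom(sval M, P)) (p : 'Hom(P, sval (nx M))),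
    short_exact e p /\ projective P.
  exact: proj2_sig (constructive_indefinite_description _ (right M)).
have pvP (M : T) : exists (P : lmod A) (e : 'Hom(sval (pv M), P)) (p : 'Hom(P, sval M)),
    short_exact e p /\ projective P.
  exact: proj2_sig (constructive_indefinite_description _ (left M)).
pose g : T := exist _ G CG.
pose Z (i : int) : T := match i with Posz n => iter n nx g | Negz n => iter n.+1 pv g end.
have ZP i : exists (P : lmod A) (e : 'Hom(sval (Z i), P)) (p : 'Hom(P, sval (Z (i + 1)))),
    short_exact e p /\ projective P.
  case: i => [n | [|n]].
  - rewrite (_ : Posz n + 1 = Posz n.+1); first exact: nxP.
    by rewrite -PoszD addn1.
  - exact: pvP.
  - rewrite (_ : Negz n.+1 + 1 = Negz n); first exact: pvP.
    by rewrite !NegzE -addn1 PoszD opprD addrNK.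
(* The shift puts G, which is Z at 0, in degree 1, where [Gproj] reads off the kernel. *)
apply: (@Gproj_splice (fun i => sval (Z (i - 1)))) => i.
  by have [] := gC _ (proj2_sig (Z (i - 1))).
by have := ZP (i - 1); rewrite addrAC.
Qed.

Lemma Gproj_gorenstein_class : gorenstein_class (@Gproj k A).
Proof.
(* C admits the kernel in any degree, so that neighbouring kernels stay in it without reindexing the
   complex; [Gproj_coind] leads back to degree 1. *)
pose C M := exists (P : int -> lmod A) (d : forall i : int, 'Hom(P i, P (i + 1))),
  [/\ forall i, projective (P i) /\ is_hom (d i),
      forall i, limg (d i) = lker (d (i + 1)),
      forall i (f : 'Hom(P (i + 1), regular_lmod)), is_hom f ->
        (f \o d i)%VF = 0 ->
        exists g : 'Hom(P (i + 1 + 1), regular_lmod),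
          is_hom g /\ f = (g \o d (i + 1))%VF
    & exists i, exists e : 'Hom(M, P i),
        [/\ is_hom e, lker e = 0%VS & limg e = lker (d i)] ].
have GC M : Gproj M -> C M.
  by move=> [P [d [hd ex hex e]]]; exists P, d; split=> //; exists 1.
suff gC : gorenstein_class C.
  have CG M : C M -> Gproj M by exact: Gproj_coind.
  move=> G /GC/gC[EG [P [G' [i [p [ip prP CG']]]]] [Q [G'' [j [q [jq prQ CG'']]]]]].
  split=> //; first by exists P, G', i, p; split=> //; exact: CG.
  by exists Q, G'', j, q; split=> //; exact: CG.
move=> G [P [d [hd dex dhex [i [e [he /lker0E ei /limg_lkerP[de eex]]]]]]].
have dd l x : d (l + 1) (d l x) = 0 by have /limg_lkerP[] := dex l.
have step l K (a : 'Hom(K, P l)) N (b : 'Hom(N, P (l + 1))) :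
    is_hom a -> (forall x, a x = 0 -> x = 0) -> limg a = lker (d l) ->
    is_hom b -> (forall x, b x = 0 -> x = 0) -> limg b = lker (d (l + 1)) ->
    exists2 p : 'Hom(P l, N), short_exact a p & forall x, b (p x) = d l x.
  move=> ha ia /limg_lkerP[da aex] hb ib /limg_lkerP[db bex].
  have [p hp pE] : exists2 p : 'Hom(P l, N), is_hom p & forall x, b (p x) = d l x.
    apply: hom_factor_mono => //; first by case: (hd l).
    by move=> x; apply: bex.
  exists p => //; apply/short_exactP; split=> //.
    split=> [x | y py]; first by apply: ib; rewrite pE da.
    by apply: aex; rewrite -pE py linear0.
  move=> z; have /limg_lkerP[_ dx] := dex l; have [y yE] := dx _ (db z).
  exists y; apply/eqP; rewrite -subr_eq0; apply/eqP/ib.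
  by rewrite linearB /= pE yE subrr.
have kerd l : exists (K : lmod A) (a : 'Hom(K, P l)),
    [/\ is_hom a, forall x, a x = 0 -> x = 0 & limg a = lker (d l)].
  have [_ hdl] := hd l; have [K [a [ha ia da dx]]] := ker_exists hdl.
  by exists K, a; split=> //; apply/limg_lkerP.
have inC l K (a : 'Hom(K, P l)) : is_hom a -> (forall x, a x = 0 -> x = 0) ->
    limg a = lker (d l) -> C K.
  move=> ha ia ea; exists P, d; split=> //; exists l, a; split=> //; exact/lker0E.
have ee : limg e = lker (d i) by apply/limg_lkerP.
have [m mE] : exists m, i = m + 1 + 1 + 1.
  by exists (i - 1 - 1 - 1); rewrite !subrK.
subst i; split.
- have [K [a [ha ia ea]]] := kerd (m + 1 + 1).
  have [p ap pE] := step _ _ a _ e ha ia ea he ei ee.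
  apply: (extends_Ext1_eq0 ap); first by case: (hd (m + 1 + 1)).
  move=> f hf; have [L [b [hb ib eb]]] := kerd (m + 1).
  have [q /short_exactP[_ hq _ _ _] qE] := step _ _ b _ a hb ib eb ha ia ea.
  have [|g [hg gE]] := dhex m (f \o q)%VF (hom_comp hf hq).
    apply/lfunP=> x; rewrite !comp_lfunE zero_lfunE (_ : q _ = 0) ?linear0 //.
    by apply: ia; rewrite qE dd.
  have /limg_lkerP[_ dx] := dex (m + 1); have /limg_lkerP[da _] := ea.
  exists g => // x; have [y yE] := dx _ (da x).
  have -> : x = q y.
    by apply/eqP; rewrite -subr_eq0; apply/eqP/ia; rewrite linearB /= qE yE subrr.
  by rewrite qE -[g _]comp_lfunE -gE comp_lfunE.
- have [K [a [ha ia ea]]] := kerd (m + 1 + 1 + 1 + 1).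
  have [p ep _] := step _ _ e _ a he ei ee ha ia ea.
  exists (P (m + 1 + 1 + 1)), K, e, p; split=> //; last exact: inC ea.
  by case: (hd (m + 1 + 1 + 1)).
- have [K [a [ha ia ea]]] := kerd (m + 1 + 1).
  have [p ap _] := step _ _ a _ e ha ia ea he ei ee.
  exists (P (m + 1 + 1)), K, a, p; split=> //; last exact: inC ea.
  by case: (hd (m + 1 + 1)).
Qed.

Lemma Gproj_Ext1_eq0 G P : Gproj G -> projective P -> Ext1_eq0 G P.
Proof. by case/Gproj_gorenstein_class=> GA _ _; exact: Ext1_eq0_projr. Qed.

Lemma projective_Gproj P : projective P -> Gproj P.
Proof.
apply: (@Gproj_coind (@projective k A)) => Q prQ.
have [Z Z0] := zero_mod_exists (A := A); split; first exact: projective_Ext1_eq0.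
- exists Q, Z, \1%VF, 0; split=> //; last exact: projective_zero.
  apply/short_exactP; split=> //; [exact: hom1 | exact: hom0 | | | ].
  + by move=> x; rewrite id_lfunE.
  + by split=> x //; exists x; rewrite id_lfunE.
  + by move=> z; exists 0; rewrite (Z0 z).
- exists Q, Z, 0, \1%VF; split=> //; last exact: projective_zero.
  apply/short_exactP; split=> //; [exact: hom0 | exact: hom1 | | ].
  + by split=> [x | y]; rewrite id_lfunE ?zero_lfunE // => ->; exists 0; rewrite linear0.
  + by move=> z; exists z; rewrite id_lfunE.
Qed.

Lemma Gproj_iso_closed : iso_closed (@Gproj k A).
Proof.
move=> M N /isomorphicP[f fi] [P [d [hd dex dhex [e [he /lker0E ie /limg_lkerP[de eex]]]]]].
have [g [[hg ig gs] gf fg]] := iso_inverse fi.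
exists P, d; split=> //; exists (e \o g)%VF; split; first exact: hom_comp.
  by apply/lker0E=> x; rewrite comp_lfunE => /ie/ig.
apply/limg_lkerP; split=> [x | y /eex[x <-]]; first by rewrite comp_lfunE de.
by exists (f x); rewrite comp_lfunE gf.
Qed.

(** The horseshoe lemma for coresolutions by projectives; Ext^1(N, P) = 0 replaces injectivity of P
    in extending M -> P to E. *)
Lemma horseshoe_right M E N M' N' P Q (i : 'Hom(M, E)) (p : 'Hom(E, N))
    (a : 'Hom(M, P)) (b : 'Hom(P, M')) (c : 'Hom(N, Q)) (d : 'Hom(Q, N')) :
    short_exact i p -> short_exact a b -> short_exact c d ->
    Ext1_eq0 N P -> projective P -> projective Q ->
  exists (S E' : lmod A) (w : 'Hom(E, S)) (v : 'Hom(S, E')) (i' : 'Hom(M', E')) (p' : 'Hom(E', N')),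
    [/\ short_exact w v, short_exact i' p' & projective S].
Proof.
move=> ip /short_exactP[ha hb ia [ba bex] bs] /short_exactP[hc hd ic [dc dex] ds].
move=> NP prP prQ; have [u hu ui] := Ext1_eq0_extends NP ip ha.
case/short_exactP: ip => hi hp ii [pi pex] ps.
have [S [j1 [j2 [q1 [q2 [[hj1 hj2 hq1 hq2] [q1j1 q2j2 q2j1 q1j2 j1j2]]]]]]] := biprod_exists P Q.
pose w := (j1 \o u)%VF + (j2 \o (c \o p))%VF.
have hw : is_hom w by apply: homD; do 2?apply: hom_comp.
have wE x : w x = j1 (u x) + j2 (c (p x)) by rewrite add_lfunE !comp_lfunE.
have q1w x : q1 (w x) = u x by rewrite wE linearD /= q1j1 q1j2 addr0.
have q2w x : q2 (w x) = c (p x) by rewrite wE linearD /= q2j1 q2j2 add0r.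
have iw x : w x = 0 -> x = 0.
  move=> wx; have /pex[y yE] : p x = 0 by apply: ic; rewrite -q2w wx linear0.
  have y0 : y = 0 by apply: ia; rewrite -ui yE -q1w wx linear0.
  by rewrite -yE y0 linear0.
have [E' [v wv]] := quot_exact hw iw.
case/short_exactP: (wv) => _ hv _ [vw vex] vs.
have [i' hi' i'E] : exists2 i' : 'Hom(M', E'), is_hom i' &
    forall x, i' (b x) = (v \o j1)%VF x.
  apply: hom_factor_epi => //; first exact: hom_comp.
  move=> x /bex[y <-]; rewrite comp_lfunE -(vw (i y)) wE pi !linear0 addr0.
  by rewrite ui.
have [p' hp' p'E] : exists2 p' : 'Hom(E', N'), is_hom p' &
    forall x, p' (v x) = (d \o q2)%VF x.
  apply: hom_factor_epi => //; first exact: hom_comp.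
  by move=> x /vex[y <-]; rewrite comp_lfunE q2w dc.
exists S, E', w, v, i', p'; split=> //; last first.
  exact: (@projective_add_closed _ _ P Q S j1 q1 j2 q2).
apply/short_exactP; split=> //.
- move=> z; have [x <-] := bs z; rewrite i'E comp_lfunE => /vex[e eE].
  have /pex[y yE] : p e = 0 by apply: ic; rewrite -q2w eE q2j1.
  by rewrite -[x]q1j1 -eE q1w -yE ui ba.
- split=> [z | t].
    by have [x <-] := bs z; rewrite i'E comp_lfunE p'E comp_lfunE q2j1 linear0.
  have [s <-] := vs t; rewrite p'E comp_lfunE => /dex[n nE].
  have [e eE] := ps n; exists (b (q1 s - u e)).
  rewrite i'E comp_lfunE; transitivity (v (s - w e)); last by rewrite linearB /= vw subr0.
  congr (v _); rewrite -[s - w e]j1j2.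
  have -> : q2 (s - w e) = 0 by rewrite linearB /= q2w eE nE subrr.
  by rewrite linear0 addr0 [q1 (_ - _)]linearB /= q1w.
- move=> z; have [y <-] := ds z; exists (v (j2 y)).
  by rewrite p'E comp_lfunE q2j2.
Qed.

(** C provides coresolutions only. Adjoining all syzygies provides resolutions, and the sequence
    defining a new syzygy is its coresolution step. *)
Inductive syzygy_closure (C : lmod A -> Prop) : lmod A -> Prop :=
  | syzygy_in M : C M -> syzygy_closure C M
  | syzygy_step K P M (i : 'Hom(K, P)) (p : 'Hom(P, M)) : short_exact i p ->
      projective P -> syzygy_closure C M -> syzygy_closure C K.

(* Iterated cosyzygies of A shift the degree, so that the first hypothesis says *)
(* Ext^n(G, A) = 0 for all n > 0; then syzygies never leave the class.          *)
Lemma Gproj_coind_right (C : lmod A -> Prop) G :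
    (forall M, C M -> (forall n, Ext1_eq0 M (iter n cosyzygy regular_lmod)) /\
       has_coresolution_step C M) ->
  C G -> Gproj G.
Proof.
move=> Cstep CG; apply: (@Gproj_coind (syzygy_closure C)); last exact: syzygy_in.
move=> M CM.
have Mext : forall n, Ext1_eq0 M (iter n cosyzygy regular_lmod).
  elim: CM => [N /Cstep[] // | K P N i p ip prP _ IH n].
  by apply/(Ext1_eq0_cosyzygy _ ip prP); exact: (IH n.+1).
split; first exact: (Mext 0).
  case: CM => [N /Cstep[_ [P [N' [i [p [ip prP CN']]]]]] | K P N i p ip prP CN].
    by exists P, N', i, p; split=> //; exact: syzygy_in.
  by exists P, N, i, p.
have [K [P [i [p [ip prP]]]]] := presentation_exists M.
by exists P, K, i, p; split=> //; exact: syzygy_step ip prP CM.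
Qed.

Lemma Gproj_Ext1_eq0_cosyzygy G n : Gproj G -> Ext1_eq0 G (iter n cosyzygy regular_lmod).
Proof.
elim: n G => [|n IH] G /Gproj_gorenstein_class[EG _ [P [K [i [p [ip prP gK]]]]]] //.
by apply/(Ext1_eq0_cosyzygy _ ip prP); exact: IH.
Qed.

(** The class of all extensions of Gorenstein projectives by one another is coresolved within itself
    by the horseshoe lemma, so [Gproj_coind_right] applies. *)
Lemma Gproj_ext_closed : ext_closed (@Gproj k A).
Proof.
move=> M E N i p ip gM gN.
apply: (@Gproj_coind_right (fun E => exists (M N : lmod A) (i : 'Hom(M, E)) (p : 'Hom(E, N)),
  [/\ short_exact i p, Gproj M & Gproj N])); last by exists M, N, i, p.
move=> {M N E i p ip gM gN} E [M [N [i [p [ip gM gN]]]]]; split=> [n|].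
  by apply: (Ext1_eq0_extl ip); exact: Gproj_Ext1_eq0_cosyzygy.
have [_ [P [M' [a [b [ab prP gM']]]]] _] := Gproj_gorenstein_class gM.
have [_ [Q [N' [c [d [cd prQ gN']]]]] _] := Gproj_gorenstein_class gN.
have [S [E' [w [v [i' [p' [wv ip' prS]]]]]]] :=
  horseshoe_right ip ab cd (Gproj_Ext1_eq0 gN prP) prP prQ.
by exists S, E', w, v; split=> //; exists M', N', i', p'.
Qed.

Lemma triangular_Gproj_projective G : triangular A -> Gproj G -> projective G.
Proof.
move=> tri; apply: (acyclic_projective tri) => {}G /Gproj_gorenstein_class[_ [P [G' h]] _].
by exists P, G'.
Qed.

End GorensteinProjective.

(** * Filtrations *)

Section Filtrations.
Context {k : fieldType} {A : falgType k}.
Implicit Types M N E P Q S T X Y K L W Z G : lmod A.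
Implicit Type F : lmod A -> Prop.

Lemma sub_inclusion M (U : submod M) :
  exists i : 'Hom(sub_lmod U, M), [/\ is_hom i, forall x, i x = vsval x,
    forall x, i x = 0 -> x = 0 & limg i = U].
Proof.
pose i : 'Hom(sub_lmod U, M) := linfun vsval.
have iE x : i x = vsval x by rewrite lfunE.
exists i; split=> //.
- apply/is_homP=> a x; rewrite !iE /= /sub_act !comp_lfunE !lfunE /= vsprojK //.
  by apply: (subvP (sm_stable U a)); exact/memv_img/subvsP.
- by move=> x; rewrite iE => e; exact/val_inj.
- apply/vspaceP=> x; apply/memv_imgP/idP => [[y _ ->] | xU].
    by rewrite iE; exact: subvsP.
  by exists (vsproj U x); rewrite ?memvf // iE vsprojK.
Qed.

(** Describes V/U = Y by an embedding of W with image V and a surjection W -> Y with kernel U, which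
    avoids computing in the nested quotient. *)
Lemma subquotient_isoP X (U V : submod X) Y : (U <= V)%VS ->
  isomorphic (quot_lmod (sub_in V U)) Y <->
  exists (W : lmod A) (i : 'Hom(W, X)) (g : 'Hom(W, Y)),
    [/\ is_hom i /\ is_hom g, forall x, i x = 0 -> x = 0, limg i = V,
        forall z, exists y, g y = z & forall x, g x = 0 <-> i x \in (U : {vspace X})].
Proof.
move=> UV; have [j [hj jE ij ej]] := sub_inclusion V.
have hq := qproj_hom (sub_in V U); set q := qproj _ in hq.
have qs : forall z, exists y, q y = z by exact/limg_fullP/limg_qproj.
have qE x : q x = 0 <-> j x \in (U : {vspace X}).
  rewrite jE; split=> [/eqP | xU]; first by rewrite -memv_ker lker_qproj -memv_preim lfunE.
  by apply/eqP; rewrite -memv_ker lker_qproj -memv_preim lfunE.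
split=> [/isomorphicP[f [hf fi fs]] | [W [i [g [[hi hg] ii ei gs gE]]]]].
  exists (sub_lmod V), j, (f \o q)%VF; split=> //.
  - by split=> //; apply: hom_comp.
  - by move=> z; have [y <-] := fs z; have [x <-] := qs y; exists x; rewrite comp_lfunE.
  - by move=> x; rewrite comp_lfunE -qE; split=> [/fi | ->] //; rewrite linear0.
have [p hp pE] : exists2 p : 'Hom(sub_lmod V, W), is_hom p & forall x, i (p x) = j x.
  apply: hom_factor_mono => // x.
  have /memv_imgP[y _ ->] : j x \in limg i by rewrite ei jE; exact: subvsP.
  by exists y.
have ps z : exists x, p x = z.
  have /memv_imgP[x _ xE] : i z \in limg j by rewrite ej -ei memv_img ?memvf.
  exists x; apply/eqP; rewrite -subr_eq0; apply/eqP/ii.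
  by rewrite linearB /= pE xE subrr.
have [f hf fE] : exists2 f : 'Hom(quot_lmod (sub_in V U), Y), is_hom f &
    forall x, f (q x) = (g \o p)%VF x.
  apply: hom_factor_epi => //; first exact: hom_comp.
  by move=> x /qE xU; rewrite comp_lfunE; apply/gE; rewrite pE.
apply/isomorphicP; exists f; split=> // z.
  by have [x <-] := qs z; rewrite fE comp_lfunE => /gE; rewrite pE => /qE.
have [y <-] := gs z; have [x <-] := ps y.
by exists (q x); rewrite fE comp_lfunE.
Qed.

Lemma zero_stable X a : (lact X a @: (0 : {vspace X}) <= 0)%VS.
Proof. by rewrite limg0. Qed.
Definition zero_submod X : submod X := Submod (@zero_stable X).

Lemma full_stable X a : (lact X a @: (fullv : {vspace X}) <= fullv)%VS.
Proof. exact: subvf. Qed.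
Definition full_submod X : submod X := Submod (@full_stable X).

Lemma filt_fil F X : filt F X -> fil F X.
Proof.
move=> [m [U [U0 Um Ustep]]].
suff subU i : (i <= m)%N -> fil F (sub_lmod (U i)).
  apply: fil_iso (subU m (leqnn m)).
  have [j [hj jE ij ej]] := sub_inclusion (U m).
  apply/isomorphicP; exists j; split=> //.
  by apply/limg_fullP; rewrite ej.
elim: i => [_ | i IH im].
  apply: fil_zero => x; apply/val_inj/eqP; rewrite /= -memv0 -U0; exact: subvsP.
have [UV [Y FY VY]] := Ustep i im.
have [W [j [g [[hj hg] ij ej gs gE]]]] := (subquotient_isoP _ UV).1 VY.
have [u [hu uE iu eu]] := sub_inclusion (U i).
have [v [hv vE iv ev]] := sub_inclusion (U i.+1).
have jv : isomorphic W (sub_lmod (U i.+1)).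
  have [p hp pE] : exists2 p : 'Hom(W, sub_lmod (U i.+1)), is_hom p & forall x, v (p x) = j x.
    apply: hom_factor_mono => // x.
    have /memv_imgP[y _ ->] : j x \in limg v by rewrite ev -ej memv_img ?memvf.
    by exists y.
  apply/isomorphicP; exists p; split=> // [x px | z].
    by apply: ij; rewrite -pE px linear0.
  have /memv_imgP[x _ xE] : v z \in limg j by rewrite ej -ev memv_img ?memvf.
  exists x; apply/eqP; rewrite -subr_eq0; apply/eqP/iv.
  by rewrite linearB /= pE xE subrr.
apply: (fil_iso jv).
have [w hw wE] : exists2 w : 'Hom(sub_lmod (U i), W), is_hom w & forall x, j (w x) = u x.
  apply: hom_factor_mono => // x.
  have /memv_imgP[y _ ->] : u x \in limg j.
    by rewrite ej (subvP UV) // -eu memv_img ?memvf.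
  by exists y.
apply: (@fil_ext _ _ _ _ _ _ w g); [ | exact/IH/ltnW | exact: fil_in].
apply/short_exactP; split=> // [x wx | ].
  by apply: iu; rewrite -wE wx linear0.
split=> [x | y /gE]; first by apply/gE; rewrite wE -eu memv_img ?memvf.
rewrite -eu => /memv_imgP[x _ xE]; exists x.
apply/eqP; rewrite -subr_eq0; apply/eqP/ij.
by rewrite linearB /= wE xE subrr.
Qed.

Lemma filt_zero F Z : (forall x : Z, x = 0) -> filt F Z.
Proof.
move=> Z0; exists 0%N, (fun _ => zero_submod Z); split=> //=.
by apply/vspaceP=> x; rewrite (Z0 x) !mem0v.
Qed.

Lemma filt_step F M E N (i : 'Hom(M, E)) (p : 'Hom(E, N)) :
  short_exact i p -> filt F M -> F N -> filt F E.
Proof.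
move=> /short_exactP[hi hp ii [pi pex] ps] [m [U [U0 Um Ustep]]] FN.
have st j a : (lact E a @: (i @: U j) <= i @: U j)%VS.
  apply/subvP=> _ /memv_imgP[_ /memv_imgP[x xU ->] ->].
  rewrite -(is_homP i).1 // memv_img //.
  by apply: (subvP (sm_stable (U j) a)); exact: memv_img.
pose V j := if (j <= m)%N then Submod (st j) else full_submod E.
have VE j : (j <= m)%N -> (V j : {vspace E}) = (i @: U j)%VS by rewrite /V => ->.
have iU x j : (i x \in (i @: U j)%VS) = (x \in (U j : {vspace M})).
  apply/memv_imgP/idP => [[y yU xy] | xU]; last by exists x.
  rewrite (_ : x = y) //; apply/eqP; rewrite -subr_eq0; apply/eqP/ii.
  by rewrite linearB /= xy subrr.
have V1 : (V m.+1 : {vspace E}) = fullv by rewrite /V ltnn.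
exists m.+1, V; split=> //; first by rewrite VE // U0 limg0.
move=> j; rewrite ltnS => jm; move: (jm); rewrite leq_eqVlt => /orP[/eqP -> | lt_jm].
  have VV : (V m <= V m.+1)%VS by rewrite V1 subvf.
  split=> //; exists N => //; apply/subquotient_isoP => //.
  exists E, \1%VF, p; split=> //.
  - by split=> //; exact: hom1.
  - by move=> x; rewrite id_lfunE.
  - by rewrite V1; apply/limg_fullP=> z; exists z; rewrite id_lfunE.
  - move=> x; rewrite VE // Um id_lfunE; split=> [/pex[y <-] | /memv_imgP[y _ ->] //].
    by rewrite memv_img ?memvf.
have [UU [Y FY /(subquotient_isoP _ UU)]] := Ustep j lt_jm.
move=> [W [u [g [[hu hg] iu eu gs gE]]]].
have VV : (V j <= V j.+1)%VS by rewrite !VE ?limgS // ltnW.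
split=> //; exists Y => //; apply/subquotient_isoP => //.
exists W, (i \o u)%VF, g; split=> //.
- by split=> //; exact: hom_comp.
- by move=> x; rewrite comp_lfunE => /ii/iu.
- by rewrite limg_comp VE // eu.
- by move=> x; rewrite VE // comp_lfunE iU; exact: gE.
Qed.

(* fil with the extensions nested to the left, as in a filtration. *)
Inductive chain F : lmod A -> Prop :=
  | chain_zero Z : (forall x : Z, x = 0) -> chain F Z
  | chain_step M E N (i : 'Hom(M, E)) (p : 'Hom(E, N)) :
      short_exact i p -> chain F M -> F N -> chain F E.

Lemma chain_iso F M N : isomorphic M N -> chain F M -> chain F N.
Proof.
move=> /isomorphicP[f fi] FM; have [g [[hg ig gs] gf fg]] := iso_inverse fi.
have [hf finj fs] := fi.
case: FM f g fi hg ig gs gf fg hf finj fs => [Z Z0 | L E Q i p ip FL FQ] f g fi hg ig gs gf fg hf finj fs.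
  by apply: chain_zero => x; apply: ig; rewrite (Z0 (g x)).
case/short_exactP: ip => hi hp ii [pi pex] ps.
apply: (@chain_step _ _ _ _ (f \o i)%VF (p \o g)%VF _ FL FQ); apply/short_exactP; split.
- exact: hom_comp.
- exact: hom_comp.
- by move=> x; rewrite comp_lfunE => /finj/ii.
- split=> [x | y]; first by rewrite !comp_lfunE gf pi.
  by rewrite comp_lfunE => /pex[x xE]; exists x; rewrite comp_lfunE xE fg.
- by move=> z; have [y <-] := ps z; exists (f y); rewrite comp_lfunE gf.
Qed.

(** Reassociation by induction on N: when N'' is the top factor of N, the kernel E' of E -> N'' is
    an extension of the smaller N' by M. *)
Lemma chain_ext F M E N (i : 'Hom(M, E)) (p : 'Hom(E, N)) :
  short_exact i p -> chain F M -> chain F N -> chain F E.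
Proof.
move=> ip FM FN; elim: FN E i p ip => {N} [Z Z0 | N' N N'' j q jq _ IH FN''] E i p ip.
  case/short_exactP: ip => hi hp ii [pi pex] ps.
  apply: chain_iso FM; apply/isomorphicP; exists i; split=> // z.
  by apply: pex; rewrite (Z0 (p z)).
case/short_exactP: ip => hi hp ii [pi pex] ps.
case/short_exactP: jq => hj hq ij [qj qex] qs.
have hqp := hom_comp hq hp.
have [|E' [u uqp]] := kernel_exact hqp.
  by move=> z; have [y <-] := qs z; have [x <-] := ps y; exists x; rewrite comp_lfunE.
apply: (chain_step uqp) => //.
case/short_exactP: uqp => hu _ iu [qpu qpex] _.
have [v hv vE] : exists2 v : 'Hom(M, E'), is_hom v & forall x, u (v x) = i x.
  by apply: hom_factor_mono => // x; apply: qpex; rewrite comp_lfunE pi linear0.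
have [w hw wE] : exists2 w : 'Hom(E', N'), is_hom w & forall x, j (w x) = (p \o u)%VF x.
  apply: hom_factor_mono => //; first exact: hom_comp.
  by move=> x; apply: qex; have := qpu x; rewrite !comp_lfunE.
apply: (IH _ v w); apply/short_exactP; split=> //.
- by move=> x vx; apply: ii; rewrite -vE vx linear0.
- split=> [x | y wy]; first by apply: ij; rewrite wE comp_lfunE vE pi.
  have /pex[x xE] : p (u y) = 0 by have := wE y; rewrite wy linear0 comp_lfunE.
  exists x; apply/eqP; rewrite -subr_eq0; apply/eqP/iu.
  by rewrite linearB /= vE xE subrr.
- move=> z; have [y yE] := ps (j z).
  have [|x xE] := qpex y; first by rewrite comp_lfunE yE qj.
  exists x; apply/eqP; rewrite -subr_eq0; apply/eqP/ij.
  by rewrite linearB /= wE comp_lfunE xE yE subrr.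
Qed.

Lemma fil_filt F X : fil F X -> filt F X.
Proof.
move=> FX; suff: chain F X.
  elim=> [Z Z0 | M E N i p ip _ FM FN]; first exact: filt_zero.
  exact: filt_step ip FM FN.
elim: FX => [Z Z0 | M FM | M E N i p ip _ FM _ FN]; first exact: chain_zero.
  have [Z Z0] := zero_mod_exists (A := A).
  apply: (@chain_step _ Z M M 0 \1%VF) => //; last exact: chain_zero.
  apply/short_exactP; split=> //; [exact: hom0 | exact: hom1 | | ].
  - by split=> [x | y]; rewrite id_lfunE ?zero_lfunE // => ->; exists 0; rewrite linear0.
  - by move=> z; exists z; rewrite id_lfunE.
exact: chain_ext ip FM FN.
Qed.

Lemma filtP F X : filt F X <-> fil F X.
Proof. by split; [exact: filt_fil | exact: fil_filt]. Qed.

(** Zero modules carry the empty filtration, but an extension-closed class contains them only if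
    something puts them there; a zero object of F does. *)
Lemma filt_smallest_ext_closed F : (exists2 Z : lmod A, F Z & forall x : Z, x = 0) ->
  smallest_ext_closed F (filt F).
Proof.
move=> [Z0 FZ0 Z00]; split.
- by move=> M N MN /filtP FM; apply/filtP; exact: fil_iso FM.
- move=> M E N i p ip /filtP FM /filtP FN; apply/filtP; exact: fil_ext ip FM FN.
- by move=> X FX; apply/filtP; exact: fil_in.
move=> C Ciso Cext FC X /filtP; elim=> [Z ZE | M /FC // | M E N i p ip _ CM _ CN].
  apply: Ciso (FC _ FZ0); apply/isomorphicP; exists 0; split=> //; first exact: hom0.
  by move=> z; exists 0; rewrite linear0 (ZE z).
exact: Cext ip CM CN.
Qed.

End Filtrations.

(** * Tensor products *)

Section TensorSpaces.
Context {k : fieldType}.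
Implicit Types U V W : vectType k.

Lemma tpureDl U V (u u' : U) (v : V) : tpure (u + u') v = tpure u v + tpure u' v.
Proof. by have := (tpure_bilin U V).1 v 1 u u'; rewrite !scale1r. Qed.

Lemma tpureDr U V (u : U) (v v' : V) : tpure u (v + v') = tpure u v + tpure u v'.
Proof. by have := (tpure_bilin U V).2 u 1 v v'; rewrite !scale1r. Qed.

Lemma tpure0l U V (v : V) : tpure (0 : U) v = 0.
Proof. by apply: (addrI (tpure 0 v)); rewrite -tpureDl !addr0. Qed.

Lemma tpure0r U V (u : U) : tpure u (0 : V) = 0.
Proof. by apply: (addrI (tpure u 0)); rewrite -tpureDr !addr0. Qed.

Lemma tpureZl U V c (u : U) (v : V) : tpure (c *: u) v = c *: tpure u v.
Proof. by have := (tpure_bilin U V).1 v c u 0; rewrite tpure0l !addr0. Qed.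

Lemma tpureZr U V c (u : U) (v : V) : tpure u (c *: v) = c *: tpure u v.
Proof. by have := (tpure_bilin U V).2 u c v 0; rewrite tpure0r !addr0. Qed.

Lemma lfunZ U V (f : 'Hom(U, V)) c x : f (c *: x) = c *: f x.
Proof. exact: linearZ. Qed.

Lemma lfun_linear U V (f : 'Hom(U, V)) c x y : f (c *: x + y) = c *: f x + f y.
Proof. exact: linearP. Qed.

Lemma lfun_sum U V (f : 'Hom(U, V)) I (r : seq I) (P : pred I) (F : I -> U) :
  f (\sum_(i <- r | P i) F i) = \sum_(i <- r | P i) f (F i).
Proof. exact: linear_sum. Qed.

Lemma tlift_exists U V W (f : U -> V -> W) : bilin f ->
  exists g : 'Hom(tens U V, W), forall u v, g (tpure u v) = f u v.
Proof. by move=> fB; exists (linfun (tlift f)) => u v; rewrite lfunE /= tlift_pure. Qed.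

Lemma vect_split U V W (i : 'Hom(U, V)) (p : 'Hom(V, W)) :
    (forall x, i x = 0 -> x = 0) -> (forall x, p (i x) = 0) ->
    (forall y, p y = 0 -> exists x, i x = y) -> (forall z, exists y, p y = z) ->
  exists (r : 'Hom(V, U)) (s : 'Hom(W, V)),
    (forall x, r (i x) = x) /\ forall y, i (r y) + s (p y) = y.
Proof.
move=> /lker0E/eqP ii pi pex /limg_fullP ps.
have psK z : p (p^-1%VF z) = z by rewrite limg_lfunVK // ps memvf.
exists (i^-1 \o (\1%VF - (p^-1 \o p)%VF))%VF, (p^-1)%VF.
split=> [x | y]; rewrite comp_lfunE add_lfunE opp_lfunE comp_lfunE id_lfunE.
  by rewrite pi linear0 subr0 lker0_lfunK.
have [|x xE] := pex (y - p^-1%VF (p y)); first by rewrite linearB /= psK subrr.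
by rewrite -xE lker0_lfunK // xE subrK.
Qed.

Lemma functional_separates U (u : U) : (forall f : 'Hom(U, k^o), f u = 0) -> u = 0.
Proof.
move=> h; rewrite (coord_vbasis (memvf u)) big1 // => i _.
have [f fE] : exists f : 'Hom(U, k^o), forall x, f x = coord (vbasis {:U}) i x.
  by apply: linfun_exists => c x y; rewrite linearP.
by rewrite -fE h scale0r.
Qed.

Lemma functional_exists U (u : U) : u <> 0 -> exists f : 'Hom(U, k^o), f u = 1.
Proof.
move=> u0; have [f fu] : exists f : 'Hom(U, k^o), f u <> 0.
  apply: NNPP => nf; apply: u0; apply: functional_separates => f.
  by apply: NNPP => fu; apply: nf; exists f.
by exists ((f u)^-1 *: f); rewrite scale_lfunE; apply: mulVf; apply/eqP.
Qed.

(** A tensor is determined by its contractions f ⊗ id; g is this contraction, characterised by its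
    values on pure tensors. *)
Lemma tens_separates U V (t : tens U V) :
  (forall f : 'Hom(U, k^o), forall g : 'Hom(tens U V, V),
     (forall u v, g (tpure u v) = f u *: v) -> g t = 0) -> t = 0.
Proof.
move=> h.
have cB i : bilin (fun (u : U) (v : V) => coord (vbasis {:U}) i u *: v).
  split=> [v c x y | u c x y]; first by rewrite linearP /= scalerDl scalerA.
  by rewrite scalerDr !scalerA mulrC.
pose g i : 'Hom(tens U V, V) :=
  linfun (tlift (fun (u : U) (v : V) => coord (vbasis {:U}) i u *: v)).
have gE i u v : g i (tpure u v) = coord (vbasis {:U}) i u *: v.
  by rewrite lfunE /= tlift_pure.
have e (s : tens U V) : s = \sum_(i < \dim {:U}) tpure (vbasis {:U})`_i (g i s).
  elim/(@tens_ind k U V): s => [u v | s s' es es'].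
    rewrite {1}(coord_vbasis (memvf u)) (bilin_suml _ _ _ _ (tpure_bilin U V)).
    by apply: eq_bigr => i _; rewrite gE tpureZr.
  rewrite {1}es {1}es' -big_split /=; apply: eq_bigr => i _.
  by rewrite linearD /= tpureDr.
rewrite [t]e big1 // => i _.
have [f fE] : exists f : 'Hom(U, k^o), forall x, f x = coord (vbasis {:U}) i x.
  by apply: linfun_exists => c x y; rewrite linearP.
by rewrite (h f) ?tpure0r // => u v; rewrite gE fE.
Qed.

End TensorSpaces.

Section TensorModules.
Context {k : fieldType} {A B : falgType k}.
Notation AB := (tens A B).
Implicit Types (X Y Z : lmod AB).

Lemma tact_mul X a b a' b' x :
  lact X (tpure a b) (lact X (tpure a' b') x) = lact X (tpure (a * a') (b * b')) x.
Proof. by rewrite -lact_mul -tmul_pure. Qed.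

Lemma tact_split X a b x :
  lact X (tpure a b) x = lact X (tpure a 1) (lact X (tpure 1 b) x).
Proof. by rewrite tact_mul mulr1 mul1r. Qed.

Lemma tact_comm X a b x :
  lact X (tpure a 1) (lact X (tpure 1 b) x) = lact X (tpure 1 b) (lact X (tpure a 1) x).
Proof. by rewrite !tact_mul !mulr1 !mul1r. Qed.

Lemma tact_one X x : lact X (tpure 1 1) x = x.
Proof. exact: (lact_one (M := X)). Qed.

Lemma tens_homP X Y (f : 'Hom(X, Y)) :
  is_hom f <-> forall a b x, f (lact X (tpure a b) x) = lact Y (tpure a b) (f x).
Proof.
split=> [/is_homP h a b x // | h]; apply/is_homP => t x.
have actD M s s' (y : lm_sort M) : lact (A := AB) M (s + s') y = lact M s y + lact M s' y.
  by rewrite -[s]scale1r lact_linearl !scale1r.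
elim/(@tens_ind k A B): t => [a b | s s' IH IH']; first exact: h.
by rewrite !actD linearD /= IH IH'.
Qed.

Section Restriction.
Variable X : lmod AB.

Definition res_act (b : B) : 'End(X) := lact X (tpure 1 b).
Lemma res_act_linear : linear res_act.
Proof. by move=> c a b; rewrite /res_act tpureDr tpureZr lact_linear. Qed.
Lemma res_act1 : res_act 1 = \1%VF.
Proof. exact: (lact1 X). Qed.
Lemma res_actM a b : res_act (a * b) = (res_act a \o res_act b)%VF.
Proof. by rewrite /res_act -lactM -[tpure 1 a * _]/(tmul _ _) tmul_pure mul1r. Qed.

Definition resB : lmod B := Lmod res_act_linear res_act1 res_actM.

End Restriction.

Lemma res_hom X Y (f : 'Hom(X, Y)) :
  is_hom f -> is_hom (f : 'Hom(resB X, resB Y)).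
Proof. by move=> /tens_homP h; apply/is_homP => b x; exact: h. Qed.

Lemma res_exact X Y Z (i : 'Hom(X, Y)) (p : 'Hom(Y, Z)) :
  short_exact i p -> short_exact (i : 'Hom(resB X, resB Y)) (p : 'Hom(resB Y, resB Z)).
Proof. by move=> [hi hp ii ip ps]; split=> //; exact: res_hom. Qed.

Lemma res_projective X : projective X -> projective (resB X).
Proof.
apply: (@projective_ind _ _ (fun P => projective (resB P))) => {X}.
  move=> M N g f /is_homP hg gs /is_homP hf.
  have gK z : g (g^-1%VF z) = z by rewrite limg_lfunVK // gs memvf.
  (* A ⊗ B is free over B on a basis of A: the images of the a ⊗ 1 are lifted by a linear section of
     g and extended B-linearly. *)
  have [h hE] : exists h : 'Hom(AB, M), forall a b,
      h (tpure a b) = lact M b (g^-1%VF (f (tpure a 1))).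
    apply: tlift_exists; split=> [b c x y | a c x y]; last exact: lact_linearl.
    by rewrite tpureDl tpureZl !linearP.
  exists h; split.
    apply/is_homP=> b t; elim/(@tens_ind k A B): t => [a b' | s s' es es'].
      rewrite /= /res_act regular_actE [_ * _]tmul_pure !hE mul1r lact_mul //.
    by rewrite !linearD /= es es'.
  apply: tens_lfun_ext => a b; rewrite comp_lfunE hE hg gK -hf /= /res_act.
  by rewrite regular_actE [_ * _]tmul_pure mul1r mulr1.
move=> M N E i p j q hi hp hj hq.
by apply: (@projective_add_closed _ _ (resB M) (resB N) (resB E) i p j q); exact: res_hom.
Qed.

Lemma tens_lmodE (X : lmod A) (Y : lmod B) a b x y :
  lact (tens_lmod X Y) (tpure a b) (tpure x y) = tpure (lact X a x) (lact Y b y).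
Proof.
rewrite /= /tens_act tlift_pure ?tmapE //.
have [Bl Br] := tmap_bilin X Y X Y.
by split=> [b' c a' a'' | a' c b' b'']; rewrite lact_linear ?Bl ?Br.
Qed.

Lemma tmap_hom (X X' : lmod A) (Y Y' : lmod B) (f : 'Hom(X, X')) (g : 'Hom(Y, Y')) :
  is_hom f -> is_hom g ->
  is_hom (tmap f g : 'Hom(tens_lmod X Y, tens_lmod X' Y')).
Proof.
move=> /is_homP hf /is_homP hg; apply/tens_homP=> a b t.
elim/(@tens_ind k X Y): t => [x y | s s' es es']; last by rewrite !linearD /= es es'.
by rewrite tens_lmodE !tmapE hf hg tens_lmodE.
Qed.

Lemma tens_exactr (X : lmod A) (K P Y : lmod B) (i : 'Hom(K, P)) (p : 'Hom(P, Y)) :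
  short_exact i p ->
  short_exact (tmap \1%VF i : 'Hom(tens_lmod X K, tens_lmod X P))
    (tmap \1%VF p : 'Hom(tens_lmod X P, tens_lmod X Y)).
Proof.
move=> /short_exactP[hi hp ii [pi pex] ps].
have [r [s [ri irsp]]] := vect_split ii pi pex ps.
have riK (t : tens X K) : tmap \1%VF r (tmap \1%VF i t) = t.
  rewrite -comp_lfunE -tmap_comp comp_lfun1l.
  have -> : (r \o i = \1)%VF by apply/lfunP=> x; rewrite comp_lfunE ri id_lfunE.
  by rewrite tmap1 id_lfunE.
have irspK (t : tens X P) : tmap \1%VF i (tmap \1%VF r t) + tmap \1%VF s (tmap \1%VF p t) = t.
  rewrite -!comp_lfunE -!tmap_comp comp_lfun1l -add_lfunE.
  have [_ Br] := tmap_bilin X P X P.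
  rewrite -[tmap _ _]scale1r -Br scale1r.
  have -> : (i \o r)%VF + (s \o p)%VF = \1%VF.
    by apply/lfunP=> x; rewrite add_lfunE !comp_lfunE irsp id_lfunE.
  by rewrite tmap1 id_lfunE.
apply/short_exactP; split.
- by apply: tmap_hom => //; exact: hom1.
- by apply: tmap_hom => //; exact: hom1.
- by move=> t it; rewrite -[t]riK it linear0.
- split=> [t | t pt]; last first.
    by exists (tmap \1%VF r t); rewrite -[RHS]irspK pt linear0 addr0.
  rewrite -comp_lfunE -tmap_comp (_ : (p \o i)%VF = 0); last first.
    by apply/lfunP=> x; rewrite comp_lfunE pi zero_lfunE.
  elim/(@tens_ind k X K): t => [x y | t t' et et']; last by rewrite linearD /= et et' addr0.
  by rewrite tmapE zero_lfunE tpure0r.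
- move=> t; elim/(@tens_ind k X Y): t => [x y | t t' [u <-] [u' <-]].
    by have [z <-] := ps y; exists (tpure x z); rewrite tmapE id_lfunE.
  by exists (u + u'); rewrite linearD.
Qed.

Lemma tens_exactl (K P X : lmod A) (Y : lmod B) (i : 'Hom(K, P)) (p : 'Hom(P, X)) :
  short_exact i p ->
  short_exact (tmap i \1%VF : 'Hom(tens_lmod K Y, tens_lmod P Y))
    (tmap p \1%VF : 'Hom(tens_lmod P Y, tens_lmod X Y)).
Proof.
move=> /short_exactP[hi hp ii [pi pex] ps].
have [r [s [ri irsp]]] := vect_split ii pi pex ps.
have riK (t : tens K Y) : tmap r \1%VF (tmap i \1%VF t) = t.
  rewrite -comp_lfunE -tmap_comp comp_lfun1l.
  have -> : (r \o i = \1)%VF by apply/lfunP=> x; rewrite comp_lfunE ri id_lfunE.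
  by rewrite tmap1 id_lfunE.
have irspK (t : tens P Y) : tmap i \1%VF (tmap r \1%VF t) + tmap s \1%VF (tmap p \1%VF t) = t.
  rewrite -!comp_lfunE -!tmap_comp comp_lfun1l -add_lfunE.
  have [Bl _] := tmap_bilin P Y P Y.
  rewrite -[tmap _ _]scale1r -Bl scale1r.
  have -> : (i \o r)%VF + (s \o p)%VF = \1%VF.
    by apply/lfunP=> x; rewrite add_lfunE !comp_lfunE irsp id_lfunE.
  by rewrite tmap1 id_lfunE.
apply/short_exactP; split.
- by apply: tmap_hom => //; exact: hom1.
- by apply: tmap_hom => //; exact: hom1.
- by move=> t it; rewrite -[t]riK it linear0.
- split=> [t | t pt]; last first.
    by exists (tmap r \1%VF t); rewrite -[RHS]irspK pt linear0 addr0.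
  rewrite -comp_lfunE -tmap_comp (_ : (p \o i)%VF = 0); last first.
    by apply/lfunP=> x; rewrite comp_lfunE pi zero_lfunE.
  elim/(@tens_ind k K Y): t => [x y | t t' et et']; last by rewrite linearD /= et et' addr0.
  by rewrite tmapE zero_lfunE tpure0l.
- move=> t; elim/(@tens_ind k X Y): t => [x y | t t' [u <-] [u' <-]].
    by have [z <-] := ps x; exists (tpure z y); rewrite tmapE id_lfunE.
  by exists (u + u'); rewrite linearD.
Qed.

Lemma tmap_split1 (U V W E : vectType k) (i : 'Hom(U, E)) (p : 'Hom(E, U))
    (j : 'Hom(V, E)) (q : 'Hom(E, V)) (t : tens E W) :
  (forall x, i (p x) + j (q x) = x) ->
  tmap i \1%VF (tmap p \1%VF t) + tmap j \1%VF (tmap q \1%VF t) = t.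
Proof.
move=> ijpq; elim/(@tens_ind k E W): t => [x y | s s' es es'].
  by rewrite !tmapE !id_lfunE -tpureDl ijpq.
by rewrite !linearD /= addrACA es es'.
Qed.

Lemma tmap_split2 (U V W E : vectType k) (i : 'Hom(U, E)) (p : 'Hom(E, U))
    (j : 'Hom(V, E)) (q : 'Hom(E, V)) (t : tens W E) :
  (forall x, i (p x) + j (q x) = x) ->
  tmap \1%VF i (tmap \1%VF p t) + tmap \1%VF j (tmap \1%VF q t) = t.
Proof.
move=> ijpq; elim/(@tens_ind k W E): t => [x y | s s' es es'].
  by rewrite !tmapE !id_lfunE -tpureDr ijpq.
by rewrite !linearD /= addrACA es es'.
Qed.

Lemma tens_projective (P : lmod A) (Q : lmod B) :
  projective P -> projective Q -> projective (tens_lmod P Q).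
Proof.
move=> prP prQ; move: prP Q prQ.
apply: (@projective_ind _ _ (fun P => forall Q, projective Q -> projective (tens_lmod P Q))).
  move=> Q; apply: (@projective_ind _ _ (fun Q => projective (tens_lmod regular_lmod Q))) => [|M N E i p j q hi hp hj hq ijpq prM prN].
    have h : is_hom (\1%VF : 'Hom(@regular_lmod k AB,
        tens_lmod (@regular_lmod k A) (@regular_lmod k B))).
      apply/tens_homP=> a b t; elim/(@tens_ind k A B): t => [x y | s s' es es'].
        by rewrite !id_lfunE tens_lmodE !regular_actE [_ * _]tmul_pure.
      by rewrite !linearD /= es es'.
    have h' : is_hom (\1%VF : 'Hom(tens_lmod (@regular_lmod k A) (@regular_lmod k B),
        @regular_lmod k AB)).
      by apply/is_homP=> a x; have /is_homP/(_ a x) := h; rewrite !id_lfunE => ->.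
    apply: (add_closed_retract projective_add_closed h h' _ (@regular_projective k AB)).
    by move=> x; rewrite !id_lfunE.
  apply: (@projective_add_closed k AB (tens_lmod regular_lmod M)
    (tens_lmod regular_lmod N) (tens_lmod regular_lmod E)
    (tmap \1%VF i) (tmap \1%VF p) (tmap \1%VF j) (tmap \1%VF q)
    _ _ _ _ _ prM prN); try by apply: tmap_hom => //; exact: hom1.
  by move=> t; exact: tmap_split2.
move=> M N E i p j q hi hp hj hq ijpq prM prN Q prQ.
apply: (@projective_add_closed k AB (tens_lmod M Q)
    (tens_lmod N Q) (tens_lmod E Q)
    (tmap i \1%VF) (tmap p \1%VF) (tmap j \1%VF) (tmap q \1%VF)
    _ _ _ _ _ (prM Q prQ) (prN Q prQ)); try by apply: tmap_hom => //; exact: hom1.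
by move=> t; exact: tmap_split1.
Qed.

End TensorModules.

(** * The functor V ⊗_B - from A ⊗ B-modules to A-modules *)

Section TensorFunctor.
Context {k : fieldType} {A B : falgType k}.
Notation AB := (tens A B).
Implicit Types (X Y Z K P : lmod AB) (V : rmod B).

Notation T V X := (bimod_tens (inflate V) X).

Section Generators.
Variables (V : rmod B) (X : lmod AB).

(* Under (A ⊗ V) ⊗_(A ⊗ B) X = V ⊗_B X, the element v ⊗ x. *)
Definition tcl (v : V) (x : X) : T V X :=
  qproj (balanced (bm_rmod (inflate (A := A) V)) X) (tpure (tpure 1 v : tens A V) x).

Lemma tcl_bilin : bilin (fun v x => tcl v x).
Proof.
split=> [x c v v' | v c x x'].
  by rewrite /tcl tpureDr tpureZr tpureDl tpureZl linearP.
by rewrite /tcl tpureDr tpureZr linearP.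
Qed.

Lemma qproj_balanced (t : tens A V) r x :
  qproj (balanced (bm_rmod (inflate (A := A) V)) X) (tpure (inflate_ract V r t) x) =
  qproj (balanced (bm_rmod (inflate (A := A) V)) X) (tpure t (lact X r x)).
Proof.
apply/eqP; rewrite -subr_eq0 -linearB -memv_ker lker_qproj.
exact: (mem_balanced (V := bm_rmod (inflate (A := A) V))).
Qed.

Lemma inflate_ractE a b a' v :
  inflate_ract V (tpure a b) (tpure a' v) = tpure (a' * a) (ract V b v) :> tens A V.
Proof.
rewrite /inflate_ract tlift_pure ?tmapE ?lfunE //.
have [Bl Br] := tmap_bilin A V A V.
by split=> [b' c x x' | x c b' b'']; rewrite ?ract_linear ?linearP ?Bl ?Br.
Qed.

Lemma tcl_pure a v x :
  qproj (balanced (bm_rmod (inflate (A := A) V)) X) (tpure (tpure a v : tens A V) x) =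
  tcl v (lact X (tpure a 1) x).
Proof.
by rewrite /tcl -qproj_balanced inflate_ractE mul1r ract1 id_lfunE.
Qed.

Lemma tcl_balanced v b x : tcl (ract V b v) x = tcl v (lact X (tpure 1 b) x).
Proof. by rewrite /tcl -qproj_balanced inflate_ractE mul1r. Qed.

Lemma tcl_act a v x : lact (T V X) a (tcl v x) = tcl v (lact X (tpure a 1) x).
Proof.
have /is_homP/(_ a (tpure (tpure 1 v : tens A V) x)) :=
  qproj_hom (Submod (@balanced_stable k A AB (inflate V) X)).
rewrite -tcl_pure => <-; congr (qproj _ _).
rewrite /= /tensk_act tmapE /= /inflate_lact tmapE lfunE /= mulr1.
by rewrite !id_lfunE.
Qed.

(** The elements v ⊗ x span, since (a ⊗ v) ⊗ x = (1 ⊗ v) ⊗ (a ⊗ 1)x. *)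
Lemma tens_over_ext (W : vectType k) (f g : 'Hom(T V X, W)) :
  (forall v x, f (tcl v x) = g (tcl v x)) -> f = g.
Proof.
move=> fg; apply/lfunP=> t; rewrite -[t]qsecE.
elim/(@tens_ind k (tens A V) X): (qsec _ _) => [u x | s s' es es']; last by rewrite !linearD /= es es'.
elim/(@tens_ind k A V): u => [a v | s s' es es']; first by rewrite tcl_pure.
by rewrite tpureDl !linearD /= es es'.
Qed.

Lemma tcl_span (U : {vspace T V X}) :
  (forall v x, tcl v x \in U) -> forall t, t \in U.
Proof.
move=> h t; have /lfunP/(_ t) : qproj U = 0.
  apply: tens_over_ext => v x; rewrite zero_lfunE; apply/eqP.
  by rewrite -memv_ker lker_qproj.
by rewrite zero_lfunE => /eqP; rewrite -memv_ker lker_qproj.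
Qed.

(** The universal property of V ⊗_B X; balancedness over A is automatic once the A-factor has been
    moved onto X. *)
Lemma tens_over_lift (W : vectType k) (f : V -> X -> W) : bilin f ->
    (forall v b x, f (ract V b v) x = f v (lact X (tpure 1 b) x)) ->
  exists g : 'Hom(T V X, W), forall v x, g (tcl v x) = f v x.
Proof.
move=> [fl fr] fbal.
pose F (t : tens A V) (x : X) : W := tlift (fun a v => f v (lact X (tpure a 1) x)) t.
have FB x : bilin (fun a v => f v (lact X (tpure a 1) x)).
  split=> [v c a a' | a c v v']; last exact: fl.
  by rewrite tpureDl tpureZl lact_linearl fr.
have FE a v x : F (tpure a v) x = f v (lact X (tpure a 1) x) by rewrite /F tlift_pure.
have FD s s' x : F (s + s') x = F s x + F s' x by exact: linearD.
have Fbil : bilin F.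
  split=> [x c t t' | t c x x']; first exact: linearP.
  elim/(@tens_ind k A V): t => [a v | s s' es es']; first by rewrite !FE linearP fr.
  by rewrite !FD es es' scalerDr addrACA.
have [g0 g0E] := tlift_exists Fbil.
have g0bal : (balanced (bm_rmod (inflate (A := A) V)) X <= lker g0)%VS.
  apply: balanced_min => t r x; rewrite memv_ker linearB /= subr_eq0.
  rewrite (g0E (inflate_ract V r t)) (g0E t); apply/eqP.
  elim/(@tens_ind k A V): t => [a v | s s' es es']; last by rewrite linearD !FD es es'.
  elim/(@tens_ind k A B): r => [a' b | s s' es es'].
    by rewrite inflate_ractE !FE fbal !tact_mul mulr1 !mul1r.
  rewrite -[s in s + _]scale1r inflate_ract_linear lact_linearl add_lfunE scale_lfunE.
  by rewrite !scale1r FD es es' !FE linearD /= -[f v (lact X _ _)]scale1r -fr scale1r.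
exists (g0 \o qsec _)%VF => v x; rewrite comp_lfunE.
transitivity (g0 (tpure (tpure 1 v : tens A V) x)); last by rewrite g0E FE tact_one.
apply/eqP; rewrite eq_sym -subr_eq0 -linearB -memv_ker.
exact/(subvP g0bal)/qprojK.
Qed.

End Generators.

Lemma tens_over_mapE V X Y (f : 'Hom(X, Y)) v x : is_hom f ->
  tens_over_map (bm_rmod (inflate (A := A) V)) f (tcl v x) = tcl v (f x).
Proof.
move=> /is_homP hf; rewrite /tens_over_map !comp_lfunE.
set U := balanced _ X; set U' := balanced _ Y.
have UU : (U <= tmap \1%VF f @^-1: U')%VS.
  apply: balanced_min => t r y; rewrite -memv_preim linearB /= !tmapE !id_lfunE hf.
  exact: (mem_balanced (V := bm_rmod (inflate (A := A) V))).
transitivity (qproj U' (tmap \1%VF f (tpure (tpure 1 v : tens A V) x))).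
  apply/eqP; rewrite eq_sym -subr_eq0 -!linearB -memv_ker lker_qproj memv_preim.
  exact/(subvP UU)/qprojK.
by rewrite tmapE id_lfunE.
Qed.

(* g is the map id_V ⊗ f. *)
Definition tens_induced V X Y (f : 'Hom(X, Y)) (g : 'Hom(T V X, T V Y)) :=
  forall v x, g (tcl v x) = tcl v (f x).

Lemma tens_induced_exists V X Y (f : 'Hom(X, Y)) : is_hom f ->
  exists g : 'Hom(T V X, T V Y), tens_induced f g.
Proof.
move=> hf; exists (tens_over_map (bm_rmod (inflate (A := A) V)) f) => v x.
exact: tens_over_mapE.
Qed.

Lemma tens_induced_hom V X Y (f : 'Hom(X, Y)) (g : 'Hom(T V X, T V Y)) :
  is_hom f -> tens_induced f g -> is_hom g.
Proof.
move=> /is_homP hf gE a; apply: tens_over_ext => v x.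
by rewrite [LHS]comp_lfunE [RHS]comp_lfunE tcl_act !gE tcl_act hf.
Qed.

Lemma tens_over_eq V X (W : vectType k) (f g : 'Hom(T V X, W)) :
  (forall v x, f (tcl v x) = g (tcl v x)) -> forall t, f t = g t.
Proof. by move=> /tens_over_ext ->. Qed.

Lemma tcl0r V X (v : V) : tcl v (0 : X) = 0.
Proof. by rewrite /tcl tpure0r linear0. Qed.

Lemma tclDr V X (v : V) (x y : X) : tcl v (x + y) = tcl v x + tcl v y.
Proof. by have := (tcl_bilin V X).2 v 1 x y; rewrite !scale1r. Qed.

Lemma tcl_comp_exists V X (W : vectType k) (F : 'Hom(T V X, W)) (v : V) :
  exists f : 'Hom(X, W), forall x, f x = F (tcl v x).
Proof.
by apply: linfun_exists => c x y; rewrite (tcl_bilin V X).2 lfun_linear.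
Qed.

Lemma tens_induced_epi V X Y (f : 'Hom(X, Y)) (g : 'Hom(T V X, T V Y)) :
  tens_induced f g -> (forall z, exists y, f y = z) -> forall z, exists y, g y = z.
Proof.
move=> gE fs; apply/limg_fullP/vspaceP=> t; rewrite memvf; apply: tcl_span => v x.
by have [y <-] := fs x; rewrite -gE memv_img ?memvf.
Qed.

Lemma tens_induced_split V X Y Z (i : 'Hom(X, Z)) (p : 'Hom(Z, X)) (j : 'Hom(Y, Z))
    (q : 'Hom(Z, Y)) i' p' j' q' :
  tens_induced (V := V) i i' -> tens_induced p p' -> tens_induced j j' ->
  tens_induced q q' ->
  (forall x, i (p x) + j (q x) = x) -> forall t, i' (p' t) + j' (q' t) = t.
Proof.
move=> iE pE jE qE ijpq t; rewrite -[i' _]comp_lfunE -[j' _]comp_lfunE -add_lfunE.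
rewrite -[RHS]id_lfunE; apply: tens_over_eq => v x.
by rewrite add_lfunE comp_lfunE [(j' \o q')%VF _]comp_lfunE pE iE qE jE id_lfunE -tclDr ijpq.
Qed.

(* The sequence splits over B, hence remains split after applying V ⊗_B -. *)
Lemma tens_over_exact V K P X (i : 'Hom(K, P)) (p : 'Hom(P, X)) Ti Tp :
  short_exact i p -> projective (resB X) ->
  tens_induced (V := V) i Ti -> tens_induced p Tp -> short_exact Ti Tp.
Proof.
move=> ip prX TiE TpE; case/short_exactP: (ip) => hi hp ii [pi pex] ps.
case/short_exactP: (res_exact ip) => rhi rhp _ _ _.
have [s hs psE] := lift_epi prX rhp ps (hom1 _).
have [r hr rE] : exists2 r : 'Hom(resB P, resB K), is_hom r &
    forall x, i (r x) = (\1%VF - (s \o (p : 'Hom(resB P, resB X)))%VF) x.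
  apply: (hom_factor_mono (i := i : 'Hom(resB K, resB P))) => //.
    by apply: homB; [exact: hom1 | exact: hom_comp].
  move=> x; apply: pex; rewrite add_lfunE opp_lfunE comp_lfunE id_lfunE linearB /=.
  by have -> := psE (p x); rewrite id_lfunE subrr.
have ri x : r (i x) = x.
  apply/eqP; rewrite -subr_eq0; apply/eqP/ii; rewrite linearB /=.
  by have -> := rE (i x); rewrite add_lfunE opp_lfunE comp_lfunE pi linear0 subr0 id_lfunE subrr.
have irsp x : i (r x) + s (p x) = x.
  by have -> := rE x; rewrite add_lfunE opp_lfunE comp_lfunE id_lfunE subrK.
have lift X1 X2 (f : 'Hom(resB X1, resB X2)) : is_hom f ->
    exists g : 'Hom(T V X1, T V X2), forall v x, g (tcl v x) = tcl v (f x).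
  move=> /is_homP hf; apply: tens_over_lift => [|v b x].
    have [Bl Br] := tcl_bilin V X2.
    by split=> [x c v v' | v c x x']; [exact: Bl | rewrite linearP; exact: Br].
  by rewrite tcl_balanced; congr tcl; rewrite -(hf b x).
have [Tr TrE] := lift _ _ _ hr; have [Ts TsE] := lift _ _ _ hs.
have TrTi t : Tr (Ti t) = t.
  rewrite -comp_lfunE -[RHS]id_lfunE; apply: tens_over_eq => v x.
  by rewrite comp_lfunE TiE TrE ri id_lfunE.
have Tsum t : Ti (Tr t) + Ts (Tp t) = t.
  rewrite -[Ti _]comp_lfunE -[Ts _]comp_lfunE -add_lfunE -[RHS]id_lfunE.
  apply: tens_over_eq => v x.
  by rewrite add_lfunE comp_lfunE [(Ts \o Tp)%VF _]comp_lfunE TrE TiE TpE TsE id_lfunE -tclDr irsp.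
apply/short_exactP; split.
- exact: tens_induced_hom TiE.
- exact: tens_induced_hom TpE.
- by move=> t it; rewrite -[t]TrTi it linear0.
- split=> [t | t pt]; last by exists (Tr t); rewrite -[RHS]Tsum pt linear0 addr0.
  rewrite -comp_lfunE -[RHS](zero_lfunE _ t); apply: tens_over_eq => v x.
  by rewrite comp_lfunE TiE TpE pi zero_lfunE tcl0r.
- exact: tens_induced_epi TpE ps.
Qed.

End TensorFunctor.

Lemma projective_kernel (k : fieldType) (A : falgType k) (K P N : lmod A)
    (i : 'Hom(K, P)) (p : 'Hom(P, N)) :
  short_exact i p -> projective P -> projective N -> projective K.
Proof.
move=> ip prP prN; have [r hr rE] := Ext1_eq0_retraction (projective_Ext1_eq0 (M := K) prN) ip.
have [hi _ _ _ _] := ip.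
exact: (add_closed_retract projective_add_closed hr hi rE prP).
Qed.

(** * Monomorphic modules *)

Section Monomorphic.
Context {k : fieldType} {A B : falgType k}.
Notation AB := (tens A B).
Notation T V X := (bimod_tens (inflate V) X).
Implicit Types (X Y Z K P C : lmod AB) (V : rmod B).

(** Projective A ⊗ B-modules are B-projective, so every syzygy of X is, and each short exact piece
    of the resolution stays exact under V ⊗_B -. *)
Lemma projective_Tor V X n : projective (resB X) ->
  Tor_eq0 n.+1 (bm_rmod (inflate (A := A) V)) X.
Proof.
move=> prX P d e prP hd he es de dd.
have coker m : exists (C : lmod AB) (c : 'Hom(P m, C)), [/\ is_hom c,
    forall z, exists y, c y = z, limg (d m) = lker c & projective (resB C)].
  elim: m => [|m [C [c [hc cs dc prC]]]]; first by exists X, e; split=> //; exact/limg_fullP.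
  have [I [i ic]] := kernel_exact hc cs.
  case/short_exactP: (ic) => hi _ ii [ci cex] _.
  have /limg_lkerP[cd cdx] := dc.
  have [q hq qE] : exists2 q : 'Hom(P m.+1, I), is_hom q & forall x, i (q x) = d m x.
    by apply: hom_factor_mono => // x; apply: cex.
  exists I, q; split=> //.
  - move=> z; have [y yE] := cdx _ (ci z); exists y.
    apply/eqP; rewrite -subr_eq0; apply/eqP/ii.
    by rewrite linearB /= qE yE subrr.
  - rewrite dd; apply/vspaceP=> x; rewrite !memv_ker.
    by apply/eqP/eqP=> [dx | qx]; [apply: ii; rewrite qE | rewrite -qE qx linear0].
  - exact: (projective_kernel (res_exact ic) (res_projective (prP m)) prC).
have [C [c [hc cs dc prC]]] := coker n.
have [I [i ic]] := kernel_exact hc cs.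
have prI := projective_kernel (res_exact ic) (res_projective (prP n)) prC.
case/short_exactP: (ic) => hi _ ii [ci cex] _.
have /limg_lkerP[cd cdx] := dc.
have [q hq qE] : exists2 q : 'Hom(P n.+1, I), is_hom q & forall x, i (q x) = d n x.
  by apply: hom_factor_mono => // x; apply: cex.
have qs z : exists y, q y = z.
  have [y yE] := cdx _ (ci z); exists y.
  apply/eqP; rewrite -subr_eq0; apply/eqP/ii.
  by rewrite linearB /= qE yE subrr.
have [K [j jq]] := kernel_exact hq qs.
case/short_exactP: (jq) => hj _ ij [qj qex] _.
have /limg_lkerP[ddn ddx] := dd n.
have [l hl lE] : exists2 l : 'Hom(P n.+2, K), is_hom l & forall x, j (l x) = d n.+1 x.
  by apply: hom_factor_mono => // x; apply: qex; apply: ii; rewrite qE ddn.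
have ls z : exists y, l y = z.
  have [|y yE] := ddx (j z); first by rewrite -qE qj linear0.
  exists y; apply/eqP; rewrite -subr_eq0; apply/eqP/ij.
  by rewrite linearB /= lE yE subrr.
have [Ti TiE] := tens_induced_exists V hi; have [Tq TqE] := tens_induced_exists V hq.
have [Tj TjE] := tens_induced_exists V hj; have [Tl TlE] := tens_induced_exists V hl.
have [Tc TcE] := tens_induced_exists V hc.
have /short_exactP[_ _ iTi _ _] := tens_over_exact ic prC TiE TcE.
have /short_exactP[_ _ _ [TqTj Tqex] _] := tens_over_exact jq prI TjE TqE.
have Tls := tens_induced_epi TlE ls.
move=> dV; have [D0 D0E] : exists D : 'Hom(T V (P n.+1), T V (P n)),
  D = dV n /\ tens_induced (d n) D.
  by exists (dV n); split=> // v x; exact: tens_over_mapE.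
have [D1 D1E] : exists D : 'Hom(T V (P n.+2), T V (P n.+1)),
  D = dV n.+1 /\ tens_induced (d n.+1) D.
  by exists (dV n.+1); split=> // v x; exact: tens_over_mapE.
case: D0E => <- D0E; case: D1E => <- D1E.
have D0T t : D0 t = Ti (Tq t).
  rewrite -[RHS]comp_lfunE; apply: tens_over_eq => v x.
  by rewrite comp_lfunE D0E TqE TiE qE.
have D1T t : D1 t = Tj (Tl t).
  rewrite -[RHS]comp_lfunE; apply: tens_over_eq => v x.
  by rewrite comp_lfunE D1E TlE TjE lE.
apply/limg_lkerP; split=> [t | t]; first by rewrite D0T D1T TqTj linear0.
rewrite D0T => /iTi/Tqex[u <-]; have [w <-] := Tls u.
by exists w; rewrite D1T.
Qed.

Section Duality.
Variables (S : lmod B) (X : lmod AB).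
Notation D := (dual_rmod S).

(** One direction of Hom_B(X, S) = D(D(S) ⊗_B X); the inverse is [functional_hom]. *)
Lemma hom_functional (f : 'Hom(resB X, S)) : is_hom f ->
  exists F : 'Hom(T D X, k^o),
    forall (phi : 'Hom(S, k^o)) (x : X), F (tcl (V := D) phi x) = phi (f x).
Proof.
move=> /is_homP hf.
apply: (@tens_over_lift _ A B D X k^o (fun (phi : 'Hom(S, k^o)) (x : X) => phi (f x))).
  split=> [x c g g' | g c x x']; first by rewrite add_lfunE scale_lfunE.
  by rewrite !linearP.
move=> phi b x; rewrite /= dual_actE comp_lfunE; congr (fun_of_lfun phi _).
by rewrite -hf.
Qed.

Lemma functional_hom (F : 'Hom(T D X, k^o)) :
  exists2 f : 'Hom(resB X, S), is_hom f &
    forall (phi : 'Hom(S, k^o)) (x : X), F (tcl (V := D) phi x) = phi (f x).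
Proof.
have [Bl Br] := tcl_bilin (A := A) D X.
have [c cE] : exists c : 'I_(\dim {:S}) -> 'Hom(S, k^o),
    forall i x, c i x = coord (vbasis {:S}) i x.
  have ex i : exists f : 'Hom(S, k^o), forall x, f x = coord (vbasis {:S}) i x.
    by apply: linfun_exists => r x y; rewrite linearP.
  exists (fun i => proj1_sig (constructive_indefinite_description _ (ex i))) => i.
  exact: proj2_sig (constructive_indefinite_description _ (ex i)).
have [G GE] : exists G : 'I_(\dim {:S}) -> 'Hom(X, k^o),
    forall i x, G i x = F (tcl (V := D) (c i) x).
  exists (fun i => proj1_sig (constructive_indefinite_description _
    (tcl_comp_exists F (c i : D)))) => i.
  exact: proj2_sig (constructive_indefinite_description _ (tcl_comp_exists F (c i : D))).
(* The coordinates of f(x) are the values of F on c_i ⊗ x, with c_i the dual basis of S. *)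
have [f fE] : exists f : 'Hom(X, S), forall x,
    f x = \sum_(i < \dim {:S}) (G i x : k) *: (vbasis {:S})`_i.
  apply: linfun_exists => r x y; rewrite scaler_sumr -big_split /=.
  by apply: eq_bigr => i _; rewrite lfun_linear scalerDl scalerA.
have FE (phi : 'Hom(S, k^o)) x : F (tcl (V := D) phi x) = phi (f x).
  have phiE : phi = \sum_(i < \dim {:S}) phi (vbasis {:S})`_i *: c i.
    apply/lfunP=> y; rewrite sum_lfunE {1}(coord_vbasis (memvf y)) linear_sum.
    by apply: eq_bigr => i _; rewrite linearZ scale_lfunE cE; exact: mulrC.
  rewrite {1}phiE (bilin_suml (f := fun v x => tcl (V := D) v x)) // fE !lfun_sum.
  by apply: eq_bigr => i _; rewrite !lfunZ GE; exact: mulrC.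
exists f => //; apply/is_homP=> b x; apply/eqP; rewrite -subr_eq0; apply/eqP.
apply: functional_separates => phi; rewrite linearB /=; apply/eqP; rewrite subr_eq0.
have := FE phi (lact X (tpure 1 b) x); rewrite -tcl_balanced => <-.
by rewrite /= (FE (dual_act S b phi) x) dual_actE comp_lfunE.
Qed.

End Duality.

(** For a presentation K -> P -> X, Tor_1 = 0 makes D(S) ⊗ K -> D(S) ⊗ P injective. Dually Hom_B(P,
    S) -> Hom_B(K, S) is onto, so Ext^1_B(X, S) = 0 for every simple S and then for every
    B-module. *)
Lemma Mon_projective X : Mon X -> projective (resB X).
Proof.
move=> monX.
have pr (M : lmod AB) : exists x : {KP : (lmod AB * lmod AB)%type &
    ('Hom(KP.1, KP.2) * 'Hom(KP.2, M))%type},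
    short_exact (tagged x).1 (tagged x).2 /\ projective (tag x).2.
  by have [K [P [i [p ip]]]] := presentation_exists M; exists (existT _ (K, P) (i, p)).
pose x M := proj1_sig (constructive_indefinite_description _ (pr M)).
have xP M : short_exact (tagged (x M)).1 (tagged (x M)).2 /\ projective (tag (x M)).2.
  exact: proj2_sig (constructive_indefinite_description _ (pr M)).
pose K M := (tag (x M)).1; pose P M := (tag (x M)).2.
pose i M : 'Hom(K M, P M) := (tagged (x M)).1.
pose p M : 'Hom(P M, M) := (tagged (x M)).2.
have ip M : short_exact (i M) (p M) by case: (xP M).
have prP M : projective (P M) by case: (xP M).
clearbody K P i p; clear x xP pr.
pose d n : 'Hom(P (iter n.+1 K X), P (iter n K X)) :=
  (i (iter n K X) \o p (iter n.+1 K X))%VF.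
have hd n : is_hom (d n).
  by apply: hom_comp; [case: (ip (iter n K X)) | case: (ip (iter n.+1 K X))].
have dE n y : d n y = i _ (p _ y) by rewrite comp_lfunE.
have dd n : limg (d n.+1) = lker (d n).
  have /short_exactP[_ _ ii _ _] := ip (iter n K X).
  have /short_exactP[_ _ _ [pi pex] _] := ip (iter n.+1 K X).
  have /short_exactP[_ _ _ _ ps] := ip (iter n.+2 K X).
  apply/limg_lkerP; split=> [y | y]; first by rewrite !dE pi linear0.
  by rewrite dE => /ii/pex[z <-]; have [t <-] := ps z; exists t; rewrite dE.
have de : limg (d 0) = lker (p X).
  have /short_exactP[_ _ _ [pi pex] _] := ip X.
  have /short_exactP[_ _ _ _ ps] := ip (K X).
  apply/limg_lkerP; split=> [y | y /pex[z <-]]; first by rewrite dE pi.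
  by have [t <-] := ps z; exists t; rewrite dE.
have mono (S : lmod B) : simple S -> forall t : T (dual_rmod S) (K X),
    forall Ti, tens_induced (i X) Ti -> Ti t = 0 -> t = 0.
  move=> sS t Ti TiE Tit.
  have /short_exactP[hi hp ii [pi pex] psx] := ip X.
  have /short_exactP[_ hpK _ [piK _] ps] := ip (K X).
  have hi1 : is_hom (i (K X)) by case: (ip (K X)).
  have hp2 : is_hom (p (K (K X))) by case: (ip (K (K X))).
  have tor := monX 1%N S isT sS (fun n => P (iter n K X)) d (p X)
    (fun n => prP _) hd hp ((limg_fullP _).2 psx) de dd.
  have [Tp TpE] := tens_induced_exists (dual_rmod S) hpK.
  have [u uE] := tens_induced_epi TpE ps t.
  have [D0 [D0E D0I]] : exists D : 'Hom(T (dual_rmod S) (P (K X)), T (dual_rmod S) (P X)),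
    D = tens_over_map (bm_rmod (inflate (A := A) (dual_rmod S))) (d 0)
    /\ tens_induced (d 0) D.
    by eexists; split=> // v y; apply: tens_over_mapE; exact: (hd 0%N).
  have [D1 [D1E D1I]] : exists D : 'Hom(T (dual_rmod S) (P (K (K X))), T (dual_rmod S) (P (K X))),
    D = tens_over_map (bm_rmod (inflate (A := A) (dual_rmod S))) (d 1%N)
    /\ tens_induced (d 1%N) D.
    by eexists; split=> // v y; apply: tens_over_mapE; exact: (hd 1%N).
  have D01 : limg D1 = lker D0 by rewrite D0E D1E; exact: tor.
  have /limg_lkerP[_ Dex] := D01.
  have [|w wE] := Dex u.
    rewrite -Tit -uE -[Ti _]comp_lfunE; apply: tens_over_eq => v y.
    by rewrite comp_lfunE D0I TpE TiE dE.
  rewrite -uE -wE -comp_lfunE -[RHS](zero_lfunE _ w); apply: tens_over_eq => v y.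
  by rewrite comp_lfunE D1I TpE dE piK zero_lfunE tcl0r.
have ipX := ip X; have rip := res_exact ipX.
apply: Ext1_eq0_projective => M; apply: fil_Ext1_eq0r (fil_simple M) => S sS.
apply: (extends_Ext1_eq0 rip (res_projective (prP X))) => f hf.
have hi : is_hom (i X) by case: ipX.
have [Ti TiE] := tens_induced_exists (dual_rmod S) hi.
have iTi : lker Ti == 0%VS by apply/eqP/lker0E => t; exact: mono.
have [F FE] := hom_functional hf.
(* The functional of f is extended along a linear left inverse of [Ti]; the map that corresponds to
   it extends f. *)
have [g hg gE] := functional_hom (F \o Ti^-1)%VF.
exists g => // y; apply/eqP; rewrite -subr_eq0; apply/eqP.
apply: functional_separates => phi; rewrite linearB /=.
by rewrite -gE -TiE comp_lfunE lker0_lfunK // FE subrr.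
Qed.

Lemma MonP X : Mon X <-> projective (resB X).
Proof.
split=> [|prX [|n] S //]; first exact: Mon_projective.
by move=> _ _; exact: projective_Tor.
Qed.

End Monomorphic.

(** * Gorenstein projective modules over the tensor product *)

Section GorensteinTensor.
Context {k : fieldType} {A B : falgType k}.
Hypothesis B_triangular : triangular B.
Notation AB := (tens A B).
Notation T V X := (bimod_tens (inflate V) X).
Implicit Types (X Y Z K P : lmod AB) (V : rmod B).

Lemma res_Gproj X : Gproj X -> projective (resB X).
Proof.
move=> gX; apply: (acyclic_projective (C := fun W => exists2 X, Gproj X & W = resB X)
  B_triangular); last by exists X.
move=> _ [{gX} X /Gproj_gorenstein_class[_ [P [X' [i [p [ip prP gX']]]]] _] ->].
exists (resB P), (resB X'), i, p; split; [exact: res_exact | exact: res_projective |].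
by exists X'.
Qed.

(** Induction on the level of the factors of M. For simple S with cover P and radical K, A ⊗ P is
    projective, so Ext^1(X, A ⊗ S) embeds into Ext^2(X, A ⊗ K). The latter is Ext^1(X', A ⊗ K) for a
    Gorenstein projective syzygy X', where K has lower level. *)
Lemma Gproj_Ext1_eq0_tens X (M : lmod B) : Gproj X -> Ext1_eq0 X (tens_lmod (@regular_lmod k A) M).
Proof.
have [n nB] := triangular_low B_triangular.
have : fil (fun S => simple S /\ low n S) M.
  by apply: fil_sub (fil_simple M) => S sS; split=> //; exact: nB.
elim: n {nB} M X => [|n IH] M X FM; elim: FM X => {M}.
- move=> M M0 X _; apply: Ext1_eq0_zeror => t; elim/(@tens_ind k A M): t => [a x | s s' -> ->].
    by rewrite (M0 x) tpure0r.
  exact: addr0.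
- by move=> S [].
- move=> M E N i p ip _ IM _ IN X gX.
  exact: (Ext1_eq0_extr (tens_exactr regular_lmod ip) (IM X gX) (IN X gX)).
- move=> M M0 X _; apply: Ext1_eq0_zeror => t; elim/(@tens_ind k A M): t => [a x | s s' -> ->].
    by rewrite (M0 x) tpure0r.
  exact: addr0.
- move=> S [sS lS] X gX.
  have [P [p [prP lp]]] := projective_cover_exists sS.
  have [hp ps _] := lp; have [K [i ip]] := kernel_exact hp ps.
  have FK := cover_kernel sS lS prP lp ip.
  have [_ _ [Q [X' [j [q [jq prQ gX']]]]]] := Gproj_gorenstein_class gX.
  apply: (Ext1_eq0_shift jq prQ (tens_exactr regular_lmod ip) (IH _ _ FK gX')).
  by apply: Gproj_Ext1_eq0 => //; apply: tens_projective => //; exact: regular_projective.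
- move=> M E N i p ip _ IM _ IN X gX.
  exact: (Ext1_eq0_extr (tens_exactr regular_lmod ip) (IM X gX) (IN X gX)).
Qed.

(** V ⊗_B (A ⊗ B) = A ⊗ V is free over A. *)
Lemma tens_over_projective V P : projective P -> projective (T V P).
Proof.
apply: (@projective_ind k AB (fun P => projective (T V P))); last first.
  move=> M N E i p j q hi hp hj hq ijpq prM prN.
  have [Ti TiE] := tens_induced_exists V hi; have [Tp TpE] := tens_induced_exists V hp.
  have [Tj TjE] := tens_induced_exists V hj; have [Tq TqE] := tens_induced_exists V hq.
  apply: (@projective_add_closed k A (T V M) (T V N) (T V E) Ti Tp Tj Tq) => //.
  - exact: tens_induced_hom TiE.
  - exact: tens_induced_hom TpE.
  - exact: tens_induced_hom TjE.
  - exact: tens_induced_hom TqE.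
  - exact: tens_induced_split TiE TpE TjE TqE ijpq.
pose R := @regular_lmod k AB.
move=> M N g f /is_homP hg gs /is_homP hf.
have gK z : g (g^-1%VF z) = z by rewrite limg_lfunVK // gs memvf.
have [tl tr] := tcl_bilin (A := A) V R.
pose f1 (v : V) : N := f (tcl v (tpure 1 1 : R)).
have [h hE] : exists h : 'Hom(T V R, M), forall v t,
    h (tcl v t) = tlift (fun a b => lact M a (g^-1%VF (f1 (ract V b v)))) t.
  have hB v : bilin (fun a b => lact M a (g^-1%VF (f1 (ract V b v)))).
    split=> [b c x y | a c x y]; first exact: lact_linearl.
    by rewrite /f1 ract_linear add_lfunE scale_lfunE tl !linearP.
  apply: tens_over_lift => [|v b t].
    split=> [t c v v' | v c t t']; last exact: linearP.
    elim/(@tens_ind k A B): t => [a b | s s' es es'].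
      by rewrite !tlift_pure // /f1 linearP tl !linearP.
    by rewrite !linearD /= es es' addrACA.
  elim/(@tens_ind k A B): t => [a b' | s s' es es'].
    rewrite regular_actE [_ * _]tmul_pure !tlift_pure // mul1r ractM comp_lfunE //.
  by rewrite !linearD /= es es'.
have hB v : bilin (fun a b => lact M a (g^-1%VF (f1 (ract V b v)))).
  split=> [b c x y | a c x y]; first exact: lact_linearl.
  by rewrite /f1 ract_linear add_lfunE scale_lfunE tl !linearP.
have hpE v a b : h (tcl v (tpure a b : R)) = lact M a (g^-1%VF (f1 (ract V b v))).
  by rewrite hE tlift_pure.
exists h; split.
  move=> a; apply: tens_over_ext => v t; rewrite [LHS]comp_lfunE [RHS]comp_lfunE tcl_act.
  elim/(@tens_ind k A B): t => [a' b | s s' es es'].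
    by rewrite regular_actE [_ * _]tmul_pure !hpE mul1r lact_mul.
  by rewrite linearD !tclDr !linearD /= es es'.
apply: tens_over_ext => v t; rewrite comp_lfunE.
elim/(@tens_ind k A B): t => [a b | s s' es es']; last by rewrite !tclDr !linearD /= es es'.
rewrite hpE hg gK /f1 -hf tcl_act tcl_balanced tact_mul regular_actE [_ * _]tmul_pure.
by rewrite !mulr1 mul1r.
Qed.

(* The Λ-module A ⊗ D(V) = Hom_k(V, A), with its evaluations at the elements of V. *)
Lemma tens_dual_exists V : exists (D : lmod B)
    (ev : V -> 'Hom(tens_lmod (@regular_lmod k A) D, A)),
  [/\ forall t c v v', ev (c *: v + v') t = c *: ev v t + ev v' t,
      forall v a b t, ev v (lact _ (tpure a b) t) = a * ev (ract V b v) t,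
      forall t, (forall v, ev v t = 0) -> t = 0
    & forall f : 'Hom(V, A), exists t, forall v, ev v t = f v].
Proof.
have cl b : linear (fun f : 'Hom(V, k^o) => (f \o ract V b)%VF).
  by move=> c f g; apply/lfunP=> x; rewrite comp_lfunDl -comp_lfunZl.
pose bf b : {linear 'Hom(V, k^o) -> 'Hom(V, k^o)} := HB.pack
  (fun f : 'Hom(V, k^o) => (f \o ract V b)%VF) (GRing.isLinear.Build k _ _ _ _ (cl b)).
pose act b : 'End('Hom(V, k^o)) := linfun (bf b).
have actE b f v : act b f v = f (ract V b v) by rewrite lfunE /= comp_lfunE.
have al : linear act.
  move=> c a b; apply/lfunP=> f; apply/lfunP=> x.
  by rewrite !(add_lfunE, scale_lfunE) !actE ract_linear add_lfunE scale_lfunE linearP.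
have a1 : act 1 = \1%VF.
  by apply/lfunP=> f; apply/lfunP=> x; rewrite actE ract1 !id_lfunE.
have aM a b : act (a * b) = (act a \o act b)%VF.
  by apply/lfunP=> f; apply/lfunP=> x; rewrite comp_lfunE !actE ractM comp_lfunE.
pose D := Lmod al a1 aM.
have evB (v : V) : bilin (fun (a : A) (f : 'Hom(V, k^o)) => (f v : k) *: a).
  split=> [f c a a' | a c f f']; first by rewrite scalerDr !scalerA mulrC.
  by rewrite add_lfunE scale_lfunE scalerDl scalerA.
pose ev (v : V) : 'Hom(tens_lmod (@regular_lmod k A) D, A) :=
  linfun (tlift (fun (a : A) (f : 'Hom(V, k^o)) => (f v : k) *: a)).
have evE v (a : A) (f : 'Hom(V, k^o)) : ev v (tpure a f) = (f v : k) *: a.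
  by rewrite lfunE /= tlift_pure.
clearbody ev.
have [c cE] : exists c : 'I_(\dim {:V}) -> 'Hom(V, k^o),
    forall i x, c i x = coord (vbasis {:V}) i x.
  have ex i : exists f : 'Hom(V, k^o), forall x, f x = coord (vbasis {:V}) i x.
    by apply: linfun_exists => r x y; rewrite linearP.
  exists (fun i => proj1_sig (constructive_indefinite_description _ (ex i))) => i.
  exact: proj2_sig (constructive_indefinite_description _ (ex i)).
exists D, ev; split.
- move=> t r v v'; elim/(@tens_ind k A 'Hom(V, k^o)): t => [a f | s s' es es'].
    by rewrite !evE linearP scalerDl scalerA.
  by rewrite !linearD /= es es' addrACA.
- move=> v a b t; elim/(@tens_ind k A 'Hom(V, k^o)): t => [a' f | s s' es es'].
    by rewrite tens_lmodE regular_actE !evE /= actE scalerAr.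
  by rewrite !linearD /= es es' mulrDr.
- move=> t t0; have e (s : tens A 'Hom(V, k^o)) :
      s = \sum_(i < \dim {:V}) tpure (ev (vbasis {:V})`_i s) (c i).
    elim/(@tens_ind k A 'Hom(V, k^o)): s => [a f | s s' es es'].
      have {1}-> : f = \sum_(i < \dim {:V}) (f (vbasis {:V})`_i : k) *: c i.
        apply/lfunP=> y; rewrite sum_lfunE {1}(coord_vbasis (memvf y)) linear_sum.
        by apply: eq_bigr => i _; rewrite linearZ scale_lfunE cE; exact: mulrC.
      rewrite (bilin_sumr _ _ _ _ (tpure_bilin A _)); apply: eq_bigr => i _.
      by rewrite evE tpureZl.
    rewrite {1}es {1}es' -big_split /=; apply: eq_bigr => i _.
    by rewrite linearD /= tpureDl.
  by rewrite [t]e big1 // => i _; rewrite t0 tpure0l.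
- move=> f; exists (\sum_(i < \dim {:V})
    (tpure (f (vbasis {:V})`_i) (c i) : tens A 'Hom(V, k^o))) => v.
  rewrite linear_sum [in RHS](coord_vbasis (memvf v)) linear_sum.
  by apply: eq_bigr => i _; rewrite linearZ [LHS]evE cE.
Qed.

(** Since the modules involved are B-projective, V ⊗_B - preserves the resolution and coresolution
    steps. For Ext^1(V ⊗_B X, A) = 0, a map V ⊗_B K -> A is turned into a map K -> A ⊗ D(V),
    extended to Q by [Gproj_Ext1_eq0_tens], and turned back. *)
Lemma tens_over_Gproj V X : Gproj X -> Gproj (T V X).
Proof.
move=> gX; apply: (@Gproj_coind k A (fun N => exists2 X, Gproj X & N = T V X)); last by exists X.
move=> _ [{gX} X gX ->]; have := gX; move=> /Gproj_gorenstein_class[_].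
move=> [P [X' [i [p [ip prP gX']]]]] [Q [K [j [q [jq prQ gK]]]]].
have Texact Y1 Y2 Y3 (u : 'Hom(Y1, Y2)) (w : 'Hom(Y2, Y3)) : short_exact u w -> Gproj Y3 ->
    exists Tu Tw, [/\ short_exact Tu Tw, tens_induced (V := V) u Tu & tens_induced (V := V) w Tw].
  move=> uw gY; have [hu hw _ _ _] := uw.
  have [Tu TuE] := tens_induced_exists V hu; have [Tw TwE] := tens_induced_exists V hw.
  by exists Tu, Tw; split=> //; exact: tens_over_exact uw (res_Gproj gY) TuE TwE.
have [Ti [Tp [Tip _ _]]] := Texact _ _ _ _ _ ip gX'.
have [Tj [Tq [Tjq TjE TqE]]] := Texact _ _ _ _ _ jq gX.
suff EX : Ext1_eq0 (T V X) (@regular_lmod k A).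
  split=> //; [exists (T V P), (T V X'), Ti, Tp | exists (T V Q), (T V K), Tj, Tq].
    by split=> //; [exact: tens_over_projective | exists X'].
  by split=> //; [exact: tens_over_projective | exists K].
apply: (extends_Ext1_eq0 Tjq (tens_over_projective prQ)) => f /is_homP hf.
have [D [ev [evl evact ev0 evex]]] := tens_dual_exists V.
have [hj _ _ _ _] := jq.
have [tl tr] := tcl_bilin (A := A) V K.
have [F hF FE] : exists2 F : 'Hom(K, tens_lmod (@regular_lmod k A) D), is_hom F &
    forall v x, ev v (F x) = f (tcl v x).
  have ex (x : K) : exists t, forall v, ev v t = f (tcl v x).
    have [g gE] : exists g : 'Hom(V, A), forall v, g v = f (tcl v x).
      by apply: linfun_exists => c v v'; rewrite tl linearP.
    by have [t tE] := evex g; exists t => v; rewrite tE gE.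
  pose t x := proj1_sig (constructive_indefinite_description _ (ex x)).
  have tE x v : ev v (t x) = f (tcl v x).
    exact: (proj2_sig (constructive_indefinite_description _ (ex x)) v).
  have evI s s' : (forall v, ev v s = ev v s') -> s = s'.
    move=> e; apply/eqP; rewrite -subr_eq0; apply/eqP/ev0 => v.
    by rewrite linearB /= e subrr.
  have [F FE] : exists F : 'Hom(K, tens_lmod (@regular_lmod k A) D), forall x, F x = t x.
    apply: linfun_exists => c x y; apply: evI => v.
    by rewrite linearP /= !tE tr linearP.
  exists F; last by move=> v x; rewrite FE tE.
  apply/tens_homP=> a b x; apply: evI => v.
  rewrite evact !FE !tE tact_split tact_comm -tcl_balanced -tcl_act hf.
  exact: regular_actE.
have [G /tens_homP hG GE] := Ext1_eq0_extends (Gproj_Ext1_eq0_tens (M := D) gX) jq hF.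
have [g gE] : exists g : 'Hom(T V Q, A), forall v x, g (tcl v x) = ev v (G x).
  apply: tens_over_lift => [|v b x]; last by rewrite hG evact mul1r.
  by split=> [x c v v' | v c x x']; [exact: evl | rewrite !linearP].
exists g.
  move=> a; apply: tens_over_ext => v x.
  rewrite [LHS]comp_lfunE [RHS]comp_lfunE tcl_act !gE hG evact ract1 id_lfunE.
  by rewrite regular_actE.
move=> t; rewrite -comp_lfunE; move: t; apply: tens_over_eq => v x.
by rewrite comp_lfunE TjE gE GE FE.
Qed.

Lemma Gproj_MonIn X : Gproj X -> MonIn (Gproj (A := A)) X.
Proof.
move=> gX; split; first exact/MonP/res_Gproj.
by move=> V; exact: tens_over_Gproj.
Qed.

(** By [projective_ind] it is enough to take P = B. There f is determined by x -> f(x ⊗ 1) in A ⊗ B,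
    whose coordinates in a basis of B are A-linear maps K -> A; each extends to Q. *)
Lemma tens_extends (G K Q : lmod A) (i : 'Hom(K, Q)) (p : 'Hom(Q, G)) (P : lmod B) :
    short_exact i p -> Ext1_eq0 G (@regular_lmod k A) -> projective P ->
  extends (tmap i \1%VF : 'Hom(tens_lmod K P, tens_lmod Q P)) (@regular_lmod k AB).
Proof.
move=> ip GA; apply: (@projective_ind k B (fun P : lmod B =>
  extends (tmap i \1%VF : 'Hom(tens_lmod K P, tens_lmod Q P)) (@regular_lmod k AB))); last first.
  move=> M N E u v w z hu hv hw hz uvwz eM eN f hf.
  have tm (P1 P2 : lmod B) (X1 : lmod A) (g : 'Hom(P1, P2)) : is_hom g ->
      is_hom (tmap \1%VF g : 'Hom(tens_lmod X1 P1, tens_lmod X1 P2)).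
    by move=> hg; apply: tmap_hom => //; exact: hom1.
  have [g1 hg1 g1E] := eM _ (hom_comp hf (tm _ _ K _ hu)).
  have [g2 hg2 g2E] := eN _ (hom_comp hf (tm _ _ K _ hw)).
  exists ((g1 \o tmap \1%VF v)%VF + (g2 \o tmap \1%VF z)%VF).
    by apply: homD; apply: hom_comp => //; exact: tm.
  move=> t; rewrite add_lfunE !comp_lfunE.
  have sw (P1 P2 : lmod B) (g : 'Hom(P1, P2)) (s : tens K P1) :
      tmap \1%VF g (tmap i \1%VF s) = tmap i \1%VF (tmap \1%VF g s).
    by rewrite -!comp_lfunE -!tmap_comp !comp_lfun1l !comp_lfun1r.
  rewrite (sw _ _ v) (sw _ _ z) g1E g2E !comp_lfunE -linearD.
  by rewrite (tmap_split2 t uvwz).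
move=> f /tens_homP hf.
pose R := @regular_lmod k B.
have [c cE] : exists c : 'I_(\dim {:B}) -> 'Hom(tens A B, A),
    forall i a b, c i (tpure a b) = coord (vbasis {:B}) i b *: a.
  have ex i0 : exists g : 'Hom(tens A B, A), forall a b, g (tpure a b) = coord (vbasis {:B}) i0 b *: a.
    apply: tlift_exists; split=> [b r a a' | a r b b'].
      by rewrite scalerDr !scalerA mulrC.
    by rewrite linearP scalerDl scalerA.
  exists (fun i => proj1_sig (constructive_indefinite_description _ (ex i))) => i0.
  exact: proj2_sig (constructive_indefinite_description _ (ex i0)).
have cM j a t : c j (lact (@regular_lmod k AB) (tpure a 1) t) = a * c j t.
  elim/(@tens_ind k A B): t => [a' b | s s' es es'].
    by rewrite regular_actE [_ * _]tmul_pure !cE mul1r scalerAr.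
  by rewrite !linearD /= es es' mulrDr.
have cS (t : tens A B) : t = \sum_(j < \dim {:B}) tpure (c j t) (vbasis {:B})`_j.
  elim/(@tens_ind k A B): t => [a b | s s' es es'].
    rewrite {1}(coord_vbasis (memvf b)) (bilin_sumr _ _ _ _ (tpure_bilin A B)).
    by apply: eq_bigr => j _; rewrite cE tpureZl.
  rewrite {1}es {1}es' -big_split /=; apply: eq_bigr => j _.
  by rewrite linearD /= tpureDl.
have ex j : exists g : 'Hom(Q, @regular_lmod k A), is_hom g /\
    forall x, g (i x) = c j (f (tpure x (1 : B) : tens K R)).
  have [fj fjE] : exists fj : 'Hom(K, @regular_lmod k A), forall x,
      fj x = c j (f (tpure x (1 : B) : tens K R)).
    by apply: linfun_exists => r x y; rewrite tpureDl tpureZl !linearP.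
  have hfj : is_hom fj.
    apply/is_homP=> a x; rewrite !fjE regular_actE -cM -hf tens_lmodE lact_one //.
  by have [g hg gE] := Ext1_eq0_extends GA ip hfj; exists g; split=> // x; rewrite gE fjE.
pose g j := proj1_sig (constructive_indefinite_description _ (ex j)).
have gP j : is_hom (g j) /\ forall x, g j (i x) = c j (f (tpure x (1 : B) : tens K R)).
  exact: (proj2_sig (constructive_indefinite_description _ (ex j))).
clearbody g.
have [h hE] : exists h : 'Hom(tens Q R, AB), forall x (b : B),
    h (tpure x b) = \sum_(j < \dim {:B}) tpure (g j x) (b * (vbasis {:B})`_j).
  apply: tlift_exists; split=> [b r x y | x r b b'].
    rewrite scaler_sumr -big_split /=; apply: eq_bigr => j _.
    by rewrite linearP tpureDl tpureZl.
  rewrite scaler_sumr -big_split /=; apply: eq_bigr => j _.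
  by rewrite mulrDl -scalerAl tpureDr tpureZr.
exists h.
  apply/tens_homP=> a b t; elim/(@tens_ind k Q R): t => [x b' | s s' es es'].
    rewrite tens_lmodE !regular_actE !hE mulr_sumr; apply: eq_bigr => j _.
    have [/is_homP -> _] := gP j.
    by rewrite regular_actE [RHS]tmul_pure mulrA.
  by rewrite !linearD /= es es'.
move=> t; elim/(@tens_ind k K R): t => [x b | s s' es es']; last by rewrite !linearD /= es es'.
rewrite tmapE id_lfunE hE.
have -> : f (tpure x b) = lact (@regular_lmod k AB) (tpure 1 b) (f (tpure x (1 : B) : tens K R)).
  by rewrite -hf tens_lmodE lact_one regular_actE mulr1.
rewrite [f _ in RHS]cS regular_actE mulr_sumr; apply: eq_bigr => j _.
by have [_ ->] := gP j; rewrite [RHS]tmul_pure mul1r.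
Qed.

Lemma tens_Gproj (G : lmod A) (P : lmod B) :
  Gproj G -> projective P -> Gproj (tens_lmod G P).
Proof.
move=> gG prP; apply: (@Gproj_coind k AB (fun N => exists2 G, Gproj G & N = tens_lmod G P));
  last by exists G.
move=> _ [{gG} G gG ->]; have := gG => /Gproj_gorenstein_class[GA].
move=> [Q [G' [i [p [ip prQ gG']]]]] [Q' [K [j [q [jq prQ' gK]]]]].
suff EGP : Ext1_eq0 (tens_lmod G P) (@regular_lmod k AB).
  split=> //.
    exists (tens_lmod Q P), (tens_lmod G' P), (tmap i \1%VF), (tmap p \1%VF).
    by split; [exact: tens_exactl | exact: tens_projective | exists G'].
  exists (tens_lmod Q' P), (tens_lmod K P), (tmap j \1%VF), (tmap q \1%VF).
  by split; [exact: tens_exactl | exact: tens_projective | exists K].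
apply: (extends_Ext1_eq0 (tens_exactl P jq)); first exact: tens_projective.
exact: tens_extends jq GA prP.
Qed.

Lemma fil_Gproj X : fil (tens_class (Gproj (A := A)) (Gproj (A := B))) X -> Gproj X.
Proof.
elim=> [Z Z0 | M [G [P [gG gP MGP]]] | M E N i p ip _ gM _ gN].
- by apply: projective_Gproj; exact: projective_zero.
- apply: Gproj_iso_closed (isomorphic_sym MGP) _; apply: tens_Gproj => //.
  exact: triangular_Gproj_projective gP.
- exact: Gproj_ext_closed ip gM gN.
Qed.

End GorensteinTensor.

Lemma dim_mono (k : fieldType) (U V : vectType k) (f : 'Hom(U, V)) :
  (forall x, f x = 0 -> x = 0) -> (dim U <= dim V)%N.
Proof.
move=> /lker0E fi; have := limg_ker_dim f fullv.
by rewrite capfv fi dimv0 add0n dimvf => <-; rewrite -[dim V]dimvf dimvS ?subvf.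
Qed.

(** * Projective covers of simples of maximal level *)

Section LocalCovers.
Context {k : fieldType} {B : falgType k}.
Implicit Types P S T X Y K : lmod B.

Lemma local_top S P T (p : 'Hom(P, S)) (g : 'Hom(P, T)) :
  simple S -> local_over p -> simple T -> is_hom g -> (exists x, g x <> 0) ->
  isomorphic T S.
Proof.
move=> sS [hp ps loc] sT hg g0; have gs := simple_epi sT hg g0.
have [t t0] := simple_neq0 sT; have [y yE] := gs t.
have [G [j [hj ij gj gex]]] := ker_exists hg.
have pj x : p (j x) = 0.
  apply: NNPP => px; have [|z zE] := loc _ _ hj _ y; first by exists x.
  by apply: t0; rewrite -yE -zE gj.
have [u hu uE] : exists2 u : 'Hom(T, S), is_hom u & forall x, u (g x) = p x.
  by apply: hom_factor_epi => // x /gex[z <-].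
apply/isomorphicP; exists u; apply: simple_iso => //.
have [s s0] := simple_neq0 sS; have [x xE] := ps s.
by exists (g x); rewrite uE xE.
Qed.

Lemma nonlow_iso n S T : isomorphic T S -> low n T -> ~ low n S -> False.
Proof. by move=> TS lT; apply; exact: low_iso TS lT. Qed.

Variables (S P : lmod B) (p : 'Hom(P, S)) (n : nat).
Hypotheses (B_split : splitting B) (sS : simple S) (lS : low n.+1 S) (nS : ~ low n S).
Hypotheses (prP : projective P) (lp : local_over p).

(** The factors of Ker p have lower level than S, so w kills Ker p and comes from an endomorphism of
    S, a scalar by [splitting]. *)
Lemma local_hom (w : 'Hom(P, S)) : is_hom w -> exists c, forall y, w y = c *: p y.
Proof.
move=> hw; have [hp ps _] := lp; have [K [i ip]] := kernel_exact hp ps.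
have FK := cover_kernel sS lS prP lp ip.
case/short_exactP: ip => hi _ ii [pi pex] _.
have [u hu uE] : exists2 u : 'Hom(S, S), is_hom u & forall x, u (p x) = w x.
  apply: hom_factor_epi => // x /pex[y <-]; rewrite -comp_lfunE.
  apply: fil_hom0l FK (hom_comp hw hi) y => X g [sX lX] hg z.
  apply: NNPP => gz; apply: (nonlow_iso _ lX nS); apply/isomorphicP; exists g.
  by apply: simple_iso => //; exists z.
by have [c cE] := B_split sS hu; exists c => y; rewrite -uE cE scale_lfunE id_lfunE.
Qed.

(** By [local_hom] some u - c maps into Ker p. Every nonzero map from P to a simple has image
    isomorphic to S, which is no factor of Ker p, so u - c = 0. *)
Lemma local_end (u : 'End(P)) : is_hom u -> exists c, forall y, u y = c *: y.
Proof.
move=> hu; have [hp ps _] := lp; have [K [i ip]] := kernel_exact hp ps.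
have FK := cover_kernel sS lS prP lp ip.
case/short_exactP: ip => hi _ ii [pi pex] _.
have [c cE] := local_hom (hom_comp hp hu); exists c => y.
have hd : is_hom (u - c *: \1%VF) by apply: homB => //; apply: homZ; exact: hom1.
have [d hdd dE] : exists2 d : 'Hom(P, K), is_hom d & forall x, i (d x) = (u - c *: \1%VF) x.
  apply: hom_factor_mono => // x; apply: pex.
  rewrite add_lfunE opp_lfunE scale_lfunE id_lfunE linearB /= linearZ /=.
  by have := cE x; rewrite comp_lfunE => ->; rewrite subrr.
have d0 : d y = 0.
  apply: fil_hom0r FK hdd y => X g [sX lX] hg z.
  apply: NNPP => gz; apply: (nonlow_iso _ lX nS).
  by apply: (local_top sS lp sX hg); exists z.
apply/eqP; rewrite -subr_eq0; apply/eqP; have := dE y; rewrite d0 linear0.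
by rewrite add_lfunE opp_lfunE scale_lfunE id_lfunE => ->.
Qed.

(* Y = P^m + Y' with no map from Y' to S and none from P to Y'; h_j and q_j are *)
(* the inclusions of and the projections to the copies of P.                   *)
Lemma isotypic_split Y : projective Y ->
    (forall T (w : 'Hom(Y, T)), simple T -> is_hom w ->
       (forall z, exists y, w y = z) -> low n.+1 T) ->
  exists m (h : nat -> 'Hom(P, Y)) (q : nat -> 'Hom(Y, P)),
  [/\ forall j, is_hom (h j) /\ is_hom (q j),
      forall i j y, (i < m)%N -> (j < m)%N -> q i (h j y) = (i == j)%:R *: y,
      forall T (w : 'Hom(Y, T)), isomorphic T S -> is_hom w ->
        forall y, w y = \sum_(j < m) w (h j (q j y))
    & forall g : 'Hom(P, Y), is_hom g ->
        forall y, g y = \sum_(j < m) h j (q j (g y))].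
Proof.
move=> prY topY; have [hp ps _] := lp.
(* m orthogonal copies of P split off from Y. A maximal m exists, since the vectors h_j(y0) are
   linearly independent. *)
pose sys m := exists (h : nat -> 'Hom(P, Y)) (q : nat -> 'Hom(Y, P)),
  [/\ forall j, is_hom (h j), forall j, is_hom (q j)
    & forall i j y, (i < m)%N -> (j < m)%N -> q i (h j y) = (i == j)%:R *: y].
have [s s0] := simple_neq0 sS; have [y0 y0E] := ps s.
have y0N : y0 <> 0 by move=> y00; apply: s0; rewrite -y0E y00 linear0.
have sys0 : sys 0.
  by exists (fun _ => 0), (fun _ => 0); split=> // j; exact: hom0.
have sysb m : sys m -> (m <= dim Y)%N.
  move=> [h [q [hh hq qh]]].
  have [f fE] : exists f : 'Hom('rV[k]_m, Y), forall c,
      f c = \sum_(j < m) c 0 j *: h j y0.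
    apply: linfun_exists => r c d; rewrite scaler_sumr -big_split /=.
    by apply: eq_bigr => j _; rewrite !mxE scalerDl scalerA.
  have dE : dim 'rV[k]_m = m by exact: mul1n.
  have := dim_mono (f := f); rewrite dE; apply.
  move=> c fc; apply/rowP=> i; rewrite mxE; apply/eqP.
  have : q i (f c) = c 0 i *: y0.
    rewrite fE linear_sum (bigD1 i) //= linearZ /= qh // eqxx scale1r big1 ?addr0 //.
    move=> j /negPf ji; rewrite linearZ /= qh // eq_sym (_ : (j == i :> nat) = false) //.
    by rewrite scale0r scaler0.
  by rewrite fc linear0 => /esym/eqP; rewrite scaler_eq0; case/orP=> // /eqP /y0N.
have [m [h [q [hh hq qh]]] mmax] := max_nat_exists (ex_intro _ _ sys0) sysb.
pose e : 'End(Y) := \sum_(j < m) (h j \o q j)%VF.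
have eE y : e y = \sum_(j < m) h j (q j y).
  by rewrite sum_lfunE; apply: eq_bigr => j _; rewrite comp_lfunE.
have he : is_hom e by apply: hom_sum => j; exact: hom_comp.
have qe i y : (i < m)%N -> q i (e y) = q i y.
  move=> im; rewrite eE linear_sum (bigD1 (Ordinal im)) //= qh // eqxx scale1r.
  rewrite big1 ?addr0 // => j /negPf ji; rewrite qh //.
  by rewrite eq_sym (_ : (j == i :> nat) = false) ?scale0r.
have eh j y : (j < m)%N -> e (h j y) = h j y.
  move=> jm; rewrite eE (bigD1 (Ordinal jm)) //= qh // eqxx scale1r.
  rewrite big1 ?addr0 // => i /negPf ij; rewrite qh //.
  by rewrite (_ : (i == j :> nat) = false) ?scale0r ?linear0.
have ee y : e (e y) = e y.
  by rewrite (eE y) linear_sum; apply: eq_bigr => j _; exact: eh.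
pose d : 'End(Y) := \1%VF - e.
have dE y : d y = y - e y by rewrite add_lfunE opp_lfunE id_lfunE.
have hd : is_hom d by apply: homB => //; exact: hom1.
(* Otherwise a surjection from the complement to S would split off one more copy of P, against the
   maximality of m. *)
have killS (w : 'Hom(Y, S)) : is_hom w -> forall y, w (d y) = 0.
  move=> hw; apply: NNPP => nw.
  pose w' : 'Hom(Y, S) := (w \o d)%VF; have hw' : is_hom w' by exact: hom_comp.
  have w's : forall z, exists y, w' y = z.
    apply: simple_epi => //; apply: NNPP => nx; apply: nw => y.
    by apply: NNPP => wy; apply: nx; exists y; rewrite comp_lfunE.
  have w'd y : w' (d y) = w' y.
    by rewrite !comp_lfunE; congr (w _); rewrite dE [e (d y)](_ : _ = 0) ?subr0 // dE linearB /= ee subrr.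
  have [h0 hh0 h0E] := lift_epi prP hw' w's hp.
  have [q0 hq0 q0E] := lift_epi prY hp ps hw'.
  have hu : is_hom (q0 \o (d \o h0))%VF by do 2?apply: hom_comp.
  have [c cE] := local_end hu.
  (* Both sides of the scalar identity are compared in the top: y0 maps to s <> 0 under p, before
     and after. *)
  have c1 : c = 1.
    have := q0E (d (h0 y0)); rewrite w'd h0E.
    have := cE y0; rewrite !comp_lfunE => ->; rewrite linearZ /= y0E => /eqP.
    rewrite -subr_eq0 -{2}[s]scale1r -scalerBl scaler_eq0 => /orP[|/eqP //].
    by rewrite subr_eq0 => /eqP.
  have dd y : d (d y) = d y by rewrite [LHS]dE dE linearB /= ee subrr subr0.
  have qd i y : (i < m)%N -> q i (d y) = 0 by move=> im; rewrite dE linearB /= qe // subrr.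
  have dh j y : (j < m)%N -> d (h j y) = 0 by move=> jm; rewrite dE eh // subrr.
  have : sys m.+1.
    exists (fun j => if (j < m)%N then h j else (d \o h0)%VF),
      (fun j => if (j < m)%N then q j else (q0 \o d)%VF); split.
    - by move=> j; case: ifP => // _; exact: hom_comp.
    - by move=> j; case: ifP => // _; exact: hom_comp.
    move=> i j y; rewrite !ltnS => im jm.
    have [lim | lim] := ltnP i m; have [ljm | ljm] := ltnP j m; first exact: qh.
    - by rewrite comp_lfunE qd // (_ : (i == j) = false) ?scale0r // ltn_eqF // (leq_trans lim).
    - rewrite comp_lfunE dh // linear0 (_ : (i == j) = false) ?scale0r // gtn_eqF //.
      exact: leq_trans ljm lim.
    - have -> : i = j by apply/eqP; rewrite eqn_leq (leq_trans im ljm) (leq_trans jm lim).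
      rewrite eqxx scale1r !comp_lfunE dd.
      by have := cE y; rewrite !comp_lfunE c1 scale1r.
  by move=> /mmax; rewrite ltnn.
have kill T (w : 'Hom(Y, T)) : isomorphic T S -> is_hom w -> forall y, w (d y) = 0.
  move=> /isomorphicP[f [hf fi fs]] hw y; apply: fi.
  by have := killS _ (hom_comp hf hw) y; rewrite comp_lfunE.
have [I [u [v [hu hv iv us vu]]]] := hom_image hd.
have ue y : u (e y) = 0 by apply: iv; rewrite vu dE ee subrr.
(* The complement I has no factor S: S is not in its top by [kill], and arrows lead from level n + 1
   to level n, where S does not occur. *)
have FI : fil (fun T => simple T /\ (low n.+1 T /\ ~ isomorphic T S)) I.
  apply: fil_top => [X T [sX [lX nX]] sT nT | T g sT hg gs].
    apply: NNPP => XT; apply: nT; have {}XT : Ext1_neq0 X T by apply: NNPP => /Ext1_eq0P.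
    have lT := lX _ sT XT; split=> //; split; first exact: lowS.
    by move=> TS; exact: nonlow_iso TS lT nS.
  split=> //; split.
    apply: (topY _ (g \o u)%VF) => //; first exact: hom_comp.
    by move=> z; have [y <-] := gs z; have [x <-] := us y; exists x; rewrite comp_lfunE.
  move=> TS; have [t t0] := simple_neq0 sT; have [y yE] := gs t; have [x xE] := us y.
  apply: t0; rewrite -yE -xE -comp_lfunE -[x](subrK (e x)) linearD /=.
  by rewrite -dE (kill _ _ TS (hom_comp hg hu)) add0r comp_lfunE ue linear0.
exists m, h, q; split=> // [T w TS hw y | g hg y].
  rewrite -linear_sum -eE; apply/eqP; rewrite -subr_eq0 -linearB /= -dE.
  by apply/eqP; exact: kill.
rewrite -eE; apply/eqP; rewrite -subr_eq0 -dE -vu; apply/eqP.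
rewrite -[u (g y)]comp_lfunE (_ : (u \o g)%VF y = 0) ?linear0 //.
apply: fil_hom0r FI (hom_comp hu hg) y => X w [sX [_ nX]] hw z.
apply: NNPP => wz; apply: nX; apply: (local_top sS lp sX hw).
by exists z.
Qed.

End LocalCovers.

Lemma nat_switch (Q : nat -> Prop) n : Q n -> ~ Q 0%N ->
  exists m, Q m.+1 /\ ~ Q m.
Proof.
elim: n => // n IH Qn Q0; case: (classic (Q n)) => [/IH|nQ]; first exact.
by exists n.
Qed.

Lemma functional_tlift_exists (k : fieldType) (U V W : vectType k) m
    (f : nat -> 'Hom(U, k^o)) (h : nat -> 'Hom(V, W)) :
  exists g : 'Hom(tens U V, W), forall u v,
    g (tpure u v) = \sum_(j < m) (f j u : k) *: h j v.
Proof.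
apply: tlift_exists; split=> [v c x y | u c x y]; rewrite scaler_sumr -big_split /=.
  by apply: eq_bigr => j _; rewrite linearP scalerDl scalerA.
by apply: eq_bigr => j _; rewrite linearP scalerDr !scalerA mulrC.
Qed.

(** * Splitting off the isotypic part of a simple of maximal level *)

Section Peeling.
Context {k : fieldType} {A B : falgType k}.
Notation AB := (tens A B).
Notation T V X := (bimod_tens (inflate V) X).
Notation D := (@dual_rmod k B).
Implicit Types (X Y Z : lmod AB) (L : lmod A -> Prop) (R : lmod B).

Lemma lact_hom X a : is_hom (lact X (tpure a 1) : 'Hom(resB X, resB X)).
Proof. by apply/is_homP=> b x; rewrite /= /res_act tact_comm. Qed.

(** The map sends u ⊗ y to the sum of the f_j(u) h_j(y), where the f_j are coordinates on U. It is
    A-linear because a acts on the f_j and the h_j through the same matrix, injective because the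
    f_j span D(U), and it reaches each h_j(y) by the dual vectors. *)
Lemma isotypic_embedding (U : lmod A) (P : lmod B) X m (f : nat -> 'Hom(U, k^o))
    (h : nat -> 'Hom(P, resB X)) (q : nat -> 'Hom(resB X, P)) :
    (forall j, is_hom (h j)) ->
    (forall i j y, (i < m)%N -> (j < m)%N -> q i (h j y) = (i == j)%:R *: y) ->
    (forall a, exists c : nat -> nat -> k,
       (forall j y, lact X (tpure a 1) (h j y) = \sum_(i < m) c i j *: h i y) /\
       (forall i u, f i (lact U a u) = \sum_(j < m) c i j * f j u)) ->
    (forall g : 'Hom(U, k^o), exists c : nat -> k,
       forall u, g u = \sum_(j < m) c j * f j u) ->
    (forall j, (j < m)%N -> exists u, forall i, (i < m)%N -> f i u = (i == j)%:R) ->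
  exists Phi : 'Hom(tens_lmod U P, X),
  [/\ is_hom Phi, forall z, Phi z = 0 -> z = 0,
      forall (W : vectType k) (g : 'Hom(X, W)),
        (forall j y, (j < m)%N -> g (h j y) = 0) -> forall z, g (Phi z) = 0
    & forall j y, (j < m)%N -> exists z, Phi z = h j y].
Proof.
move=> hh qh fact fspan fdual.
have [Phi PhiE] := functional_tlift_exists m f h.
exists Phi; split.
- apply/tens_homP=> a b z.
  elim/(@tens_ind k U P): z => [u y | s s' es es']; last by rewrite !linearD /= es es'.
  have [c [ah fa]] := fact a.
  rewrite tens_lmodE !PhiE linear_sum.
  transitivity (\sum_(i < m) \sum_(j < m) (c i j * f j u) *: h i (lact P b y)).
    by apply: eq_bigr => i _; rewrite fa scaler_suml.
  rewrite exchange_big; apply: eq_bigr => j _ /=.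
  rewrite linearZ /= tact_split.
  have /is_homP/(_ b y) /= := hh j; rewrite /res_act => <-.
  by rewrite ah scaler_sumr; apply: eq_bigr => i _; rewrite scalerA mulrC.
- move=> z Phiz; apply: (tens_separates (U := U) (V := P)) => g G gE.
  have [c cE] := fspan g.
  have -> : G = \sum_(j < m) c j *: (q j \o Phi)%VF.
    apply: tens_lfun_ext => u y; rewrite gE cE sum_lfunE scaler_suml.
    apply: eq_bigr => j _; rewrite scale_lfunE comp_lfunE PhiE linear_sum (bigD1 j) //=.
    rewrite linearZ /= qh // eqxx scale1r big1 ?addr0 ?scalerA // => i /negPf ij.
    rewrite linearZ /= qh // (_ : (j == i :> nat) = false) ?scale0r ?scaler0 //.
    by rewrite eq_sym.
  rewrite sum_lfunE big1 // => j _.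
  by rewrite scale_lfunE comp_lfunE Phiz linear0 scaler0.
- move=> W g gh; suff /lfunP gPhi : (g \o Phi)%VF = 0 :> 'Hom(tens U P, W).
    by move=> z; have := gPhi z; rewrite comp_lfunE zero_lfunE.
  apply: tens_lfun_ext => u y; rewrite comp_lfunE PhiE zero_lfunE linear_sum big1 // => j _.
  by rewrite linearZ /= gh // scaler0.
- move=> j y jm; have [u uE] := fdual j jm; exists (tpure u y).
  rewrite PhiE (bigD1 (Ordinal jm)) //= uE // eqxx scale1r big1 ?addr0 // => i /negPf ij.
  by rewrite uE // (_ : (i == j :> nat) = false) ?scale0r.
Qed.

(* With X = P^m + X' over B as in isotypic_split, the submodule P^m is        *)
(* (D(S) ⊗_B X) ⊗_k P over A ⊗ B.                                             *)
Lemma peel_top X (S P : lmod B) (p : 'Hom(P, S)) n :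
    splitting B -> simple S -> low n.+1 S -> ~ low n S ->
    projective P -> local_over p -> projective (resB X) ->
    (forall R (w : 'Hom(resB X, R)), simple R -> is_hom w ->
       (forall z, exists y, w y = z) -> low n.+1 R) ->
    (exists f : 'Hom(resB X, S), is_hom f /\ exists x, f x <> 0) ->
  exists (X' : lmod AB) (i : 'Hom(tens_lmod (T (D S) X) P, X)) (c : 'Hom(X, X')),
  [/\ short_exact i c, (dim X' < dim X)%N, projective (resB X'),
      forall R, simple R -> isomorphic R S -> forall t : T (D R) X', t = 0
    & forall R, simple R -> ~ isomorphic R S ->
        isomorphic (T (D R) X) (T (D R) X')].
Proof.
move=> Bs sS lS nS prP lp prX topX [f0 [hf0 [x0 f0x]]]; have [hp ps _] := lp.
have [m [h [q [hhq qh eS eP]]]] := isotypic_split Bs sS lS nS prP lp prX topX.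
have hh j : is_hom (h j) by case: (hhq j).
have hq j : is_hom (q j) by case: (hhq j).
(* The coordinates on D(S) ⊗_B X are the functionals that belong to the maps p q_j : X -> S. *)
have wex j : exists F : 'Hom(T (D S) X, k^o), forall (phi : 'Hom(S, k^o)) (x : X),
    F (tcl (V := D S) phi x) = phi (p (q j x)).
  have [F FE] := hom_functional (hom_comp hp (hq j)).
  by exists F => phi x; rewrite FE comp_lfunE.
pose om j := proj1_sig (constructive_indefinite_description _ (wex j)).
have omE j (phi : 'Hom(S, k^o)) (x : X) : om j (tcl (V := D S) phi x) = phi (p (q j x)).
  exact: (proj2_sig (constructive_indefinite_description _ (wex j))).
clearbody om.
have [s s0] := simple_neq0 sS; have [y0 y0E] := ps s.
have [phi phis] := functional_exists s0.
have omdual j : (j < m)%N -> exists t, forall i, (i < m)%N -> om i t = (i == j)%:R.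
  move=> jm; exists (tcl (V := D S) phi (h j y0 : X)) => i im.
  rewrite omE qh // (lfunZ p) y0E (lfunZ phi) phis; exact: mulr1.
(* A functional is a map X -> S; it is determined on the copies of P, where it is a multiple of
   p. *)
have omspan (f : 'Hom(T (D S) X, k^o)) : exists c : nat -> k,
    forall t, f t = \sum_(j < m) c j * om j t.
  have [w hw wE] := functional_hom f.
  have cex j : exists c, forall y, w (h j y) = c *: p y.
    have [c cE] := local_hom Bs sS lS nS prP lp (hom_comp hw (hh j)).
    by exists c => y; rewrite -cE comp_lfunE.
  pose c j := proj1_sig (constructive_indefinite_description _ (cex j)).
  have cE j y : w (h j y) = c j *: p y.
    exact: (proj2_sig (constructive_indefinite_description _ (cex j))).
  clearbody c; exists c => t.
  transitivity ((\sum_(j < m) c j *: om j) t); last first.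
    by rewrite sum_lfunE; apply: eq_bigr => j _; rewrite scale_lfunE.
  move: t; apply: tens_over_eq => psi x.
  rewrite sum_lfunE wE (eS _ _ (isomorphic_refl S) hw x) (lfun_sum psi).
  by apply: eq_bigr => j _; rewrite scale_lfunE omE cE (lfunZ psi).
have omact a : exists c : nat -> nat -> k,
    (forall j y, lact X (tpure a 1) (h j y) = \sum_(i < m) c i j *: h i y) /\
    (forall i t, om i (lact (T (D S) X) a t) = \sum_(j < m) c i j * om j t).
  have ha := lact_hom X a.
  have cex i j : exists c, forall y, q i (lact X (tpure a 1) (h j y)) = c *: y.
    have [c cE] := local_end Bs sS lS nS prP lp (hom_comp (hq i) (hom_comp ha (hh j))).
    by exists c => y'; have := cE y'; rewrite !comp_lfunE.
  pose c i j := proj1_sig (constructive_indefinite_description _ (cex i j)).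
  have cE i j y' : q i (lact X (tpure a 1) (h j y')) = c i j *: y'.
    exact: (proj2_sig (constructive_indefinite_description _ (cex i j))).
  clearbody c; exists c; split=> [j y | i t].
    have := eP _ (hom_comp ha (hh j)) y; rewrite !comp_lfunE => ->.
    by apply: eq_bigr => i _; rewrite cE linearZ.
  transitivity ((\sum_(j < m) c i j *: om j) t); last first.
    by rewrite sum_lfunE; apply: eq_bigr => j _; rewrite scale_lfunE.
  rewrite -[LHS]comp_lfunE; move: t; apply: tens_over_eq => psi x.
  rewrite [LHS]comp_lfunE tcl_act sum_lfunE omE.
  have := eS _ _ (isomorphic_refl S) (hom_comp hp (hom_comp (hq i) ha)) x.
  rewrite !comp_lfunE => ->; rewrite (lfun_sum psi); apply: eq_bigr => j _.
  by rewrite !comp_lfunE cE (lfunZ p) (lfunZ psi) scale_lfunE omE.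
have [Phi [hPhi iPhi kill Phih]] := isotypic_embedding hh qh omact omspan omdual.
clear omact omspan omdual omE.
have [X' [c Phic]] := quot_exact hPhi iPhi.
exists X', Phi, c; have [_ hc _ _ _] := Phic.
have hc' := res_hom hc.
have /short_exactP[_ _ _ [cPhi cex] cs] := Phic.
have ch j y : (j < m)%N -> c (h j y) = 0 by move=> jm; have [z <-] := Phih j y jm.
split=> //.
- rewrite (dim_short_exact Phic) -[X in (X < _)%N]add0n ltn_add2r; apply/dim_gt0P.
  apply: NNPP => nz; apply: f0x; rewrite (eS _ _ (isomorphic_refl S) hf0 x0).
  rewrite big1 // => j _; have [z <-] := Phih j (q j x0) (ltn_ord j).
  have -> : z = 0 by apply: NNPP => z0; apply: nz; exists z.
  by rewrite !linear0.
(* Over B the projection d kills P^m and so factors through X', which makes X' a B-summand of X. *)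
- pose d : 'End(resB X) := \1%VF - \sum_(j < m) (h j \o q j)%VF.
  have hd : is_hom d.
    by apply: homB; [exact: hom1 | apply: hom_sum => j; exact: hom_comp].
  have dE x : d x = x - \sum_(j < m) h j (q j x).
    rewrite add_lfunE opp_lfunE id_lfunE sum_lfunE; congr (_ - _).
    by apply: eq_bigr => j _; rewrite comp_lfunE.
  have [r hr rE] : exists2 r : 'Hom(resB X', resB X), is_hom r & forall x, r (c x) = d x.
    apply: (hom_factor_epi hc') => // x /cex[z <-]; apply: (kill _ (d : 'Hom(X, X))) => j y jm.
    by have -> := dE (h j y); rewrite -(eP _ (hh j)) subrr.
  apply: (add_closed_retract projective_add_closed hc' hr _ prX) => z.
  have [x <-] := cs z; rewrite rE dE linearB /= linear_sum big1 ?subr0 // => j _.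
  exact: ch.
- move=> R sR RS t; apply: functional_separates => F.
  have [w hw wE] := functional_hom F.
  have w0 z : w z = 0.
    have [x <-] := cs z; rewrite -[w _](comp_lfunE w (c : 'Hom(resB X, resB X'))).
    rewrite (eS _ _ RS (hom_comp hw hc') x) big1 // => j _.
    by rewrite comp_lfunE ch // linear0.
  rewrite -[RHS](zero_lfunE _ t); move: t; apply: tens_over_eq => psi x.
  by rewrite wE w0 linear0 zero_lfunE.
(* There is no nonzero map P -> R, so Hom_B(X', R) = Hom_B(X, R), and by duality D(R) ⊗_B X -> D(R)
   ⊗_B X' is injective. *)
move=> R sR nRS; have [Tc TcE] := tens_induced_exists (D R) hc.
apply/isomorphicP; exists Tc; split.
- exact: tens_induced_hom TcE.
- move=> t Tct; apply: functional_separates => F.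
  have [w hw wE] := functional_hom F.
  have [w' hw' w'E] : exists2 w' : 'Hom(resB X', R), is_hom w' & forall x, w' (c x) = w x.
    apply: (hom_factor_epi hc') => // x /cex[z <-]; apply: (kill _ (w : 'Hom(X, R))) => j y jm.
    apply: NNPP => why; apply: nRS.
    by apply: (local_top sS lp sR (hom_comp hw (hh j))); exists y; rewrite comp_lfunE.
  have [F' F'E] := hom_functional hw'.
  transitivity (F' (Tc t)); last by rewrite Tct linear0.
  rewrite -[RHS]comp_lfunE; move: t {Tct}; apply: tens_over_eq => psi x.
  by rewrite comp_lfunE TcE wE F'E w'E.
- exact: tens_induced_epi TcE cs.
Qed.

(** Induction on dim X by [peel_top]. The quotient X' satisfies the hypotheses again, since each
    D(R) ⊗_B X' is zero or isomorphic to D(R) ⊗_B X; the zero object of L covers the first case. *)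
Lemma projective_fil L X :
    triangular B -> splitting B -> iso_closed L ->
    (exists2 M : lmod A, L M & forall x : M, x = 0) ->
    projective (resB X) -> (forall S, simple S -> L (T (D S) X)) ->
  fil (tens_class L (@projective k B)) X.
Proof.
move=> /triangular_low[N Nlow] Bs Liso [Z LZ Z0].
have [n] := ubnP (dim X); elim: n X => // n IH X; rewrite ltnS => Xn prX LX.
case: (classic (exists x : X, x <> 0)) => [x0 | nx]; last first.
  by apply: fil_zero => x; apply: NNPP => x0; apply: nx; exists x.
pose Q l := forall R (w : 'Hom(resB X, R)), simple R -> is_hom w ->
  (forall z, exists y, w y = z) -> low l R.
(* The simple quotients of X have level at most l + 1, and some S among them exceeds level l: it is
   of maximal level, as [peel_top] requires. *)
have [l [Ql nQl]] : exists l, Q l.+1 /\ ~ Q l.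
  apply: (@nat_switch Q N) => [R w sR _ _ | Q0]; first exact: Nlow.
  by have [S [f [sS hf fs]]] := simple_quotient_exists (M := resB X) x0; exact: Q0 hf fs.
have [S [f [sS hf fs nS]]] : exists (S : lmod B) (f : 'Hom(resB X, S)),
    [/\ simple S, is_hom f, forall z, exists y, f y = z & ~ low l S].
  apply: NNPP => nS; apply: nQl => R w sR hw ws; apply: NNPP => lR.
  by apply: nS; exists R, w.
have [P [p [prP lp]]] := projective_cover_exists sS.
have f0 : exists f : 'Hom(resB X, S), is_hom f /\ exists x, f x <> 0.
  exists f; split=> //; have [s s0] := simple_neq0 sS; have [x xE] := fs s.
  by exists x; rewrite xE.
have [X' [i [c [ic dX' prX' TS TnS]]]] := peel_top Bs sS (Ql _ _ sS hf fs) nS prP lp prX Ql f0.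
apply: (fil_ext ic).
  by apply: fil_in; exists (T (D S) X), P; split=> //; [exact: LX | exact: isomorphic_refl].
apply: IH => // [|R sR]; first exact: leq_trans dX' Xn.
case: (classic (isomorphic R S)) => [RS | nRS]; last exact: Liso (TnS R sR nRS) (LX R sR).
apply: Liso LZ; apply/isomorphicP; exists 0; split=> //; first exact: hom0.
by move=> z; exists 0; rewrite linear0 (TS R sR RS z).
Qed.

End Peeling.

(** * Equality of the three categories *)

Theorem theoremC (k : fieldType) (A B : falgType k)
    (B_triangular : triangular B) (B_split : splitting B) :
  [/\ forall X : lmod (tens A B),
        Gproj X <-> MonIn (Gproj (A := A)) X,
      forall X : lmod (tens A B),
        MonIn (Gproj (A := A)) X <->
        filt (tens_class (Gproj (A := A)) (Gproj (A := B))) X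
    & smallest_ext_closed (tens_class (Gproj (A := A)) (Gproj (A := B)))
        (filt (tens_class (Gproj (A := A)) (Gproj (A := B)))) ].
Proof.
have zero_Gproj (C : falgType k) : exists2 Z : lmod C, Gproj Z & forall x : Z, x = 0.
  have [Z Z0] := zero_mod_exists (A := C).
  by exists Z => //; apply: projective_Gproj; exact: projective_zero.
have Mon_fil X : MonIn (Gproj (A := A)) X ->
    fil (tens_class (Gproj (A := A)) (Gproj (A := B))) X.
  move=> [/MonP prX GX].
  apply: (@fil_sub _ _ (tens_class (Gproj (A := A)) (@projective k B))).
    move=> M [G [P [gG prP MGP]]]; exists G, P; split=> //; exact: projective_Gproj.
  by apply: projective_fil => //; exact: Gproj_iso_closed.
split=> [X | X |].
- split=> [|/Mon_fil]; first exact: Gproj_MonIn.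
  exact: fil_Gproj.
- split=> [/Mon_fil | /filt_fil FX]; first exact: fil_filt.
  by apply: Gproj_MonIn => //; exact: fil_Gproj FX.
apply: filt_smallest_ext_closed; have [Z gZ Z0] := zero_Gproj A.
have [Y gY _] := zero_Gproj B.
exists (tens_lmod Z Y); first by exists Z, Y; split=> //; exact: isomorphic_refl.
move=> t; elim/(@tens_ind k Z Y): t => [x y | s s' -> ->]; last exact: addr0.
by rewrite (Z0 x) tpure0l.
Qed.
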